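(* Let $n\ge 3$, $\alpha\in(0,1)$, and let $(\Omega,g,\pi)$ be an $n$-dimensional compact initial data set with nonempty smooth boundary, such that $(g,\pi)\in C^{4,\alpha}(\Omega)\times C^{3,\alpha}(\Omega)$ and also $(g,\pi)\in C^5_{\mathrm{loc}}(\operatorname{Int}\Omega)\times C^4_{\mathrm{loc}}(\operatorname{Int}\Omega)$. Let $B$ be an open ball in $\operatorname{Int}\Omega$, and let $\delta>0$. Then there is a $C^{4,\alpha}(\Omega)\times C^{3,\alpha}(\Omega)$ neighborhood $\mathcal U$ of $(g,\pi)$ such that for any $V\subset\subset\operatorname{Int}\Omega$, there exist constants $\epsilon,C>0$ such that the following holds: for $(\gamma,\tau)\in\mathcal U$ and $u\in C^{0,\alpha}_c(V)$ with $\|u\|_{C^{0,\alpha}(\Omega)}<\epsilon$, there exists $(h,w)\in C^{2,\alpha}_c(\operatorname{Int}\Omega)$ with $\|(h,w)\|_{C^{2,\alpha}(\Omega)}\le C\|u\|_{C^{0,\alpha}(\Omega)}$ such that the initial data set $(\gamma+h,\tau+w)$ satisfies $$\sigma(\gamma+h,\tau+w)\ge\sigma(\gamma,\tau)+u-\delta\mathbf 1_B,$$ where $\mathbf 1_B$ is the indicator function of $B$.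
   Context: An initial data set $(U,g,\pi)$ consists of a connected smooth $n$-manifold $U$ ($n\ge3$), a Riemannian metric $g$ and a symmetric $(2,0)$-tensor $\pi$. Its energy and current densities are $\mu=\tfrac12\big(R_g+\tfrac1{n-1}(\operatorname{tr}_g\pi)^2-|\pi|_g^2\big)$ and $J=\operatorname{div}_g\pi$ (a vector field), and the dominant energy scalar is $\sigma(g,\pi)=2(\mu-|J|_g)$. In the claim, $h$ is a symmetric $(0,2)$-tensor and $w$ a symmetric $(2,0)$-tensor. The subscript $c$ denotes compact support. *)

(* Defs.v *)
From HB Require Import structures.
From mathcomp Require Import all_boot all_order all_algebra.
From mathcomp Require Import all_classical all_reals all_analysis.

Set Implicit Arguments.
Unset Strict Implicit.
Unset Printing Implicit Defensive.

Import Order.TTheory GRing.Theory Num.Theory.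
Import numFieldNormedType.Exports.

Local Open Scope classical_set_scope.
Local Open Scope ring_scope.

(** Smooth manifolds with boundary are given by atlases with values in a closed
    half-space of R^n; tensor fields are families of components, one for each
    chart, subject to the usual transformation law. *)

Section Calculus.
Context {R : realType} {n : nat}.
Implicit Types (x y : 'rV[R]_n) (f : 'rV[R]_n -> R) (s : seq 'I_n).

Definition halfspace : set 'rV[R]_n :=
  [set x | forall a : 'I_n, a = 0%N :> nat -> 0 <= x 0 a].

(* The increments are restricted to those that stay in the half-space: this is
   the ordinary partial derivative off the boundary hyperplane (see [pdE]) and
   the one-sided derivative across that hyperplane at its points. *)
Definition incr (a : 'I_n) x : set_system R :=
  within [set t | halfspace (x + t *: delta_mx 0 a)] 0^'.

Definition dquot (a : 'I_n) f x (t : R) : R :=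
  t^-1 * (f (x + t *: delta_mx 0 a) - f x).

Definition pd (a : 'I_n) f x : R := lim (dquot a f x @ incr a x).

Definition pds s f : 'rV[R]_n -> R := foldr pd f s.

(* [f] is C^k, up to the boundary hyperplane, on a relatively open subset [D]
   of the half-space. *)
Definition Ck (k : nat) (D : set 'rV[R]_n) f : Prop :=
  (forall s, (size s <= k)%N -> {within D, continuous (pds s f)}) /\
  (forall s a x, (size s < k)%N -> D x -> cvg (dquot a (pds s f) x @ incr a x)).

(* The element 0 only matters for empty [A]. *)
Definition esup0 (A : set \bar R) : \bar R := ereal_sup (0%E |` A).

Definition sup_norm (D : set 'rV[R]_n) f : \bar R :=
  esup0 [set `|f x|%:E | x in D].

(* [`|x - y|] is the l^oo norm of R^n, equivalent to the Euclidean one. *)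
Definition holder_seminorm (alpha : R) (D : set 'rV[R]_n) f : \bar R :=
  esup0 [set z | exists x y, [/\ D x, D y, x != y &
    z = (`|f x - f y| / `|x - y| `^ alpha)%:E]].

Definition holder_norm (k : nat) (alpha : R) (D : set 'rV[R]_n) f : \bar R :=
  (\sum_(j < k.+1) \sum_(s : j.-tuple 'I_n) sup_norm D (pds s f) +
   \sum_(s : k.-tuple 'I_n) holder_seminorm alpha D (pds s f))%E.

(* Local expressions, for the matrix-valued functions [G] and [P] giving the
   components g_ab and pi^ab in a coordinate system. *)
Implicit Types G P : 'rV[R]_n -> 'M[R]_n.

(* Gamma^c_ab *)
Definition christoffel G (c a b : 'I_n) x : R :=
  2^-1 * \sum_d invmx (G x) c d *
    (pd a (fun y => G y b d) x + pd b (fun y => G y a d) x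
     - pd d (fun y => G y a b) x).

(* Sign convention: the round sphere has positive Ricci curvature. *)
Definition ricci G (a b : 'I_n) x : R :=
  \sum_c (pd c (christoffel G c a b) x - pd a (christoffel G c c b) x
    + \sum_d (christoffel G c c d x * christoffel G d a b x
              - christoffel G c a d x * christoffel G d c b x)).

Definition scalar_curvature G x : R :=
  \sum_a \sum_b invmx (G x) a b * ricci G a b x.

Definition tr_g G P x : R := \sum_a \sum_b G x a b * P x a b.

Definition normsq_g G P x : R :=
  \sum_a \sum_b \sum_c \sum_d G x a c * G x b d * P x a b * P x c d.

Definition energy_density G P x : R :=
  2^-1 * (scalar_curvature G x + (n%:R - 1)^-1 * tr_g G P x ^+ 2
          - normsq_g G P x).

(* J^a = nabla_b pi^ab *)
Definition current_density G P (a : 'I_n) x : R :=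
  \sum_b (pd b (fun y => P y a b) x
    + \sum_c (christoffel G a b c x * P x c b
              + christoffel G b b c x * P x a c)).

Definition normJ G P x : R :=
  Num.sqrt (\sum_a \sum_b
    G x a b * current_density G P a x * current_density G P b x).

Definition sigma_loc G P x : R := 2 * (energy_density G P x - normJ G P x).

Lemma pdE (a : 'I_n) f x :
  (forall b : 'I_n, b = 0%N :> nat -> 0 < x 0 b) ->
  pd a f x = 'D_(delta_mx 0 a) f x.
Proof.
move=> x_gt0; rewrite /pd /derive.
have near_in : \forall t \near 0^', halfspace (x + t *: delta_mx 0 a).
  apply: nbhs_dnbhs; rewrite /halfspace /=.
  have [b00|nob] := pselect (exists b : 'I_n, b = 0%N :> nat); last first.
    by near=> t => b bE; case: nob; exists b.
  have [b bE] := b00.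
  have small : \forall t \near nbhs (0 : R), `|t| < x 0 b.
    by exact: (@nbhs0_lt R R^o _ (x_gt0 b bE)).
  near=> t => c cE.
  have -> : c = b by apply/val_inj => /=; rewrite cE bE.
  have : `|t| < x 0 b by near: t.
  rewrite !mxE eqxx /= ltr_norml => /andP[/ltW h _].
  case: (b == a); rewrite ?mulr1 ?mulr0 ?addr0 ?(ltW (x_gt0 _ bE))//.
  by rewrite addrC -[t + _]opprK oppr_ge0 opprD subr_le0 lerNl.
have -> : incr a x = 0^'.
  rewrite eqEsubset; split => A; rewrite /incr /within /= => PA.
    by near=> t; apply: (near PA t) => //; near: t.
  by near=> t => _; near: t.
suff -> : dquot a f x =
    (fun h => h^-1 *: ((f \o shift x) (h *: delta_mx 0 a) - f x)) by [].
by apply/funext => t; rewrite /dquot /= [_ + x]addrC.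
Unshelve. all: by end_near.
Qed.

End Calculus.

(* A smooth atlas with boundary on [M]; [chart] may be any index type. *)
Record bd_atlas (R : realType) (n : nat) (M : topologicalType) := BdAtlas {
  chart : Type;
  dom : chart -> set M;
  coord : chart -> M -> 'rV[R]_n;
  param : chart -> 'rV[R]_n -> M;
  chart_at : M -> chart;
  dom_chart_at : forall p, dom (chart_at p) p;
  open_dom : forall i, open (dom i);
  open_image : forall i, exists2 O : set 'rV[R]_n,
    open O & coord i @` dom i = O `&` halfspace;
  coordK : forall i p, dom i p -> param i (coord i p) = p;
  coord_cont : forall i, {within dom i, continuous (coord i)};
  param_cont : forall i, {within coord i @` dom i, continuous (param i)};
  transition_smooth : forall i j k (b : 'I_n),
    Ck k (coord i @` (dom i `&` dom j)) (fun x => coord j (param i x) 0 b)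
}.

Section Geometry.
Context {R : realType} {n : nat} {M : topologicalType} (A : bd_atlas R n M).

Definition Int : set M :=
  [set p | exists2 i : chart A, dom i p &
    forall a : 'I_n, a = 0%N :> nat -> 0 < coord i p 0 a].

(* The entry (a, b) is d y^b / d x^a, with x = coord i and y = coord j. *)
Definition jacobian (i j : chart A) (p : M) : 'M[R]_n :=
  \matrix_(a, b) pd a (fun x => coord j (param i x) 0 b) (coord i p).

(* Components in all the charts; [h i p] is irrelevant for p outside [dom i]. *)
Definition tensor := chart A -> M -> 'M[R]_n.

Definition sym_field (h : tensor) : Prop :=
  forall i p, dom i p -> (h i p)^T = h i p.

(* symmetric (0,2)-tensor fields *)
Definition sym_02 (h : tensor) : Prop :=
  sym_field h /\
  forall i j p, dom i p -> dom j p ->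
    h i p = jacobian i j p *m h j p *m (jacobian i j p)^T.

(* symmetric (2,0)-tensor fields *)
Definition sym_20 (w : tensor) : Prop :=
  sym_field w /\
  forall i j p, dom i p -> dom j p ->
    w j p = (jacobian i j p)^T *m w i p *m jacobian i j p.

Definition riemannian (g : tensor) : Prop :=
  sym_02 g /\
  forall i p, dom i p -> forall v : 'rV[R]_n, v != 0 ->
    0 < (v *m g i p *m v^T) 0 0.

(* The last condition makes the norms below independent, up to equivalence, of
   the choice of the cover. *)
Record norm_cover := NormCover {
  csize : nat;
  cchart : 'I_csize -> chart A;
  cset : 'I_csize -> set M;
  cset_compact : forall m, compact (cset m);
  cset_dom : forall m, cset m `<=` dom (cchart m);
  cset_cover : forall p, exists m, (cset m)° p
}.

Definition Ck_fun (k : nat) (D : set M) (f : chart A -> M -> R) : Prop :=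
  forall i, Ck k (coord i @` (dom i `&` D)) (fun x => f i (param i x)).

Definition Ck_field (k : nat) (D : set M) (h : tensor) : Prop :=
  forall a b, Ck_fun k D (fun i p => h i p a b).

Section HolderSpaces.
Variables (K : norm_cover) (k : nat) (alpha : R).

Definition norm_comp (f : chart A -> M -> R) : \bar R :=
  (\sum_(m < csize K) holder_norm k alpha (coord (cchart m) @` cset m)
     (fun x => f (cchart m) (param (cchart m) x)))%E.

Definition norm_fun (u : M -> R) : \bar R := norm_comp (fun _ => u).

Definition norm_field (h : tensor) : \bar R :=
  (\sum_a \sum_b norm_comp (fun i p => h i p a b))%E.

Definition holder_fun (u : M -> R) : Prop :=
  Ck_fun k setT (fun _ => u) /\ (norm_fun u < +oo)%E.

Definition holder_field (h : tensor) : Prop :=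
  Ck_field k setT h /\ (norm_field h < +oo)%E.

End HolderSpaces.

Definition supp_fun (u : M -> R) : set M := closure [set p | u p != 0].

Definition supp_field (h : tensor) : set M :=
  closure [set p | exists2 i, dom i p & h i p != 0].

Definition tensorD (h h' : tensor) : tensor := fun i p => h i p + h' i p.
Definition tensorB (h h' : tensor) : tensor := fun i p => h i p - h' i p.

(* The dominant energy scalar. It does not depend on the coordinates, hence not
   on [chart_at]. *)
Definition sigma (g pi : tensor) (p : M) : R :=
  let i := chart_at A p in
  sigma_loc (fun x => g i (param i x)) (fun x => pi i (param i x)) (coord i p).

Definition C1_curve (c : R -> M) : Prop :=
  continuous c /\
  forall t (i : chart A), dom i (c t) -> forall b : 'I_n,
    let cb := fun s : R => coord i (c s) 0 b in
    derivable cb t 1 /\ {for t, continuous (derive1 cb)}.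

Definition velocity (c : R -> M) (t : R) : 'rV[R]_n :=
  \row_b derive1 (fun s : R => coord (chart_at A (c t)) (c s) 0 b) t.

Definition speed (g : tensor) (c : R -> M) (t : R) : R :=
  Num.sqrt ((velocity c t *m g (chart_at A (c t)) (c t) *m
             (velocity c t)^T) 0 0).

Definition curve_length (g : tensor) (c : R -> M) : \bar R :=
  (\int[lebesgue_measure]_(t in `[0%R, 1%R]) (speed g c t)%:E)%E.

(* Open ball for the Riemannian distance. The curves are C^1 on the whole line:
   up to a reparametrization with vanishing velocities at the nodes and at the
   end points, these restrict to all piecewise C^1 curves on [0, 1]. *)
Definition metric_ball (g : tensor) (p : M) (r : R) : set M :=
  [set q | exists c : R -> M,
    [/\ C1_curve c, c 0 = p, c 1 = q & (curve_length g c < r%:E)%E]].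

(* Pairs (gamma, tau) in C^{4,alpha} x C^{3,alpha} that form an initial data
   set. *)
Definition init_data (K : norm_cover) (alpha : R)
    (x : tensor * tensor) : Prop :=
  [/\ riemannian x.1, sym_20 x.2,
      holder_field K 4 alpha x.1 & holder_field K 3 alpha x.2].

(* C^{4,alpha} x C^{3,alpha} neighborhood, within initial data sets (Riemannian
   metrics form an open subset of the symmetric tensor fields). *)
Definition data_nbhs (K : norm_cover) (alpha : R) (x : tensor * tensor)
    (U : set (tensor * tensor)) : Prop :=
  U `<=` [set y | init_data K alpha y] /\
  exists2 r : R, 0 < r & forall y, init_data K alpha y ->
    (norm_field K 4 alpha (tensorB y.1 x.1) +
     norm_field K 3 alpha (tensorB y.2 x.2) < r%:E)%E -> U y.

End Geometry.

(* Main.v *)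
Require Import Defs.
From HB Require Import structures.
From mathcomp Require Import all_boot all_order all_algebra.
From mathcomp Require Import all_classical all_reals all_analysis.
From mathcomp Require Import measurable_realfun ring lra.

Set Implicit Arguments.
Unset Strict Implicit.
Unset Printing Implicit Defensive.

Import Order.TTheory GRing.Theory Num.Theory.
Import numFieldNormedType.Exports.

Local Open Scope classical_set_scope.
Local Open Scope ring_scope.

(** The perturbation is [h = t f g] and [w = 0], with [t] the norm of [u] and [f <= 0]
    a fixed function with compact support in the interior. Conformal changes act on the
    scalar curvature through an elliptic operator, and the norm of J only costs first
    derivatives of [h]: uniformly for data close to [(g, pi)], sigma increases by at least
    [t P f], where [P f = - a^ij d_i d_j f - C (|f| + |df|)] for some [a] in a fixed
    elliptic class. So it is enough to find [f] with [P f >= 0] off the ball and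
    [P f >= 1] on [V] minus the ball: the loss [O(t)] inside the ball is absorbed by
    [delta]. With [k] large, [f = - (r^2 - |x - x0|^2)_+^k] satisfies [P f >= c > 0] on
    compact subsets of its support, except near the center [x0]; the center is repaired
    by adding a large multiple of a function already found that works near [x0].
    Starting from the given ball, chains of coordinate balls thus reach every interior
    point, the manifold being connected, and finitely many of the resulting functions
    are added up. *)

(** * Partial derivatives and C^k functions up to the boundary hyperplane *)

(** The function f is fixed before gamma, tau and u, while the coefficients a belong to the
    perturbed metric. The inequality for P must therefore hold for all matrices of the elliptic
    class at once. The infimum of P f over the class is superadditive and positively homogeneous in
    f, so subsolutions may be added and rescaled. A nonzero f <= 0 with compact support has a
    negative minimum in the interior, where P f < 0: this is why some ball must be exempted, and why
    the center of each bump causes trouble. Sigma is not differentiable where J vanishes, so it is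
    not linearized. The norm of the new J is bounded above by the triangle inequality for the
    perturbed metric. As f <= 0, this metric is smaller than the old one, and the norm of the old J
    does not grow. The same sign makes the leading term k (k - 1) psi^(k-2) a(d psi, d psi) of a
    bump - psi^k a gain. The direction of the perturbation is the fixed g and not gamma: the Hoelder
    norm of h is then t times one constant, and the symbol stays elliptic since gamma is close to
    g. *)

Section Derivative.
Context {R : realType} {n : nat}.
Implicit Types (x y : 'rV[R]_n) (f g : 'rV[R]_n -> R) (a b : 'I_n).

Local Notation E a := (delta_mx 0 a : 'rV[R]_n).

(** Neighborhoods relative to the half-space: interior charts and boundary charts share one
    calculus. *)
Definition hnbhs x : set_system 'rV[R]_n := within halfspace (nbhs x).

#[global] Instance hnbhs_filter x : Filter (hnbhs x).
Proof. exact: within_filter. Qed.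

#[global] Instance incr_filter a x : Filter (incr a x).
Proof. exact: within_filter. Qed.

Lemma rowv_normP x e : 0 <= e -> (forall b, `|x 0 b| <= e) -> `|x| <= e.
Proof.
move=> e0 h; rewrite [leLHS]/Num.Def.normr /= mx_normrE.
by apply: bigmax_le => // -[i j] _ /=; rewrite (ord1 i).
Qed.

Lemma ler_coord_norm x b : `|x 0 b| <= `|x|.
Proof.
rewrite [leRHS]/Num.Def.normr /= mx_normrE.
exact: (le_bigmax _ (fun ij : 'I_1 * 'I_n => `|x ij.1 ij.2|) (0, b)).
Qed.

Lemma norm_deltaZ (t : R) a : `|t *: E a| = `|t|.
Proof.
apply/eqP; rewrite eq_le; apply/andP; split.
  apply: rowv_normP => // b; rewrite !mxE eqxx /=.
  by case: (b == a); rewrite ?mulr1 ?mulr0 ?normr0.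
by apply: le_trans (ler_coord_norm _ a); rewrite !mxE !eqxx mulr1.
Qed.

Lemma coord_shift x (t : R) a b : (x + t *: E a) 0 b = x 0 b + t * (b == a)%:R.
Proof. by rewrite !mxE eqxx. Qed.

Lemma hnbhsP x (P : set 'rV[R]_n) : hnbhs x P <->
  exists2 d : R, 0 < d & forall y, halfspace y -> `|y - x| < d -> P y.
Proof.
split.
  move=> H; have /nbhs_normP[d /= d0 h] : \forall y \near x, halfspace y -> P y := H.
  by exists d => // y hy xy; apply: h => //=; rewrite /ball_ /= distrC.
move=> [d d0 h]; suff : \forall y \near x, halfspace y -> P y by [].
apply/nbhs_normP; exists d => //= y; rewrite /ball_ /= => xy hy.
by apply: h => //; rewrite distrC.
Qed.

Lemma incrP a x (P : set R) : incr a x P <->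
  exists2 d : R, 0 < d &
    forall t, t != 0 -> `|t| < d -> halfspace (x + t *: E a) -> P t.
Proof.
split.
  move=> H; have /nbhs_normP[d /= d0 h] : \forall t \near (0 : R),
    t != 0 -> halfspace (x + t *: E a) -> P t := H.
  by exists d => // t t0 td ht; apply: h => //=; rewrite /ball_ /= sub0r normrN.
move=> [d d0 h].
suff : \forall t \near (0 : R), t != 0 -> halfspace (x + t *: E a) -> P t by [].
apply/nbhs_normP; exists d => //= t.
by rewrite /ball_ /= sub0r normrN => td t0 ht; exact: h.
Qed.

Lemma halfspace_shift x (t : R) a : halfspace x -> 0 <= t ->
  halfspace (x + t *: E a).
Proof.
move=> hx t0 b b0; rewrite coord_shift addr_ge0//; first exact: hx.
by rewrite mulr_ge0.
Qed.

(** Positive increments never leave the half-space, so even at the wall limits of difference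
    quotients are unique. *)
Lemma incr_proper a x : halfspace x -> ProperFilter (incr a x).
Proof.
move=> hx; apply: Build_ProperFilter_ex => P /incrP[d d0 h].
exists (d / 2); apply: h.
- by rewrite gt_eqF// divr_gt0.
- by rewrite gtr0_norm ?divr_gt0// ltr_pdivrMr// ltr_pMr// ltr1n.
- by apply: halfspace_shift => //; rewrite ltW// divr_gt0.
Qed.

Lemma incr_hnbhs a x (P : set 'rV[R]_n) : hnbhs x P ->
  \forall t \near incr a x, P (x + t *: E a).
Proof.
move=> /hnbhsP[d d0 h]; apply/incrP; exists d => // t t0 td ht; apply: h => //.
by rewrite addrC addKr norm_deltaZ.
Qed.

Lemma incr_neq0 a x : \forall t \near incr a x, t != 0.
Proof. by apply/incrP; exists 1. Qed.

Lemma hnbhs_self x (P : set 'rV[R]_n) : halfspace x -> hnbhs x P -> P x.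
Proof. by move=> hx /hnbhsP[d d0]; apply=> //; rewrite subrr normr0. Qed.

Lemma hnbhs_open x (P : set 'rV[R]_n) : hnbhs x P ->
  \forall y \near hnbhs x, hnbhs y P.
Proof.
move=> /hnbhsP[d d0 h]; apply/hnbhsP; exists (d / 2); first by rewrite divr_gt0.
move=> y hy yx; apply/hnbhsP; exists (d / 2); first by rewrite divr_gt0.
move=> z hz zy; apply: h => //; rewrite -(subrKA y) (le_lt_trans (ler_normD _ _))//.
by rewrite [ltRHS](splitr d) ltrD.
Qed.

Lemma cvg_near_eq {T : Type} (F : set_system T) {FF : Filter F} (f g : T -> R)
    (l : R) : (\forall t \near F, f t = g t) -> f @ F --> l -> g @ F --> l.
Proof. by move=> fg h; apply: cvg_trans h; exact: near_eq_cvg. Qed.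

(** Asserts that the limit exists, whereas [pd] has a value in any case. *)
Definition der a f x (l : R) := dquot a f x t @[t --> incr a x] --> l.

Lemma pd_der a f x (l : R) : halfspace x -> der a f x l -> pd a f x = l.
Proof.
move=> hx h; apply: cvg_lim => //.
by have := incr_proper a hx.
Qed.

Lemma der_pd a f x : cvg (dquot a f x t @[t --> incr a x]) -> der a f x (pd a f x).
Proof. by []. Qed.

Lemma der_dble a f x l : der a f x l -> cvg (dquot a f x t @[t --> incr a x]).
Proof. by move=> h; apply/cvg_ex; exists l. Qed.

Lemma eq_dquot_lim a f g x : halfspace x -> (\forall y \near hnbhs x, f y = g y) ->
  forall F, (dquot a f x t @[t --> incr a x]) `=>` F <->
            (dquot a g x t @[t --> incr a x]) `=>` F.
Proof.
move=> hx fg F.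
have fgx := hnbhs_self hx fg.
have fgt : \forall t \near incr a x, dquot a f x t = dquot a g x t.
  apply: filterS (incr_hnbhs a fg) => t /= tE.
  by rewrite /dquot tE fgx.
by split=> h; apply: cvg_trans h; apply: near_eq_cvg => //;
   apply: filterS fgt => t ->.
Qed.

Lemma eq_der a f g x l : halfspace x -> (\forall y \near hnbhs x, f y = g y) ->
  der a f x l -> der a g x l.
Proof. by move=> hx fg; apply: (iffLR (eq_dquot_lim a hx fg _)). Qed.

Lemma eq_dble a f g x : halfspace x -> (\forall y \near hnbhs x, f y = g y) ->
  cvg (dquot a f x t @[t --> incr a x]) -> cvg (dquot a g x t @[t --> incr a x]).
Proof. by move=> hx fg h; apply: der_dble (eq_der hx fg (der_pd h)). Qed.

(* No differentiability is assumed: the limits of both difference quotients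
   are the same choice. *)
Lemma eq_pd a f g x : halfspace x -> (\forall y \near hnbhs x, f y = g y) ->
  pd a f x = pd a g x.
Proof.
move=> hx fg; have h := eq_dquot_lim a hx fg.
rewrite /pd /lim /lim_in; congr (get _).
by apply/funext => l; apply/propext; exact: h.
Qed.

Lemma eq_pd_near a f g x : (\forall y \near hnbhs x, f y = g y) ->
  \forall y \near hnbhs x, pd a f y = pd a g y.
Proof.
move=> /hnbhs_open /hnbhsP[d d0 h]; apply/hnbhsP; exists d => // y hy yx.
by apply: eq_pd => //; exact: h.
Qed.

Lemma eq_pds_near s f g x : (\forall y \near hnbhs x, f y = g y) ->
  \forall y \near hnbhs x, pds s f y = pds s g y.
Proof. by move=> fg; elim: s => //= a s; apply: eq_pd_near. Qed.

Lemma eq_pds s f g x : halfspace x -> (\forall y \near hnbhs x, f y = g y) ->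
  pds s f x = pds s g x.
Proof. by move=> hx /(eq_pds_near s); exact: hnbhs_self. Qed.

(** From f (x + t e_a) = f x + t [dquot]; continuity along the one axis is all that the product rule
    needs. *)
Lemma der_cont a f x l : der a f x l ->
  f (x + t *: E a) @[t --> incr a x] --> f x.
Proof.
move=> h.
have t0 : t @[t --> incr a x] --> (0 : R).
  apply: cvg_trans (@cvg_id _ (nbhs (0 : R))).
  move=> P [d d0 dP]; apply/incrP; exists d => // t _ td _; apply: dP.
  by rewrite /ball_ /= sub0r normrN.
have : (f x + t * dquot a f x t) @[t --> incr a x] --> f x + 0 * l.
  by apply: cvgD; [exact: cvg_cst|apply: cvgM].
rewrite mul0r addr0; apply: cvg_near_eq.
apply: filterS (incr_neq0 a x) => t tn0.
by rewrite /dquot mulVKf// addrC subrK.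
Qed.

Lemma der_cst a x (c : R) : der a (fun=> c) x 0.
Proof.
rewrite /der; under eq_fun do rewrite /dquot subrr mulr0.
exact: cvg_cst.
Qed.

Lemma derD a f g x k l : der a f x k -> der a g x l ->
  der a (fun y => f y + g y) x (k + l).
Proof.
move=> hf hg; apply: (cvg_near_eq _ (cvgD hf hg)).
by near=> t; rewrite fctE /dquot /= -mulrDr opprD addrACA.
Unshelve. all: by end_near.
Qed.

Lemma derM a f g x k l : der a f x k -> der a g x l ->
  der a (fun y => f y * g y) x (k * g x + f x * l).
Proof.
move=> hf hg; apply: (cvg_near_eq _ (cvgD (cvgM hf (der_cont hg)) (cvgM (cvg_cst (f x)) hg))).
near=> t; rewrite fctE /= /dquot; ring.
Unshelve. all: by end_near.
Qed.

Lemma derZ a (c : R) f x k : der a f x k -> der a (fun y => c * f y) x (c * k).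
Proof. by move=> h; have := derM (der_cst a x c) h; rewrite mul0r add0r. Qed.

Lemma derN a f x k : der a f x k -> der a (fun y => - f y) x (- k).
Proof.
move=> /(derZ (c := -1)); rewrite mulN1r => h; apply: (cvg_near_eq _ h).
by near=> t; rewrite /dquot /= !mulN1r.
Unshelve. all: by end_near.
Qed.

Lemma derB a f g x k l : der a f x k -> der a g x l ->
  der a (fun y => f y - g y) x (k - l).
Proof. by move=> hf hg; apply: derD => //; exact: derN. Qed.

Lemma der_sum (I : Type) (r : seq I) (P : pred I) a (F : I -> 'rV[R]_n -> R) x
    (L : I -> R) : (forall i, der a (F i) x (L i)) ->
  der a (fun y => \sum_(i <- r | P i) F i y) x (\sum_(i <- r | P i) L i).
Proof.
move=> h; elim: r => [|i r IH].
  rewrite big_nil; under eq_fun do rewrite big_nil; exact: der_cst.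
rewrite big_cons; under eq_fun do rewrite big_cons.
by case: (P i) => //; apply: derD.
Qed.

Lemma der_coord a b x : der a (fun y => y 0 b) x (b == a)%:R.
Proof.
apply: (@cvg_near_eq _ _ _ (fun=> (b == a)%:R)); last exact: cvg_cst.
apply: filterS (incr_neq0 a x) => t t0.
by rewrite /dquot coord_shift [_ + t * _]addrC addrK mulKf.
Qed.

(* Caratheodory's criterion turns the chain rule into a product. *)
Lemma der_comp1 a f x k (F : R -> R) (l : R) :
  der a f x k -> is_derive (f x) 1 F l -> der a (fun y => F (f y)) x (l * k).
Proof.
move=> hf [dF Fl].
pose q := fun z : R => if z == f x then l else (F z - F (f x)) / (z - f x).
have cq : q z @[z --> f x] --> q (f x).
  rewrite {2}/q eqxx; apply/cvgrPdist_le => e e0.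
  have : (h^-1 *: ((F \o shift (f x)) (h *: 1) - F (f x))) @[h --> 0^'] --> l.
    by rewrite -Fl; exact: dF.
  move=> /cvgrPdist_le/(_ _ e0)[d /= d0 h].
  apply/nbhs_normP; exists d => //= z; rewrite /ball_ /= => zd.
  rewrite /q; case: eqVneq => [_|zf]; first by rewrite subrr normr0 ltW.
  have := h (z - f x); rewrite /= sub0r normrN distrC => /(_ zd).
  rewrite subr_eq0 => /(_ zf); rewrite [_ *: 1]mulr1 subrK.
  by rewrite /GRing.scale /= mulrC.
have -> : l = q (f x) by rewrite /q eqxx.
apply: (cvg_near_eq _ (cvgM (cvg_comp _ _ (der_cont hf) cq) hf)).
near=> t; rewrite ?fctE /= /dquot /q; case: eqVneq => [->|ne].
  by rewrite !subrr !mulr0.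
by rewrite mulrCA divfK// subr_eq0.
Unshelve. all: by end_near.
Qed.

End Derivative.

Section CkClass.
Context {R : realType} {n : nat}.
Implicit Types (x y : 'rV[R]_n) (f g : 'rV[R]_n -> R) (a b : 'I_n).
Implicit Types (D : set 'rV[R]_n) (k : nat).

(** Relatively open subsets of the half-space, the domains on which [Ck] behaves as expected. *)
Definition rop D : Prop := D `<=` halfspace /\ forall x, D x -> hnbhs x D.

Lemma rop_openI (O : set 'rV[R]_n) : open O -> rop (O `&` halfspace).
Proof.
move=> oO; split=> [x []//|x [Ox hx]].
have : \forall y \near x, O y by exact: open_nbhs_nbhs.
move=> /nbhs_normP[d /= d0 h]; apply/hnbhsP; exists d => // y hy yx.
by split=> //; apply: h; rewrite /ball_ /= distrC.
Qed.

Lemma hnbhs_within D x : rop D -> D x -> within D (nbhs x) = hnbhs x.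
Proof.
move=> [Dh oD] Dx; apply/funext => P; apply/propext; split => H.
  have H' : \forall y \near x, D y -> P y := H.
  have D' : \forall y \near x, halfspace y -> D y := oD _ Dx.
  suff : \forall y \near x, halfspace y -> P y by [].
  by apply: filterS2 H' D' => y h1 h2 h3; exact/h1/h2.
have H' : \forall y \near x, halfspace y -> P y := H.
suff : \forall y \near x, D y -> P y by [].
by apply: filterS H' => y h /Dh.
Qed.

Lemma within_contP D f : rop D -> {within D, continuous f} <->
  (forall x, D x -> f y @[y --> hnbhs x] --> f x).
Proof.
move=> oD; split.
  by move=> /subspace_continuousP h x Dx; rewrite -(hnbhs_within oD Dx); exact: h.
move=> h; apply/subspace_continuousP => x Dx; rewrite (hnbhs_within oD Dx).
exact: h.
Qed.

Lemma Ck0P D f : Ck 0 D f <-> {within D, continuous f}.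
Proof.
split=> [[h _]|h]; first exact: (h [::]).
by split=> // s; rewrite leqn0 => /nilP ->.
Qed.

(** Peels off the innermost derivative, the last entry of the list, so that inductions on k can pass
    from f to [pd a f]. *)
Lemma CkSP k D f : Ck k.+1 D f <->
  [/\ {within D, continuous f},
      forall a x, D x -> cvg (dquot a f x t @[t --> incr a x]) &
      forall a, Ck k D (pd a f)].
Proof.
have E s a : pds (rcons s a) f = pds s (pd a f) by rewrite /pds foldr_rcons.
split=> [[h1 h2]|[h0 h1 h2]].
  split=> [|a x Dx|a]; first exact: (h1 [::]).
    exact: (h2 [::]).
  split=> [s sk|s b x sk Dx]; rewrite -E; first by apply: h1; rewrite size_rcons.
  by apply: h2 => //; rewrite size_rcons.
split=> [s|s b x].
  case/lastP: s => [|s a] //; rewrite size_rcons ltnS => sk.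
  by rewrite E; exact: (h2 a).1.
case/lastP: s => [_ |s a]; first exact: h1.
by rewrite size_rcons ltnS => sk Dx; rewrite E; exact: (h2 a).2.
Qed.

Lemma Ck_le j k D f : (j <= k)%N -> Ck k D f -> Ck j D f.
Proof.
move=> jk [h1 h2]; split=> [s sj|s a x sj]; first by apply: h1; exact: leq_trans jk.
by apply: h2; exact: leq_trans jk.
Qed.

Lemma Ck_cont k D f : Ck k D f -> {within D, continuous f}.
Proof. by move=> /(Ck_le (leq0n k))/Ck0P. Qed.

Lemma Ck_pd k D f a : Ck k.+1 D f -> Ck k D (pd a f).
Proof. by move=> /CkSP[]. Qed.

Lemma Ck_pds k D f s : Ck (size s + k) D f -> Ck k D (pds s f).
Proof.
have E a r : pds (rcons r a) f = pds r (pd a f) by rewrite /pds foldr_rcons.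
elim/last_ind: s f E => [//|s a IH] f E; rewrite size_rcons addSn E => h.
by apply: IH (Ck_pd a h) => b r; rewrite /pds foldr_rcons.
Qed.

Lemma Ck_der k D f a x : Ck k.+1 D f -> D x -> der a f x (pd a f x).
Proof. by move=> /CkSP[_ h _] Dx; apply: der_pd; exact: h. Qed.

Lemma Ck_hcont k D f x : rop D -> Ck k D f -> D x -> f y @[y --> hnbhs x] --> f x.
Proof. by move=> oD /Ck_cont/(within_contP f oD); exact. Qed.

Lemma Ck_ext k D f g : rop D -> (forall x, D x -> f x = g x) ->
  Ck k D f -> Ck k D g.
Proof.
move=> oD fg [h1 h2].
have fgx x : D x -> \forall y \near hnbhs x, f y = g y.
  by move=> Dx; apply: filterS (oD.2 x Dx) => y /fg.
have hx x : D x -> halfspace x by exact: oD.1.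
split=> [s sk|s a x sk Dx].
  apply/within_contP => // x Dx; rewrite -(eq_pds s (hx _ Dx) (fgx _ Dx)).
  apply: (cvg_near_eq (eq_pds_near s (fgx _ Dx))).
  by move: x Dx; apply/within_contP => //; exact: h1.
by apply: eq_dble (eq_pds_near s (fgx _ Dx)) (h2 s a x sk Dx); exact: hx.
Qed.

(** The derivative need only be known on [D]: partial derivatives are local, so [Ck_ext] carries the
    regularity of the candidate [h] over to [pd a f]. *)
Lemma CkSI k D f : rop D ->
    (forall x, D x -> f y @[y --> hnbhs x] --> f x) ->
    (forall a, exists2 h, Ck k D h & forall x, D x -> der a f x (h x)) ->
  Ck k.+1 D f.
Proof.
move=> oD cf df; apply/CkSP; split.
- exact/within_contP.
- by move=> a x Dx; have [h _ hd] := df a; exact: der_dble (hd x Dx).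
- move=> a; have [h hk hd] := df a; apply: Ck_ext hk => // x Dx.
  by apply/esym/pd_der; [exact: oD.1|exact: hd].
Qed.

Lemma Ck_sub k D D' f : rop D -> rop D' -> D' `<=` D -> Ck k D f -> Ck k D' f.
Proof.
move=> oD oD' DD' [h1 h2]; split=> [s sk|s a x sk D'x]; last exact/h2/DD'.
exact: continuous_subspaceW DD' (h1 s sk).
Qed.

Lemma Ck_local k D f : rop D ->
    (forall x, D x -> exists D', [/\ rop D', D' x & Ck k D' f]) -> Ck k D f.
Proof.
move=> oD h; split=> [s sk|s a x sk Dx].
  apply/within_contP => // x Dx; have [D' [oD' D'x [h1 _]]] := h x Dx.
  by move: x {Dx} D'x; apply/within_contP => //; exact: h1.
by have [D' [oD' D'x [_ h2]]] := h x Dx; exact: h2.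
Qed.

Lemma Ck_cst k D (c : R) : rop D -> Ck k D (fun=> c).
Proof.
elim: k c => [|k IH] c oD.
  by apply/Ck0P/within_contP => // x _; exact: cvg_cst.
apply: CkSI => // [x _|a]; first exact: cvg_cst.
by exists (fun=> 0) => [|x _]; [exact: IH|exact: der_cst].
Qed.

Lemma CkD k D f g : rop D -> Ck k D f -> Ck k D g -> Ck k D (fun x => f x + g x).
Proof.
elim: k f g => [|k IH] f g oD hf hg.
  by apply/Ck0P/within_contP => // x Dx; apply: cvgD; [exact: Ck_hcont hf Dx|exact: Ck_hcont hg Dx].
apply: CkSI => // [x Dx|a]; first by apply: cvgD; [exact: Ck_hcont hf Dx|exact: Ck_hcont hg Dx].
exists (fun x => pd a f x + pd a g x); first by apply: IH => //; exact: Ck_pd.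
by move=> x Dx; apply: derD; [exact: Ck_der hf Dx|exact: Ck_der hg Dx].
Qed.

Lemma CkM k D f g : rop D -> Ck k D f -> Ck k D g -> Ck k D (fun x => f x * g x).
Proof.
elim: k f g => [|k IH] f g oD hf hg.
  by apply/Ck0P/within_contP => // x Dx; apply: cvgM; [exact: Ck_hcont hf Dx|exact: Ck_hcont hg Dx].
apply: CkSI => // [x Dx|a]; first by apply: cvgM; [exact: Ck_hcont hf Dx|exact: Ck_hcont hg Dx].
exists (fun x => pd a f x * g x + f x * pd a g x).
  have hf' := Ck_le (leqnSn k) hf; have hg' := Ck_le (leqnSn k) hg.
  by apply: CkD => //; apply: IH => //; exact: Ck_pd.
by move=> x Dx; apply: derM; [exact: Ck_der hf Dx|exact: Ck_der hg Dx].
Qed.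

Lemma CkZ k D (c : R) f : rop D -> Ck k D f -> Ck k D (fun x => c * f x).
Proof. by move=> oD; apply: CkM => //; exact: Ck_cst. Qed.

Lemma CkN k D f : rop D -> Ck k D f -> Ck k D (fun x => - f x).
Proof.
move=> oD /(CkZ (-1) oD); apply: Ck_ext => // x _; exact: mulN1r.
Qed.

Lemma CkB k D f g : rop D -> Ck k D f -> Ck k D g -> Ck k D (fun x => f x - g x).
Proof. by move=> oD hf hg; apply: CkD => //; exact: CkN. Qed.

Lemma Ck_sum (I : Type) (r : seq I) (P : pred I) k D (F : I -> 'rV[R]_n -> R) :
  rop D -> (forall i, Ck k D (F i)) ->
  Ck k D (fun x => \sum_(i <- r | P i) F i x).
Proof.
move=> oD h; elim: r => [|i r IH].
  by under eq_fun do rewrite big_nil; exact: Ck_cst.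
by under eq_fun do rewrite big_cons; case: (P i) => //; exact: CkD.
Qed.

Lemma Ck_prod (I : Type) (r : seq I) (P : pred I) k D (F : I -> 'rV[R]_n -> R) :
  rop D -> (forall i, Ck k D (F i)) ->
  Ck k D (fun x => \prod_(i <- r | P i) F i x).
Proof.
move=> oD h; elim: r => [|i r IH].
  by under eq_fun do rewrite big_nil; exact: Ck_cst.
by under eq_fun do rewrite big_cons; case: (P i) => //; exact: CkM.
Qed.

Lemma Ck_coord k D b : rop D -> Ck k D (fun x => x 0 b).
Proof.
move=> oD; have c0 x : (y : 'rV[R]_n) 0 b @[y --> hnbhs x] --> x 0 b.
  apply/cvgrPdist_lt => e e0; apply/hnbhsP; exists e => // y _ yx.
  have := ler_coord_norm (x - y) b; rewrite !mxE => /le_lt_trans; apply.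
  by rewrite distrC.
case: k => [|k]; first by apply/Ck0P/within_contP => // x _; exact: c0.
apply: CkSI => // a; exists (fun=> (b == a)%:R); first exact: Ck_cst.
by move=> x _; exact: der_coord.
Qed.

(** The derivative - f^-2 df involves 1/f only to order k, which the induction provides. *)
Lemma CkV k D f : rop D -> (forall x, D x -> f x != 0) -> Ck k D f ->
  Ck k D (fun x => (f x)^-1).
Proof.
move=> oD f0; elim: k => [|k IH] hf.
  apply/Ck0P/within_contP => // x Dx.
  exact: (cvgV (f0 _ Dx) (Ck_hcont oD hf Dx)).
apply: CkSI => // [x Dx|a].
  exact: (cvgV (f0 _ Dx) (Ck_hcont oD hf Dx)).
exists (fun x => - (f x)^-1 ^+ 2 * pd a f x).
  apply: CkM => //; last exact: (Ck_pd a hf).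
  have h := IH (Ck_le (leqnSn _) hf); by apply: CkN => //; exact: (CkM oD h h).
move=> x Dx; apply: (@der_comp1 _ _ a f x _ GRing.inv _ (Ck_der hf Dx)).
have fx0 := f0 _ Dx.
have d1 := @derivable_id R R (f x) 1.
apply: DeriveDef; first exact: (derivableV fx0 d1).
by rewrite (deriveV fx0 d1) derive_id [_ *: _]mulr1 exprVn.
Qed.

End CkClass.

(** * Mean value theorem, chain rule, symmetry of second derivatives *)

Section MeanValue.
Context {R : realType} {n : nat}.
Implicit Types (x y z : 'rV[R]_n) (f g : 'rV[R]_n -> R) (a b : 'I_n).
Implicit Types (D : set 'rV[R]_n) (k : nat).

Local Notation E a := (delta_mx 0 a : 'rV[R]_n).

Lemma halfspace_segment z a (s t : R) : halfspace z -> halfspace (z + s *: E a) ->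
  0 <= t <= 1 -> halfspace (z + (t * s) *: E a).
Proof.
move=> hz hs /andP[t0 t1] b b0; rewrite coord_shift.
have := hz b b0; have := hs b b0; rewrite coord_shift.
set u := z 0 b; set v := (b == a)%:R => h1 h2.
have -> : u + t * s * v = (1 - t) * u + t * (u + s * v) by ring.
by rewrite addr_ge0// mulr_ge0// subr_ge0.
Qed.

(** One-variable theorem for t -> f (z + t s e_a) on [0, 1], which treats both signs of s alike. By
    convexity of the half-space, the increments at interior times are two-sided. *)
Lemma mean_value_line f (L : 'rV[R]_n -> R) z a (s : R) :
    halfspace z -> halfspace (z + s *: E a) ->
    (forall t : R, 0 <= t <= 1 ->
      der a f (z + (t * s) *: E a) (L (z + (t * s) *: E a))) ->
  exists2 t, 0 <= t <= 1 & f (z + s *: E a) - f z = s * L (z + (t * s) *: E a).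
Proof.
move=> hz hs hd.
have [->|s0] := eqVneq s 0.
  by exists 0; rewrite ?lexx ?ler01// scale0r addr0 subrr mul0r.
pose phi (t : R) := f (z + (t * s) *: E a).
have shiftE (t r : R) : z + (t * s) *: E a + (r * s) *: E a =
    z + ((r + t) * s) *: E a by rewrite -addrA -scalerDl -mulrDl [t + r]addrC.
have d1 (t : R) : t \in `]0, 1[%R ->
    is_derive t 1 phi (s * L (z + (t * s) *: E a)).
  rewrite in_itv /= => /andP[t0 t1].
  have t01 : 0 <= t <= 1 by rewrite !ltW.
  suff h : (r^-1 *: ((phi \o shift t) (r *: 1) - phi t)) @[r --> 0^'] -->
      s * L (z + (t * s) *: E a).
    by apply: DeriveDef; [apply/cvg_ex; eexists; exact: h|exact: cvg_lim h].
  apply/cvgrPdist_le => e e0.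
  have es : 0 < e / `|s| by rewrite divr_gt0// normr_gt0.
  have /cvgrPdist_le/(_ _ es)/incrP[d d0 H] := hd t t01.
  have d'0 : 0 < Num.min (d / `|s|) (Num.min t (1 - t)).
    by rewrite !lt_min divr_gt0 ?normr_gt0//= t0 subr_gt0.
  apply/nbhs_normP; exists (Num.min (d / `|s|) (Num.min t (1 - t))) => //= r.
  rewrite /ball_ /= sub0r normrN !lt_min ltr_pdivlMr ?normr_gt0// -normrM.
  move=> /andP[rd /andP[rt r1t]] r0.
  have rt01 : 0 <= r + t <= 1.
    move: rt r1t; rewrite !ltr_norml => /andP[h1 h2] /andP[h3 h4].
    by apply/andP; split; lra.
  have := H (r * s); rewrite mulf_neq0// => /(_ isT rd).
  rewrite shiftE => /(_ (halfspace_segment hz hs rt01)).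
  rewrite /dquot shiftE /phi /= [r *: 1]mulr1 /GRing.scale /= => h.
  rewrite [X in s * _ - X](_ : _ = s * ((r * s)^-1 *
    (f (z + ((r + t) * s) *: E a) - f (z + (t * s) *: E a)))); last first.
    by rewrite invfM; field; rewrite s0 r0.
  rewrite -mulrBr normrM mulrC -ler_pdivlMr ?normr_gt0//.
have c1 : {within `[(0:R), 1]%classic, continuous phi}.
  apply/subspace_continuousP => t; rewrite /= in_itv /= => t01.
  apply/cvgrPdist_lt => e e0.
  have /cvgrPdist_lt/(_ _ e0)/incrP[d d0 H] := der_cont (hd t t01).
  suff : \forall r \near t, `[0, 1]%classic r -> `|phi t - phi r| < e by [].
  apply/nbhs_normP; exists (d / `|s|); first by rewrite /= divr_gt0// normr_gt0.
  move=> r; rewrite /ball_ /= distrC ltr_pdivlMr ?normr_gt0// -normrM in_itv /=.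
  move=> rd r01; have [->|rt] := eqVneq r t; first by rewrite subrr normr0.
  have := H ((r - t) * s); rewrite mulf_neq0 ?subr_eq0// => /(_ isT rd).
  by rewrite shiftE subrK; apply; exact: (halfspace_segment hz hs r01).
have [t t01 h] := MVT ltr01 d1 c1.
exists t; first by move: t01; rewrite in_itv /= => /andP[h1 h2]; rewrite !ltW.
by move: h; rewrite /phi mul1r mul0r scale0r addr0 subr0 mulr1.
Qed.

(* Strict (relative to the half-space) differentiability at x. *)
Definition sdiff f x (L : 'I_n -> R) : Prop := forall e : R, 0 < e ->
  exists2 d : R, 0 < d & forall y z, halfspace y -> halfspace z ->
    `|y - x| < d -> `|z - x| < d ->
    `|f z - f y - \sum_a L a * (z - y) 0 a| <= e * `|z - y|.

(** Pass from y to z by changing one coordinate at a time. All points on the way have coordinates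
    between those of y and z, hence stay in the half-space and in the cube around x, and the mean
    value theorem applies to each leg. *)
Lemma Ck_sdiff D f x : rop D -> Ck 1 D f -> D x -> sdiff f x (fun a => pd a f x).
Proof.
move=> oD hf Dx e e0.
(* An equal share of the error for each of the n legs; n + 1 is never zero. *)
have e'0 : 0 < e / n.+1%:R by rewrite divr_gt0.
have [d d0 H] : exists2 d : R, 0 < d & forall y, halfspace y -> `|y - x| < d ->
    D y /\ forall a, `|pd a f x - pd a f y| <= e / n.+1%:R.
  suff : \forall y \near hnbhs x,
      D y /\ forall a, `|pd a f x - pd a f y| <= e / n.+1%:R.
    by move=> /hnbhsP.
  apply: filterI; first exact: oD.2.
  apply: (@filter_forall _ _ (fun a y => `|pd a f x - pd a f y| <= _) (hnbhs x)) => a.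
  have /cvgrPdist_le := Ck_hcont oD (Ck_pd a hf) Dx.
  exact.
exists d => // y z hy hz yd zd.
pose w (k : nat) : 'rV[R]_n := \row_b (if (b < k)%N then z 0 b else y 0 b).
have w0 : w 0%N = y by apply/rowP => b; rewrite mxE.
have wn : w n = z by apply/rowP => b; rewrite mxE ltn_ord.
have wS (a : 'I_n) : w a.+1 = w a + (z 0 a - y 0 a) *: E a.
  apply/rowP => b; rewrite coord_shift !mxE ltnS leq_eqVlt.
  have [->|ba] := eqVneq b a; first by rewrite eqxx ltnn mulr1 addrC subrK.
  by rewrite val_eqE (negPf ba) /= mulr0 addr0.
have hw k : halfspace (w k).
  by move=> b b0; rewrite mxE; case: ifP => _; [exact: hz|exact: hy].
have coordE (a : 'I_n) (t : R) b :
    (w a + (t * (z 0 a - y 0 a)) *: E a) 0 b =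
    if b == a then (1 - t) * y 0 b + t * z 0 b
    else if (b < a)%N then z 0 b else y 0 b.
  rewrite coord_shift !mxE; have [->|ba] := eqVneq b a; last by rewrite mulr0 addr0.
  by rewrite ltnn /= mulr1; ring.
have wd (a : 'I_n) (t : R) : 0 <= t <= 1 ->
    `|w a + (t * (z 0 a - y 0 a)) *: E a - x| < d.
  move=> /andP[t0 t1].
  pose m := Num.max `|y - x| `|z - x|.
  have md : m < d by rewrite /m gt_max yd zd.
  apply: le_lt_trans md; apply: rowv_normP => [|b].
    by rewrite /m le_max normr_ge0.
  have yb : `|y 0 b - x 0 b| <= m.
    by rewrite /m le_max; have := ler_coord_norm (y - x) b; rewrite !mxE => ->.
  have zb : `|z 0 b - x 0 b| <= m.
    rewrite /m le_max; have := ler_coord_norm (z - x) b; rewrite !mxE => ->.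
    by rewrite orbT.
  rewrite [(_ - x) 0 b]mxE [(- x) 0 b]mxE coordE; case: ifP => _; last by case: ifP.
  have -> : (1 - t) * y 0 b + t * z 0 b - x 0 b =
    (1 - t) * (y 0 b - x 0 b) + t * (z 0 b - x 0 b) by ring.
  rewrite (le_trans (ler_normD _ _))// !normrM (ger0_norm t0) ger0_norm ?subr_ge0//.
  have -> : m = (1 - t) * m + t * m by ring.
  by rewrite lerD// ler_wpM2l// subr_ge0.
have step (a : 'I_n) :
    `|f (w a.+1) - f (w a) - pd a f x * (z - y) 0 a| <= e / n.+1%:R * `|z - y|.
  have hwS : halfspace (w a + (z 0 a - y 0 a) *: E a) by rewrite -wS.
  rewrite wS; have [t t01|t t01 ->] := mean_value_line (f := f) (L := pd a f) (hw a) hwS.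
    have [Dw _] := H _ (halfspace_segment (hw a) hwS t01) (wd a t t01).
    exact: Ck_der hf Dw.
  have [_ /(_ a)] := H _ (halfspace_segment (hw a) hwS t01) (wd a t t01).
  set p := pd a f (w a + _) => hp.
  have -> : (z - y) 0 a = z 0 a - y 0 a by rewrite !mxE.
  rewrite mulrC -mulrBl normrM distrC ler_pM//.
  by have := ler_coord_norm (z - y) a; rewrite !mxE.
have -> : f z - f y = \sum_(a < n) (f (w a.+1) - f (w a)).
  by rewrite -(big_mkord xpredT (fun k => f (w k.+1) - f (w k))) telescope_sumr// w0 wn.
rewrite -sumrB (le_trans (ler_norm_sum _ _ _))//.
rewrite (le_trans (ler_sum _ (fun a _ => step a)))// sumr_const card_ord.
rewrite -[leLHS]mulr_natl mulrA ler_wpM2r//.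
by rewrite mulrCA ger_pMr// ler_pdivrMr// mul1r ler_nat.
Qed.

Lemma sdiff_lip f x L : sdiff f x L ->
  exists d c : R, [/\ 0 < d, 0 <= c & forall y z, halfspace y -> halfspace z ->
    `|y - x| < d -> `|z - x| < d -> `|f z - f y| <= c * `|z - y|].
Proof.
move=> /(_ 1 ltr01)[d d0 H]; exists d, (1 + \sum_a `|L a|); split=> //.
  by rewrite addr_ge0// sumr_ge0.
move=> y z hy hz yd zd; have := H y z hy hz yd zd; rewrite mul1r => h.
rewrite -(subrK (\sum_a L a * (z - y) 0 a) (f z - f y)).
rewrite (le_trans (ler_normD _ _))// mulrDl mul1r lerD// mulr_suml.
rewrite (le_trans (ler_norm_sum _ _ _))// ler_sum// => a _.
by rewrite normrM ler_wpM2l// ler_coord_norm.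
Qed.

(** The displacement of T x is not along an axis, so partial derivatives of F would not suffice.
    Strict differentiability compares F with its linear part, whose composition with T is
    differentiated entry by entry. *)
Lemma der_comp (F : 'rV[R]_n -> R) (T : 'rV[R]_n -> 'rV[R]_n) a x
    (L l : 'I_n -> R) :
    halfspace x -> (\forall y \near hnbhs x, halfspace (T y)) ->
    (forall c, der a (fun y => T y 0 c) x (l c)) -> sdiff F (T x) L ->
  der a (fun y => F (T y)) x (\sum_c L c * l c).
Proof.
move=> hx hT dT dF.
have dlin : der a (fun y => \sum_c L c * T y 0 c) x (\sum_c L c * l c).
  by apply: der_sum => c; exact: derZ.
apply/cvgrPdist_le => e e0.
(* Bounds the difference quotients of all the entries of T near x. *)
pose m := 1 + \sum_c `|l c|.
have m0 : 0 < m by rewrite ltr_wpDr// sumr_ge0.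
have em : 0 < e / 2 / m by rewrite !divr_gt0.
have [d d0 H] := dF _ em.
have h1 : \forall t \near incr a x, forall c,
    `|l c - dquot a (fun y => T y 0 c) x t| <= 1.
  apply: (@filter_forall _ _ (fun c t => `|l c - dquot a (fun y => T y 0 c) x t| <= 1)
    (incr a x)) => c.
  by have /cvgrPdist_le/(_ 1 ltr01) := dT c.
have h2 : \forall t \near incr a x, `|t| * m < d.
  apply/incrP; exists (d / m); first by rewrite divr_gt0.
  by move=> t _; rewrite ltr_pdivlMr.
have e2 : 0 < e / 2 by rewrite divr_gt0.
have /cvgrPdist_le/(_ _ e2) h3 := dlin.
near=> t.
have tn0 : t != 0 by near: t; exact: incr_neq0.
have hTt : halfspace (T (x + t *: E a)) by near: t; exact: (incr_hnbhs a hT).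
have hTx : halfspace (T x) := hnbhs_self hx hT.
have Tm : `|T (x + t *: E a) - T x| <= `|t| * m.
  apply: rowv_normP => [|c]; first by rewrite mulr_ge0// ltW.
  have : `|l c - dquot a (fun y => T y 0 c) x t| <= 1 by move: c; near: t.
  set q := dquot _ _ _ _ => hq.
  have -> : (T (x + t *: E a) - T x) 0 c = t * q.
    by rewrite /q /dquot mulVKf// !mxE.
  rewrite normrM ler_wpM2l//.
  have -> : q = l c - (l c - q) by ring.
  rewrite (le_trans (ler_normB _ _))// addrC lerD//.
  by rewrite (bigD1 c)//= lerDl sumr_ge0.
have Td : `|T (x + t *: E a) - T x| < d.
  by apply: le_lt_trans Tm _; near: t.
have := H (T x) (T (x + t *: E a)) hTx hTt.
rewrite subrr normr0 => /(_ d0 Td) h4.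
have h5 : `|\sum_c L c * l c - dquot a (fun y => \sum_c L c * T y 0 c) x t| <= e / 2.
  by near: t.
rewrite -(subrK (dquot a (fun y => \sum_c L c * T y 0 c) x t) (\sum_c _)).
rewrite -addrA (le_trans (ler_normD _ _))// [leRHS]splitr lerD//.
rewrite /dquot -mulrBr normrM normfV ler_pdivrMl ?normr_gt0//.
rewrite distrC -sumrB.
have -> : \sum_c (L c * T (x + t *: E a) 0 c - L c * T x 0 c) =
    \sum_c L c * (T (x + t *: E a) - T x) 0 c.
  by apply: eq_bigr => c _; rewrite !mxE mulrBr.
apply: (le_trans h4); apply: (le_trans (ler_wpM2l (ltW em) Tm)).
by rewrite mulrCA divfK ?gt_eqF.
Unshelve. all: by end_near.
Qed.

Lemma cvg_hnbhs_rowv (T : Type) (F : set_system T) {FF : Filter F}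
    (f : T -> 'rV[R]_n) y :
    (\forall t \near F, halfspace (f t)) -> (forall b, f t 0 b @[t --> F] --> y 0 b) ->
  f t @[t --> F] --> hnbhs y.
Proof.
move=> hf h P /hnbhsP[d d0 dP].
have d20 : 0 < d / 2 by rewrite divr_gt0.
have h' : \forall t \near F, forall b, `|y 0 b - f t 0 b| <= d / 2.
  apply: (@filter_forall _ _ (fun b t => `|y 0 b - f t 0 b| <= d / 2) F) => b.
  by have /cvgrPdist_le/(_ _ d20) := h b.
suff : \forall t \near F, P (f t) by [].
apply: filterS2 hf h' => t ht tb; apply: dP => //.
apply: (@le_lt_trans _ _ (d / 2)); last by rewrite ltr_pdivrMr// ltr_pMr// ltr1n.
by apply: rowv_normP => [|b]; [exact: ltW|rewrite !mxE distrC; exact: tb].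
Qed.

(** An increment admissible at x remains admissible after an inward shift, but not conversely: hence
    an implication only, and s >= 0. *)
Lemma der_shift f a b x (s l : R) : 0 <= s ->
  der a f (x + s *: E b) l -> der a (fun y => f (y + s *: E b)) x l.
Proof.
move=> s0 h; rewrite /der.
have -> : dquot a (fun y => f (y + s *: E b)) x = dquot a f (x + s *: E b).
  by apply/funext => t; rewrite /dquot addrAC.
apply: cvg_trans h; apply: cvg_app => P /incrP[d d0 H]; apply/incrP; exists d => //.
move=> t t0 td ht; apply: H => //; rewrite addrAC.
exact: halfspace_shift.
Qed.

Lemma Ck_comp k D D' (F : 'rV[R]_n -> R) (T : 'rV[R]_n -> 'rV[R]_n) :
    rop D -> rop D' -> (forall x, D x -> D' (T x)) ->
    (forall b, Ck k D (fun x => T x 0 b)) -> Ck k D' F ->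
  Ck k D (fun x => F (T x)).
Proof.
move=> oD oD' TD; elim: k F => [|k IH] F hT hF.
  apply/Ck0P/within_contP => // x Dx; apply: cvg_comp (Ck_hcont oD' hF (TD _ Dx)).
  apply: cvg_hnbhs_rowv => [|b]; last exact: (Ck_hcont oD (hT b) Dx).
  by apply: filterS (oD.2 _ Dx) => y /TD; exact: oD'.1.
apply: CkSI => // [x Dx|a].
  apply: cvg_comp (Ck_hcont oD' hF (TD _ Dx)).
  apply: cvg_hnbhs_rowv => [|b]; last exact: (Ck_hcont oD (hT b) Dx).
  by apply: filterS (oD.2 _ Dx) => y /TD; exact: oD'.1.
exists (fun x => \sum_c pd c F (T x) * pd a (fun y => T y 0 c) x).
  apply: Ck_sum => // c; apply: CkM => //; last exact: Ck_pd (hT c).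
  by apply: IH => [b|]; [exact: Ck_le (hT b)|exact: Ck_pd].
move=> x Dx; apply: der_comp => [||c|].
- exact: oD.1.
- by apply: filterS (oD.2 _ Dx) => y /TD; exact: oD'.1.
- exact: Ck_der (hT c) Dx.
- by apply: (Ck_sdiff oD' (Ck_le _ hF)) => //; exact: TD.
Qed.

(* The second difference quotient of f is both a value of d_a d_b f and one of
   d_b d_a f near x. *)
Lemma pd_comm D f a b x : rop D -> Ck 2 D f -> D x ->
  pd a (pd b f) x = pd b (pd a f) x.
Proof.
move=> oD hf Dx.
pose Q (c d : 'I_n) (e s : R) := `|s^-1 ^+ 2 * (f (x + s *: E c + s *: E d) - f (x + s *: E c) -
      (f (x + s *: E d) - f x)) - pd d (pd c f) x| <= e.
(* Only s > 0 is used: x may lie on the wall, and the shifts must then point inwards. The mean value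
   theorem is applied first in direction c, then in direction d. *)
have key c d (e : R) : 0 < e -> \forall s \near 0^'+, Q c d e s.
  move=> e0.
  have : \forall y \near hnbhs x, D y /\ `|pd d (pd c f) x - pd d (pd c f) y| <= e.
    apply: filterI; first exact: oD.2.
    by have /cvgrPdist_le/(_ _ e0) := Ck_hcont oD (Ck_pd d (Ck_pd c hf)) Dx.
  move=> /hnbhsP[r r0 H].
  near=> s.
  have s0 : 0 < s by near: s; exact: nbhs_right_gt.
  have sr : s + s < r.
    rewrite -mulr2n -mulr_natr -ltr_pdivlMr//.
    by near: s; apply: nbhs_right_lt; rewrite divr_gt0.
  have hx := oD.1 _ Dx.
  have hcd (p q : R) : 0 <= p <= 1 -> 0 <= q <= 1 ->
      halfspace (x + (p * s) *: E c + (q * s) *: E d) /\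
      `|x + (p * s) *: E c + (q * s) *: E d - x| < r.
    move=> /andP[p0 p1] /andP[q0 q1]; split.
      by do !apply: halfspace_shift => //; rewrite mulr_ge0// ltW.
    apply: le_lt_trans sr; rewrite [_ + _ - x]addrC !addrA [- x + x]addNr add0r.
    have s0' := ltW s0.
    rewrite (le_trans (ler_normD _ _))// !norm_deltaZ !normrM !ger0_norm//.
    by rewrite lerD// ger_pMl.
  have h01 : 0 <= (1 : R) <= 1 by rewrite ler01 lexx.
  have h00 : 0 <= (0 : R) <= 1 by rewrite ler01 lexx.
  pose F y := f (y + s *: E d) - f y.
  have hs1 : halfspace (x + s *: E c) by apply: halfspace_shift => //; exact: ltW.
  have [p p01|p p01 hp] := mean_value_line (f := F) (s := s) (a := c)
      (L := fun y => pd c f (y + s *: E d) - pd c f y) hx hs1.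
    apply: derB.
      apply: der_shift; first exact: ltW.
      have [h1 h2] := hcd p 1 p01 h01; rewrite mul1r in h1 h2.
      exact: Ck_der hf (H _ h1 h2).1.
    have [h1 h2] := hcd p 0 p01 h00; rewrite mul0r scale0r addr0 in h1 h2.
    exact: Ck_der hf (H _ h1 h2).1.
  have [hy _] := hcd p 0 p01 h00; rewrite mul0r scale0r addr0 in hy.
  have [hy1 _] := hcd p 1 p01 h01; rewrite mul1r in hy1.
  have [q q01|q q01 hq] := mean_value_line (f := pd c f) (s := s) (a := d)
      (L := pd d (pd c f)) hy hy1.
    have [h1 h2] := hcd p q p01 q01.
    exact: Ck_der (Ck_pd c hf) (H _ h1 h2).1.
  rewrite /F in hp; rewrite /Q hp hq.
  have [h1 h2] := hcd p q p01 q01.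
  have [_] := H _ h1 h2; rewrite distrC; set u := pd d (pd c f) _.
  have sn0 : s != 0 by rewrite gt_eqF.
  by have -> : s^-1 ^+ 2 * (s * (s * u)) = u by field.
apply/eqP; rewrite eq_sym -subr_eq0 -normr_le0; apply/ler_addgt0Pr => e e0.
have e2 : 0 < e / 2 by rewrite divr_gt0.
have [s [h1 h2]] : exists s, Q a b (e / 2) s /\ Q b a (e / 2) s.
  apply: (@filter_ex _ (0 : R)^'+ _).
  exact: (filterI (key a b _ e2) (key b a _ e2)).
have swap : f (x + s *: E b + s *: E a) = f (x + s *: E a + s *: E b).
  by rewrite addrAC.
rewrite /Q swap in h2; rewrite /Q in h1.
have aux (p q r t u v i c : R) : `|i * (p - q - (r - t)) - u| <= c / 2 ->
    `|i * (p - r - (q - t)) - v| <= c / 2 -> `|u - v| <= c.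
  have -> : p - r - (q - t) = p - q - (r - t) by ring.
  move: (i * _) => w k1 k2; rewrite -(subrKA w) [c]splitr.
  by rewrite (le_trans (ler_normD _ _))// lerD// distrC.
by rewrite add0r; exact: aux h1 h2.
Unshelve. all: by end_near.
Qed.

End MeanValue.

(** * Coordinate invariance of the dominant energy scalar *)

(** Locked so that [mxE] opens matrix operations without unfolding derivatives. *)
HB.lock Definition pdm (R : realType) (n p q : nat) (a : 'I_n)
    (A : 'rV[R]_n -> 'M[R]_(p, q)) (x : 'rV[R]_n) : 'M[R]_(p, q) :=
  \matrix_(i, j) pd a (fun y => A y i j) x.

(** Rows are directions of differentiation, the transpose of the usual Jacobian: vectors are rows
    and transform by v S, metrics by S H S^T. *)
HB.lock Definition jac (R : realType) (n : nat) (T : 'rV[R]_n -> 'rV[R]_n)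
    (x : 'rV[R]_n) : 'M[R]_n :=
  \matrix_(a, b) pd a (fun y => T y 0 b) x.

(* Twice the Christoffel symbols of the first kind: 2 Gamma_(ab,d) at entry (b, d). *)
HB.lock Definition low_chr (R : realType) (n : nat) (G : 'rV[R]_n -> 'M[R]_n)
    (a : 'I_n) (x : 'rV[R]_n) : 'M[R]_n :=
  \matrix_(b, d) (pdm a G x b d + pdm b G x a d - pdm d G x a b).

(* Gamma^c_ab at entry (b, c). *)
HB.lock Definition chr (R : realType) (n : nat) (G : 'rV[R]_n -> 'M[R]_n)
    (a : 'I_n) (x : 'rV[R]_n) : 'M[R]_n :=
  \matrix_(b, c) christoffel G c a b x.

Section EntryLemmas.
Context {R : realType} {n : nat}.
Implicit Types (x y : 'rV[R]_n) (a b c d : 'I_n) (G : 'rV[R]_n -> 'M[R]_n).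

Lemma pdmE (p q : nat) a (A : 'rV[R]_n -> 'M[R]_(p, q)) x i j :
  pdm a A x i j = pd a (fun y => A y i j) x.
Proof. by rewrite pdm.unlock mxE. Qed.

Lemma jacE (T : 'rV[R]_n -> 'rV[R]_n) x a b :
  jac T x a b = pd a (fun y => T y 0 b) x.
Proof. by rewrite jac.unlock mxE. Qed.

Lemma low_chrE G a x b d : low_chr G a x b d =
  pdm a G x b d + pdm b G x a d - pdm d G x a b.
Proof. by rewrite low_chr.unlock mxE. Qed.

Lemma chr_entry G a x b c : chr G a x b c = christoffel G c a b x.
Proof. by rewrite chr.unlock mxE. Qed.

End EntryLemmas.

(** * Calculus of matrix-valued functions *)

Section MatrixCalculus.
Context {R : realType} {n : nat}.
Implicit Types (x y : 'rV[R]_n) (D : set 'rV[R]_n) (a b : 'I_n).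

Definition Ckm (k p q : nat) D (A : 'rV[R]_n -> 'M[R]_(p, q)) : Prop :=
  forall i j, Ck k D (fun x => A x i j).

Lemma Ckm_le (j k p q : nat) D (A : 'rV[R]_n -> 'M[R]_(p, q)) :
  (j <= k)%N -> Ckm k D A -> Ckm j D A.
Proof. by move=> jk h i l; exact: Ck_le (h i l). Qed.

Lemma Ckm_ext (k p q : nat) D (A B : 'rV[R]_n -> 'M[R]_(p, q)) :
  rop D -> (forall x, D x -> A x = B x) -> Ckm k D A -> Ckm k D B.
Proof. by move=> oD AB h i j; apply: Ck_ext (h i j) => // x Dx; rewrite AB. Qed.

Lemma CkmD (k p q : nat) D (A B : 'rV[R]_n -> 'M[R]_(p, q)) : rop D ->
  Ckm k D A -> Ckm k D B -> Ckm k D (fun x => A x + B x).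
Proof.
by move=> oD hA hB i j; under eq_fun do rewrite mxE; exact: CkD.
Qed.

Lemma CkmZ (k p q : nat) D (f : 'rV[R]_n -> R) (A : 'rV[R]_n -> 'M[R]_(p, q)) :
  rop D -> Ck k D f -> Ckm k D A -> Ckm k D (fun x => f x *: A x).
Proof.
by move=> oD hf hA i j; under eq_fun do rewrite mxE; exact: CkM.
Qed.

Lemma Ckm_sum (I : finType) (k p q : nat) D
    (A : I -> 'rV[R]_n -> 'M[R]_(p, q)) : rop D ->
  (forall i, Ckm k D (A i)) -> Ckm k D (fun x => \sum_i A i x).
Proof.
move=> oD h i j; under eq_fun do rewrite summxE.
by apply: Ck_sum => // l; exact: h.
Qed.

Lemma Ckm_mul (k p q r : nat) D (A : 'rV[R]_n -> 'M[R]_(p, q))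
    (B : 'rV[R]_n -> 'M[R]_(q, r)) : rop D ->
  Ckm k D A -> Ckm k D B -> Ckm k D (fun x => A x *m B x).
Proof.
move=> oD hA hB i j; under eq_fun do rewrite mxE.
by apply: Ck_sum => // l; exact: CkM.
Qed.

Lemma Ckm_tr (k p q : nat) D (A : 'rV[R]_n -> 'M[R]_(p, q)) :
  Ckm k D A -> Ckm k D (fun x => (A x)^T).
Proof. by move=> h i j; under eq_fun do rewrite mxE; exact: h. Qed.

Lemma Ck_det (k p : nat) D (A : 'rV[R]_n -> 'M[R]_p) : rop D ->
  Ckm k D A -> Ck k D (fun x => \det (A x)).
Proof.
move=> oD h; apply: Ck_sum => // s; apply: CkM => //; first exact: Ck_cst.
by apply: Ck_prod => // i; exact: h.
Qed.

Lemma Ckm_inv (k p : nat) D (A : 'rV[R]_n -> 'M[R]_p) : rop D ->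
  (forall x, D x -> A x \in unitmx) -> Ckm k D A ->
  Ckm k D (fun x => invmx (A x)).
Proof.
move=> oD uA h; apply: (@Ckm_ext _ _ _ _ (fun x => (\det (A x))^-1 *: \adj (A x))).
- by [].
- by move=> x Dx; rewrite /invmx uA.
apply: CkmZ => //.
  apply: CkV => //; last exact: Ck_det.
  by move=> x /uA; rewrite unitmxE unitfE.
move=> i j; under eq_fun do rewrite mxE /cofactor.
apply: CkM => //; first exact: Ck_cst.
by apply: Ck_det => // l m; under eq_fun do rewrite !mxE; exact: h.
Qed.

Lemma Ckm_pdm (k p q : nat) D (A : 'rV[R]_n -> 'M[R]_(p, q)) a : rop D ->
  Ckm k.+1 D A -> Ckm k D (pdm a A).
Proof.
by move=> oD h i j; under eq_fun do rewrite pdmE; exact: Ck_pd.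
Qed.

Lemma pdm_ext (p q : nat) D (A B : 'rV[R]_n -> 'M[R]_(p, q)) a x :
  rop D -> (forall x, D x -> A x = B x) -> D x -> pdm a A x = pdm a B x.
Proof.
move=> oD AB Dx; apply/matrixP => i j; rewrite [LHS]pdmE [RHS]pdmE; apply: eq_pd.
  exact: oD.1.
by apply: filterS (oD.2 _ Dx) => y /AB ->.
Qed.

Lemma pdmD (p q : nat) D (A B : 'rV[R]_n -> 'M[R]_(p, q)) a x :
  rop D -> Ckm 1 D A -> Ckm 1 D B -> D x ->
  pdm a (fun y => A y + B y) x = pdm a A x + pdm a B x.
Proof.
move=> oD hA hB Dx; apply/matrixP => i j; rewrite pdmE [RHS]mxE (pdmE a A) (pdmE a B).
apply: pd_der; first exact: oD.1.
under eq_fun do rewrite mxE.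
by apply: derD; [exact: Ck_der (hA i j) Dx|exact: Ck_der (hB i j) Dx].
Qed.

Lemma pdmZ (p q : nat) D (f : 'rV[R]_n -> R) (A : 'rV[R]_n -> 'M[R]_(p, q)) a x :
  rop D -> Ck 1 D f -> Ckm 1 D A -> D x ->
  pdm a (fun y => f y *: A y) x = pd a f x *: A x + f x *: pdm a A x.
Proof.
move=> oD hf hA Dx; apply/matrixP => i j; rewrite pdmE !mxE (pdmE a A).
apply: pd_der; first exact: oD.1.
under eq_fun do rewrite mxE.
by apply: derM; [exact: Ck_der hf Dx|exact: Ck_der (hA i j) Dx].
Qed.

Lemma pdm_sum (I : finType) (p q : nat) D
    (A : I -> 'rV[R]_n -> 'M[R]_(p, q)) a x :
  rop D -> (forall i, Ckm 1 D (A i)) -> D x ->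
  pdm a (fun y => \sum_i A i y) x = \sum_i pdm a (A i) x.
Proof.
move=> oD hA Dx; apply/matrixP => i j; rewrite summxE pdmE.
apply: pd_der; first exact: oD.1.
under eq_fun do rewrite summxE.
by apply: der_sum => l; rewrite pdmE; exact: Ck_der (hA l i j) Dx.
Qed.

Lemma pdm_mul (p q r : nat) D (A : 'rV[R]_n -> 'M[R]_(p, q))
    (B : 'rV[R]_n -> 'M[R]_(q, r)) a x :
  rop D -> Ckm 1 D A -> Ckm 1 D B -> D x ->
  pdm a (fun y => A y *m B y) x = pdm a A x *m B x + A x *m pdm a B x.
Proof.
move=> oD hA hB Dx; apply/matrixP => i j; rewrite pdmE !mxE -big_split /=.
apply: pd_der; first exact: oD.1.
under eq_fun do rewrite mxE.
apply: der_sum => l; rewrite (pdmE a A) (pdmE a B).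
by apply: derM; [exact: Ck_der (hA i l) Dx|exact: Ck_der (hB l j) Dx].
Qed.

Lemma pdm_tr (p q : nat) (A : 'rV[R]_n -> 'M[R]_(p, q)) a x :
  pdm a (fun y => (A y)^T) x = (pdm a A x)^T.
Proof.
apply/matrixP => i j; rewrite [RHS]mxE [LHS]pdmE [RHS]pdmE; congr (pd a _ x).
by apply/funext => y; rewrite mxE.
Qed.

Lemma Ck_comp1 D D' (F : 'rV[R]_n -> R) (T : 'rV[R]_n -> 'rV[R]_n) a x :
  rop D -> rop D' -> (forall x, D x -> D' (T x)) ->
  (forall b, Ck 1 D (fun x => T x 0 b)) -> Ck 1 D' F -> D x ->
  pd a (fun y => F (T y)) x = \sum_c jac T x a c * pd c F (T x).
Proof.
move=> oD oD' TD hT hF Dx; apply: pd_der; first exact: oD.1.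
under eq_bigr do rewrite jacE mulrC.
apply: der_comp => [||c|].
- exact: oD.1.
- by apply: filterS (oD.2 _ Dx) => y /TD; exact: oD'.1.
- exact: Ck_der (hT c) Dx.
- by apply: (Ck_sdiff oD' hF) => //; exact: TD.
Qed.

Lemma pdm_comp (p q : nat) D D' (A : 'rV[R]_n -> 'M[R]_(p, q))
    (T : 'rV[R]_n -> 'rV[R]_n) a x :
  rop D -> rop D' -> (forall x, D x -> D' (T x)) ->
  (forall b, Ck 1 D (fun x => T x 0 b)) -> Ckm 1 D' A -> D x ->
  pdm a (fun y => A (T y)) x = \sum_c jac T x a c *: pdm c A (T x).
Proof.
move=> oD oD' TD hT hA Dx; apply/matrixP => i j; rewrite pdmE summxE.
rewrite (Ck_comp1 a oD oD' TD hT (hA i j) Dx).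
by apply: eq_bigr => c _; rewrite mxE pdmE.
Qed.

Lemma Ckm_comp (k p q : nat) D D' (A : 'rV[R]_n -> 'M[R]_(p, q))
    (T : 'rV[R]_n -> 'rV[R]_n) :
  rop D -> rop D' -> (forall x, D x -> D' (T x)) ->
  (forall b, Ck k D (fun x => T x 0 b)) -> Ckm k D' A ->
  Ckm k D (fun x => A (T x)).
Proof. by move=> oD oD' TD hT hA i j; exact: (Ck_comp oD oD' TD hT (hA i j)). Qed.

End MatrixCalculus.

(** * Curvature and current in matrix form *)

Section MatrixForms.
Context {R : realType} {n : nat}.
Implicit Types (x y : 'rV[R]_n) (D : set 'rV[R]_n) (a b c : 'I_n).
Implicit Types G P : 'rV[R]_n -> 'M[R]_n.

(** Curvature of the connection with matrices [chr G a]. These are the transposes of the usual ones,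
    which reverses the order in the commutator. *)
Definition curv G c a x : 'M[R]_n :=
  pdm c (chr G a) x - pdm a (chr G c) x
  + chr G a x *m chr G c x - chr G c x *m chr G a x.

Definition ric G x : 'M[R]_n := \matrix_(a, b) ricci G a b x.

(** The covariant derivative nabla_b P of a (2,0)-tensor. *)
Definition cov G P b x : 'M[R]_n :=
  pdm b P x + (chr G b x)^T *m P x + P x *m chr G b x.

Definition current G P x : 'rV[R]_n := \row_a current_density G P a x.

Lemma chrE G a x : chr G a x = 2^-1 *: (low_chr G a x *m (invmx (G x))^T).
Proof.
apply/matrixP => b c; rewrite chr_entry !mxE /christoffel; congr (_ * _).
by apply: eq_bigr => d _; rewrite !mxE low_chrE !pdmE mulrC.
Qed.

Lemma ricciE G a b x : ricci G a b x = \sum_c curv G c a x b c.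
Proof.
have E c a' b' d : pdm d (chr G a') x b' c = pd d (christoffel G c a' b') x.
  by rewrite pdmE; congr (pd _ _ _); apply/funext => y; rewrite chr_entry.
rewrite /ricci; apply: eq_bigr => c _; rewrite !mxE !E -!addrA; congr (_ + (_ + _)).
by rewrite -sumrB; apply: eq_bigr => d _; rewrite !chr_entry; ring.
Qed.

Lemma scalar_curvatureE G x :
  scalar_curvature G x = \tr (invmx (G x) *m (ric G x)^T).
Proof.
rewrite /scalar_curvature /mxtrace; apply: eq_bigr => a _; rewrite mxE.
by apply: eq_bigr => b _; rewrite !mxE.
Qed.

Lemma currentE G P x : current G P x = \row_a \sum_b cov G P b x a b.
Proof.
apply/rowP => a; rewrite !mxE /current_density; apply: eq_bigr => b _.
rewrite !mxE pdmE -addrA; congr (_ + _); rewrite -big_split /=.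
by apply: eq_bigr => c _; rewrite !mxE !chr_entry; ring.
Qed.

Lemma normJE G P x :
  normJ G P x = Num.sqrt ((current G P x *m G x *m (current G P x)^T) 0 0).
Proof.
rewrite /normJ; congr Num.sqrt; rewrite !mxE exchange_big /=.
apply: eq_bigr => b _; rewrite !mxE mulr_suml; apply: eq_bigr => a _.
by rewrite !mxE; ring.
Qed.

Lemma tr_gE G P x : tr_g G P x = \tr (G x *m (P x)^T).
Proof.
rewrite /tr_g /mxtrace; apply: eq_bigr => a _; rewrite mxE.
by apply: eq_bigr => b _; rewrite !mxE.
Qed.

Lemma normsq_gE G P x :
  normsq_g G P x = \tr (P x *m (G x *m P x *m (G x)^T)^T).
Proof.
rewrite /normsq_g /mxtrace; apply: eq_bigr => a _; rewrite mxE.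
apply: eq_bigr => b _; rewrite !mxE mulr_sumr exchange_big /=.
apply: eq_bigr => d _; rewrite !mxE mulr_suml mulr_sumr.
by apply: eq_bigr => c _; ring.
Qed.

Lemma Ckm_chr k D G a : rop D -> (forall x, D x -> G x \in unitmx) ->
  Ckm k.+1 D G -> Ckm k D (chr G a).
Proof.
move=> oD uG hG; apply: (@Ckm_ext _ _ _ _ _ _ (fun x =>
   2^-1 *: (low_chr G a x *m (invmx (G x))^T))) => //.
  by move=> x _; rewrite chrE.
apply: CkmZ => //; first exact: Ck_cst.
apply: Ckm_mul => //; last by apply: Ckm_tr; apply: Ckm_inv => //; exact: Ckm_le hG.
move=> b d; under eq_fun do rewrite low_chrE !pdmE.
by apply: CkB => //; [apply: CkD => //|]; exact: Ck_pd.
Qed.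

End MatrixForms.

(** * Transformation laws under a change of coordinates *)

Section Invariance.
Context {R : realType} {n : nat}.
Implicit Types (x y : 'rV[R]_n) (a b c : 'I_n).
Variables (D D' : set 'rV[R]_n) (T : 'rV[R]_n -> 'rV[R]_n).
Variables (G H P Q : 'rV[R]_n -> 'M[R]_n).
Hypotheses (oD : rop D) (oD' : rop D') (TD : forall x, D x -> D' (T x)).
Hypothesis CT : forall b, Ck 3 D (fun x => T x 0 b).
Hypotheses (CG : Ckm 2 D G) (CH : Ckm 2 D' H) (CP : Ckm 1 D P) (CQ : Ckm 1 D' Q).
Hypotheses (uG : forall x, D x -> G x \in unitmx).
Hypotheses (uH : forall y, D' y -> H y \in unitmx).
Hypotheses (sG : forall x, D x -> (G x)^T = G x).
Hypotheses (sH : forall y, D' y -> (H y)^T = H y).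

Local Notation S := (jac T).
Local Notation Z a := (pdm a S).

Hypothesis GE : forall x, D x -> G x = S x *m H (T x) *m (S x)^T.
Hypothesis QE : forall x, D x -> Q (T x) = (S x)^T *m P x *m S x.

Let CT1 b : Ck 1 D (fun x => T x 0 b). Proof. exact: (@Ck_le _ _ 1 3 _ _ isT (CT b)). Qed.
Let CS : Ckm 2 D S.
Proof. by move=> i j; under eq_fun do rewrite jacE; exact: (Ck_pd i (CT j)). Qed.
Let CH1 : Ckm 1 D' H. Proof. exact: (@Ckm_le _ _ 1 2 _ _ _ _ isT CH). Qed.
Let CS1 : Ckm 1 D S. Proof. exact: (@Ckm_le _ _ 1 2 _ _ _ _ isT CS). Qed.

Let uS x : D x -> S x \in unitmx.
Proof. by move=> Dx; have := uG Dx; rewrite GE// !unitmx_mul => /andP[/andP[]]. Qed.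

Let ZC a b x : D x -> row b (Z a x) = row a (Z b x).
Proof.
move=> Dx; apply/rowP => k; rewrite [LHS]mxE [RHS]mxE [LHS]pdmE [RHS]pdmE.
have E c : (fun y => S y c k) = pd c (fun y => T y 0 k).
  by apply/funext => y; rewrite jacE.
by rewrite (E a) (E b); exact: (pd_comm a b oD (@Ck_le _ _ 2 3 _ _ isT (CT k)) Dx).
Qed.

(** Third derivatives of T commute; this is what class C^3 is for. *)
Let ZZC a c x : D x -> pdm c (Z a) x = pdm a (Z c) x.
Proof.
move=> Dx; apply/matrixP => b k; rewrite [LHS]pdmE [RHS]pdmE.
have E c' : (fun y => Z c' y b k) = pd c' (fun y => S y b k).
  by apply/funext => y; rewrite pdmE.
by rewrite (E a) (E c); exact: (pd_comm c a oD (CS b k) Dx).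
Qed.

Let dG a x : D x -> pdm a G x = Z a x *m H (T x) *m (S x)^T
  + S x *m (\sum_m S x a m *: pdm m H (T x)) *m (S x)^T
  + S x *m H (T x) *m (Z a x)^T.
Proof.
move=> Dx; rewrite (pdm_ext a oD GE Dx).
have CHT : Ckm 1 D (fun y => H (T y)) := Ckm_comp oD oD' TD CT1 CH1.
have CSH : Ckm 1 D (fun y => S y *m H (T y)) := Ckm_mul oD CS1 CHT.
rewrite (pdm_mul a oD CSH (Ckm_tr CS1) Dx) (pdm_mul a oD CS1 CHT Dx) pdm_tr mulmxDl.
by rewrite (pdm_comp a oD oD' TD CT1 CH1 Dx).
Qed.

(** Six terms contain second derivatives of T. By their symmetry four cancel in pairs and the
    remaining two coincide, whence the factor 2. *)
Let low_chr_trans a x : D x ->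
  low_chr G a x = 2 *: (Z a x *m H (T x) *m (S x)^T)
    + S x *m (\sum_m S x a m *: low_chr H m (T x)) *m (S x)^T.
Proof.
move=> Dx.
pose h (u v : 'rV[R]_n) := (u *m H (T x) *m v^T) 0 0.
have hC u v : h u v = h v u.
  rewrite /h -[in LHS](trmxK (u *m _ *m _)) mxE 2!trmx_mul trmxK.
  by rewrite sH ?mulmxA//; exact: TD.
have hE (A B : 'M[R]_n) b d : (A *m H (T x) *m B^T) b d = h (row b A) (row d B).
  by rewrite /h tr_row -!row_mul !mxE; apply: eq_bigr => k _; rewrite !mxE.
pose t3 a' b' d' := \sum_m \sum_k \sum_l
  S x a' m * (S x b' k * (S x d' l * pdm m H (T x) k l)).
have t3E (F : 'I_n -> 'M[R]_n) a' b' d' :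
    (S x *m (\sum_m S x a' m *: F m) *m (S x)^T) b' d' =
    \sum_m \sum_k \sum_l S x a' m * (S x b' k * (S x d' l * F m k l)).
  rewrite mulmx_sumr mulmx_suml summxE; apply: eq_bigr => m _.
  rewrite -scalemxAr -scalemxAl mxE mxE exchange_big mulr_sumr /=.
  apply: eq_bigr => l _; rewrite mxE mulr_suml mulr_sumr.
  by apply: eq_bigr => k _; rewrite !mxE; ring.
have dGE a' b' d' : pdm a' G x b' d' =
    h (row b' (Z a' x)) (row d' (S x)) + t3 a' b' d' + h (row b' (S x)) (row d' (Z a' x)).
  by rewrite dG// mxE [in LHS]mxE !hE t3E.
apply/matrixP => b d; rewrite low_chrE !dGE [RHS]mxE t3E [X in _ = X + _]mxE hE.
have -> : \sum_m \sum_k \sum_l S x a m * (S x b k * (S x d l * low_chr H m (T x) k l))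
   = t3 a b d + t3 b a d - t3 d a b.
  have -> : t3 b a d = \sum_m \sum_k \sum_l
      S x a m * (S x b k * (S x d l * pdm k H (T x) m l)).
    rewrite /t3 exchange_big; apply: eq_bigr => m _; apply: eq_bigr => k _.
    by apply: eq_bigr => l _; ring.
  have -> : t3 d a b = \sum_m \sum_k \sum_l
      S x a m * (S x b k * (S x d l * pdm l H (T x) m k)).
    rewrite /t3 exchange_big; apply: eq_bigr => m _; rewrite exchange_big.
    by apply: eq_bigr => k _; apply: eq_bigr => l _; ring.
  rewrite -big_split -sumrB; apply: eq_bigr => m _.
  rewrite -big_split -sumrB; apply: eq_bigr => k _.
  rewrite -big_split -sumrB; apply: eq_bigr => l _.
  by rewrite low_chrE /=; ring.
rewrite (ZC b a Dx) (ZC d a Dx) (ZC d b Dx) !(hC (row _ (S x))).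
ring.
Qed.

Let N a x : 'M[R]_n := \sum_m S x a m *: chr H m (T x).

Let KE x : D x -> invmx (G x) = invmx (S x)^T *m invmx (H (T x)) *m invmx (S x).
Proof.
move=> Dx; have u1 := uS Dx; have u2 := uH (TD Dx).
have u3 : (S x)^T \in unitmx by rewrite unitmx_tr.
apply: (can_inj (mulKmx (uG Dx))); rewrite mulmxV ?uG//.
by rewrite {1}GE// !mulmxA mulmxK// mulmxK// mulmxV.
Qed.

(** The gauge transformation law of a connection, A S = dS + S A', with [N] the pulled-back
    connection A' and dS the inhomogeneous term. *)
Let chr_trans a x : D x -> chr G a x *m S x = Z a x + S x *m N a x.
Proof.
move=> Dx; have u1 := uS Dx; have u2 := uH (TD Dx).
have u3 : (S x)^T \in unitmx by rewrite unitmx_tr.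
rewrite chrE low_chr_trans// trmx_inv sG// KE// -scalemxAl -mulmxA mulmxKV//.
rewrite mulmxDl -scalemxAl !mulmxA mulmxK// mulmxK// scalerDr scalerA.
rewrite mulVf ?pnatr_eq0// scale1r mulmxK// -mulmxA scalemxAr; congr (_ + _ *m _).
rewrite /N mulmx_suml scaler_sumr; apply: eq_bigr => m _.
by rewrite chrE trmx_inv sH -?scalemxAl ?scalerA 1?mulrC//; exact: TD.
Qed.

Let CchrG a : Ckm 1 D (chr G a). Proof. exact: Ckm_chr. Qed.
Let CchrH a : Ckm 1 D' (chr H a). Proof. exact: Ckm_chr. Qed.

Let CchrHT a : Ckm 1 D (fun y => chr H a (T y)).
Proof. exact: (Ckm_comp oD oD' TD CT1 (CchrH a)). Qed.

Let CN a : Ckm 1 D (N a).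
Proof. by apply: Ckm_sum => // m; apply: CkmZ => //; exact: CS1. Qed.

Let CZ a : Ckm 1 D (Z a). Proof. exact: (Ckm_pdm a oD CS). Qed.

Let dN c a x : D x -> pdm c (N a) x =
  \sum_m (Z c x a m *: chr H m (T x)
    + S x a m *: \sum_k S x c k *: pdm k (chr H m) (T x)).
Proof.
move=> Dx; rewrite (pdm_sum c oD _ Dx); last by move=> m; apply: CkmZ => //; exact: CS1.
apply: eq_bigr => m _; rewrite (pdmZ c oD (CS1 a m) (CchrHT m) Dx).
by rewrite (pdm_comp c oD oD' TD CT1 (CchrH m) Dx) [Z c x a m]pdmE.
Qed.

Let dchr c a x : D x ->
  pdm c (chr G a) x *m S x + chr G a x *m Z c x =
  pdm c (Z a) x + Z c x *m N a x + S x *m pdm c (N a) x.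
Proof.
move=> Dx; rewrite -(pdm_mul c oD (CchrG a) CS1 Dx).
rewrite (pdm_ext c oD (chr_trans a) Dx) (pdmD c oD (CZ a) (Ckm_mul oD CS1 (CN a)) Dx).
by rewrite (pdm_mul c oD CS1 (CN a) Dx) addrA.
Qed.

(* F_ca S = S sum_km S_ck S_am F_km: the curvature is a gauge tensor. *)
Let curv_trans c a x : D x -> curv G c a x *m S x =
  S x *m \sum_k S x c k *: \sum_m S x a m *: curv H k m (T x).
Proof.
move=> Dx.
have ZE b : Z b x = chr G b x *m S x - S x *m N b x by rewrite chr_trans// addrK.
have h1 : pdm c (chr G a) x *m S x =
    pdm c (Z a) x + Z c x *m N a x + S x *m pdm c (N a) x - chr G a x *m Z c x.
  by rewrite -dchr// addrK.
have h2 : pdm a (chr G c) x *m S x =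
    pdm c (Z a) x + Z a x *m N c x + S x *m pdm a (N c) x - chr G c x *m Z a x.
  by rewrite (ZZC a c Dx) -dchr// addrK.
have -> : \sum_k S x c k *: (\sum_m S x a m *: curv H k m (T x)) =
    pdm c (N a) x - pdm a (N c) x + N a x *m N c x - N c x *m N a x.
  rewrite !dN// !big_split /=.
  have -> : \sum_m Z a x c m *: chr H m (T x) = \sum_m Z c x a m *: chr H m (T x).
    apply: eq_bigr => m _; congr (_ *: _).
    by have /rowP/(_ m) := ZC a c Dx; rewrite mxE [RHS]mxE.
  pose db (F : 'I_n -> 'I_n -> 'M[R]_n) := \sum_k \sum_m (S x c k * S x a m) *: F k m.
  have -> : \sum_m S x a m *: (\sum_k S x c k *: pdm k (chr H m) (T x)) =
      db (fun k m => pdm k (chr H m) (T x)).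
    rewrite /db exchange_big; apply: eq_bigr => m _; rewrite scaler_sumr.
    by apply: eq_bigr => k _; rewrite scalerA mulrC.
  have -> : \sum_m S x c m *: (\sum_k S x a k *: pdm k (chr H m) (T x)) =
      db (fun k m => pdm m (chr H k) (T x)).
    rewrite /db; apply: eq_bigr => m _; rewrite scaler_sumr.
    by apply: eq_bigr => k _; rewrite scalerA.
  have -> : N a x *m N c x = db (fun k m => chr H m (T x) *m chr H k (T x)).
    rewrite /db /N mulmx_sumr; apply: eq_bigr => k _; rewrite mulmx_suml.
    by apply: eq_bigr => m _; rewrite -scalemxAl -scalemxAr scalerA mulrC.
  have -> : N c x *m N a x = db (fun k m => chr H k (T x) *m chr H m (T x)).
    rewrite /db /N mulmx_suml; apply: eq_bigr => k _; rewrite mulmx_sumr.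
    by apply: eq_bigr => m _; rewrite -scalemxAl -scalemxAr scalerA mulrC.
  rewrite opprD addrACA subrr add0r /db -!(sumrB, big_split) /=.
  apply: eq_bigr => k _; rewrite scaler_sumr -!(sumrB, big_split) /=.
  apply: eq_bigr => m _; rewrite scalerA /curv.
  by rewrite scalerBr scalerDr scalerBr.
rewrite /curv !(mulmxBl, mulmxDl) h1 h2 -!mulmxA (ZE a) (ZE c).
rewrite !(mulmxDr, mulmxDl) !(mulmxN, mulNmx) !mulmxA.
(* The third derivatives [u1] cancel between the two orders of differentiation, the mixed products
   of [chr G] and [N] cancel in pairs, and the commutator of [chr G] cancels against [r] and [v]. *)
have aux (u1 u2 u3 p q r s t v w : 'M[R]_n) :
    u1 + (p - q) + u2 - (r - s) - (u1 + (s - t) + u3 - (v - w)) + r - v =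
    u2 - u3 + t - q + (p - w).
  by apply/matrixP => i j; rewrite !mxE; ring.
by rewrite aux subrr addr0.
Qed.

(** Contraction of an upper with a lower index: S and its inverse meet in the sum over c. *)
Let trace_jac (W : 'I_n -> 'M[R]_n) x i : D x ->
  \sum_c (\sum_k S x c k *: W k *m invmx (S x)) i c = \sum_k W k i k.
Proof.
move=> Dx; under eq_bigr do rewrite summxE.
rewrite exchange_big; apply: eq_bigr => k _.
rewrite -[W k in RHS](mulmxKV (uS Dx)) mxE; apply: eq_bigr => c _.
by rewrite -scalemxAl mxE mulrC.
Qed.

Let ric_trans x : D x -> ric G x = S x *m ric H (T x) *m (S x)^T.
Proof.
move=> Dx; apply/matrixP => a b; rewrite mxE ricciE.
have E c : curv G c a x = \sum_k S x c k *:
    (S x *m \sum_m S x a m *: curv H k m (T x)) *m invmx (S x).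
  rewrite -[LHS](mulmxK (uS Dx)) curv_trans// mulmx_sumr mulmx_suml.
  by apply: eq_bigr => k _; rewrite -scalemxAr.
under eq_bigr do rewrite E.
rewrite trace_jac//.
transitivity (\sum_k \sum_p \sum_m S x b p * (S x a m * curv H k m (T x) p k)).
  apply: eq_bigr => k _; rewrite mxE; apply: eq_bigr => p _.
  by rewrite summxE mulr_sumr; apply: eq_bigr => m _; rewrite mxE.
rewrite exchange_big /=; under eq_bigr do rewrite exchange_big /=.
rewrite exchange_big -mulmxA mxE; apply: eq_bigr => m _.
rewrite mxE mulr_sumr; apply: eq_bigr => p _.
rewrite mxE [in RHS]mxE ricciE mulr_suml mulr_sumr; apply: eq_bigr => k _.
by ring.
Qed.

Let scalar_curvature_trans x : D x ->
  scalar_curvature G x = scalar_curvature H (T x).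
Proof.
move=> Dx; rewrite !scalar_curvatureE ric_trans// KE// 2!trmx_mul trmxK.
rewrite -!mulmxA mulKmx ?uS//.
by rewrite mxtrace_mulC -!mulmxA mulmxV ?mulmx1// unitmx_tr uS.
Qed.

Let cov_trans b x : D x ->
  (S x)^T *m cov G P b x *m S x = \sum_m S x b m *: cov H Q m (T x).
Proof.
move=> Dx.
have ZE : Z b x = chr G b x *m S x - S x *m N b x by rewrite chr_trans// addrK.
have : pdm b (fun y => Q (T y)) x = (Z b x)^T *m P x *m S x
    + (S x)^T *m pdm b P x *m S x + (S x)^T *m P x *m Z b x.
  rewrite (pdm_ext b oD QE Dx).
  have C1 := Ckm_mul oD (Ckm_tr CS1) CP.
  rewrite (pdm_mul b oD C1 CS1 Dx) (pdm_mul b oD (Ckm_tr CS1) CP Dx) pdm_tr.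
  by rewrite mulmxDl.
rewrite (pdm_comp b oD oD' TD CT1 CQ Dx) => h.
have -> : \sum_m S x b m *: cov H Q m (T x) =
    \sum_m S x b m *: pdm m Q (T x) + (N b x)^T *m Q (T x) + Q (T x) *m N b x.
  rewrite /cov /N linear_sum mulmx_sumr mulmx_suml -!big_split /=.
  apply: eq_bigr => m _.
  by rewrite linearZ -scalemxAl -scalemxAr !scalerDr.
rewrite h QE// ZE /cov linearB /= !trmx_mul.
rewrite !(mulmxDr, mulmxDl) !(mulmxN, mulNmx) !mulmxA.
have aux (p q r s t : 'M[R]_n) : p + q + r = q - s + p + (r - t) + s + t.
  by apply/matrixP => i j; rewrite !mxE; ring.
exact: aux.
Qed.

Let current_trans x : D x -> current H Q (T x) = current G P x *m S x.
Proof.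
move=> Dx; rewrite !currentE; apply/rowP => k; rewrite mxE.
rewrite -(trace_jac _ k Dx) mxE.
have E b : \sum_m S x b m *: cov H Q m (T x) *m invmx (S x) =
    (S x)^T *m cov G P b x.
  by rewrite -mulmx_suml -cov_trans// mulmxK// uS.
under [RHS]eq_bigr do rewrite mxE mulr_suml.
rewrite exchange_big; apply: eq_bigr => b _.
rewrite E mxE; apply: eq_bigr => a _; rewrite !mxE; ring.
Qed.

Lemma sigma_loc_trans x : D x -> sigma_loc G P x = sigma_loc H Q (T x).
Proof.
move=> Dx; rewrite /sigma_loc /energy_density scalar_curvature_trans//.
have -> : normJ G P x = normJ H Q (T x).
  rewrite !normJE current_trans// GE//; congr (Num.sqrt (_ 0 0)).
  by rewrite trmx_mul !mulmxA.
have -> : tr_g G P x = tr_g H Q (T x).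
  rewrite !tr_gE QE// GE// !trmx_mul trmxK -!mulmxA mxtrace_mulC.
  by rewrite -!mulmxA.
have -> : normsq_g G P x = normsq_g H Q (T x).
  rewrite !normsq_gE QE// GE//.
  by rewrite !trmx_mul !trmxK !mulmxA mxtrace_mulC !mulmxA.
by [].
Qed.

End Invariance.

(** * Ellipticity of the principal part *)

Section QuadraticForms.
Context {R : realType} {n : nat}.
Implicit Types (A G K : 'M[R]_n) (u v : 'rV[R]_n).

Definition qf A u v : R := (u *m A *m v^T) 0 0.
(** The squared Euclidean norm; the norm of ['rV[R]_n] itself is the maximum norm. *)
Definition sqn u : R := \sum_i u 0 i ^+ 2.

Lemma qfE A u v : qf A u v = \sum_i \sum_j u 0 i * A i j * v 0 j.
Proof.
rewrite /qf mxE exchange_big; apply: eq_bigr => j _.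
by rewrite !mxE mulr_suml.
Qed.

Lemma qfDl A u v w : qf A (u + v) w = qf A u w + qf A v w.
Proof. by rewrite /qf !mulmxDl mxE. Qed.

Lemma qfDr A u v w : qf A u (v + w) = qf A u v + qf A u w.
Proof. by rewrite /qf linearD mulmxDr mxE. Qed.

Lemma qfZl A (c : R) u v : qf A (c *: u) v = c * qf A u v.
Proof. by rewrite /qf -!scalemxAl mxE. Qed.

Lemma qfZr A (c : R) u v : qf A u (c *: v) = c * qf A u v.
Proof. by rewrite /qf linearZ -scalemxAr mxE. Qed.

Lemma qf_mxD A B u v : qf (A + B) u v = qf A u v + qf B u v.
Proof. by rewrite /qf mulmxDr mulmxDl mxE. Qed.

Lemma qf_mxZ A (c : R) u v : qf (c *: A) u v = c * qf A u v.
Proof. by rewrite /qf -scalemxAr -scalemxAl mxE. Qed.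

Lemma qfC A u v : A^T = A -> qf A u v = qf A v u.
Proof.
move=> sA; rewrite /qf -[in LHS](trmxK (u *m _ *m _)) mxE 2!trmx_mul trmxK.
by rewrite sA mulmxA.
Qed.

Lemma sqn_ge0 u : 0 <= sqn u.
Proof. by apply: sumr_ge0 => i _; exact: sqr_ge0. Qed.

Lemma sqn_coord u i : u 0 i ^+ 2 <= sqn u.
Proof.
by rewrite /sqn (bigD1 i)//= lerDl sumr_ge0// => j _; exact: sqr_ge0.
Qed.

Lemma sqn_eq0 u : (sqn u == 0) = (u == 0).
Proof.
apply/eqP/eqP => [u0|->]; last by rewrite /sqn big1// => i _; rewrite mxE expr0n.
apply/rowP => i; rewrite mxE; apply/eqP; rewrite -sqrf_eq0 eq_le sqr_ge0 andbT.
by rewrite -u0 sqn_coord.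
Qed.

(** From 2 |u_i u_j| <= u_i^2 + u_j^2, summed over all pairs. *)
Lemma qf_ge A (b : R) u : (forall i j, `|A i j| <= b) ->
  `|qf A u u| <= n%:R * b * sqn u.
Proof.
move=> hA.
apply: (@le_trans _ _ (\sum_i \sum_j b * ((u 0 i ^+ 2 + u 0 j ^+ 2) / 2))).
  rewrite qfE (le_trans (ler_norm_sum _ _ _))// ler_sum// => i _.
  rewrite (le_trans (ler_norm_sum _ _ _))// ler_sum// => j _.
  rewrite mulrAC normrM mulrC ler_pM//.
  rewrite normrM -(real_normK (num_real (u 0 i))) -(real_normK (num_real (u 0 j))).
  have := sqr_ge0 (`|u 0 i| - `|u 0 j|); rewrite sqrrB; lra.
rewrite le_eqVlt; apply/orP; left; apply/eqP.
under eq_bigr do rewrite -mulr_sumr -mulr_suml big_split /= sumr_const card_ord.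
rewrite -mulr_sumr -mulr_suml big_split /= sumr_const card_ord sumrMnl.
rewrite -/(sqn u) -mulr_natl.
by field.
Qed.

Lemma qf_CS A u v : A^T = A -> (forall u, 0 <= qf A u u) ->
  qf A u v ^+ 2 <= qf A u u * qf A v v.
Proof.
move=> sA pA; have key (s r : R) : 0 <= s ^+ 2 * qf A u u + 2 * s * r * qf A u v + r ^+ 2 * qf A v v.
  have := pA (s *: u + r *: v); rewrite !(qfDl, qfDr, qfZl, qfZr) (qfC v u sA).
  by congr (_ <= _); ring.
have [q0|q0] := eqVneq (qf A v v) 0.
  rewrite q0 mulr0; have [->|c0] := eqVneq (qf A u v) 0; first by rewrite expr0n.
  (* The form may be degenerate. If it vanishes at v but not at (u, v), then it takes the value -1
     at u plus this multiple of v. *)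
  have := key 1 (- (qf A u u + 1) / (2 * qf A u v)); rewrite q0.
  have -> : 1 ^+ 2 * qf A u u + 2 * 1 * (- (qf A u u + 1) / (2 * qf A u v)) *
    qf A u v + (- (qf A u u + 1) / (2 * qf A u v)) ^+ 2 * 0 = -1 :> R by field.
  by rewrite ler0N1.
have qv : 0 < qf A v v by rewrite lt_def q0 pA.
have := key (qf A v v) (- qf A u v).
have -> : qf A v v ^+ 2 * qf A u u + 2 * qf A v v * - qf A u v * qf A u v +
  (- qf A u v) ^+ 2 * qf A v v = qf A v v * (qf A u u * qf A v v - qf A u v ^+ 2).
  by ring.
by rewrite pmulr_rge0// subr_ge0.
Qed.

Lemma qf_minkowski A u v : A^T = A -> (forall u, 0 <= qf A u u) ->
  Num.sqrt (qf A (u + v) (u + v)) <= Num.sqrt (qf A u u) + Num.sqrt (qf A v v).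
Proof.
move=> sA pA; set p := Num.sqrt (qf A u u); set q := Num.sqrt (qf A v v).
have p0 : 0 <= p by exact: sqrtr_ge0.
have q0 : 0 <= q by exact: sqrtr_ge0.
rewrite -(ler_pXn2r (n := 2)) ?nnegrE ?addr_ge0 ?sqrtr_ge0//.
rewrite sqr_sqrtr// !(qfDl, qfDr) (qfC v u sA) sqrrD !sqr_sqrtr//.
have : qf A u v <= p * q.
  rewrite (le_trans (ler_norm _))// -(ler_pXn2r (n := 2)) ?nnegrE ?mulr_ge0//.
  by rewrite real_normK ?num_real// exprMn !sqr_sqrtr// qf_CS.
lra.
Qed.

Section Inverse.
Variables (G : 'M[R]_n) (lam : R).
Hypotheses (sG : G^T = G) (lam0 : 0 < lam).
Hypothesis pG : forall u, lam * sqn u <= qf G u u.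

Lemma elliptic_ge0 u : 0 <= qf G u u.
Proof. by rewrite (le_trans _ (pG u))// mulr_ge0 ?sqn_ge0// ltW. Qed.

Lemma elliptic_unit : G \in unitmx.
Proof.
rewrite -row_free_unit -kermx_eq0; apply/rowV0P => v /sub_kermxP vG.
apply/eqP; rewrite -sqn_eq0 eq_le sqn_ge0 andbT -(pmulr_rle0 _ lam0).
by rewrite (le_trans (pG v))// /qf vG mul0mx mxE.
Qed.

Lemma elliptic_invC : (invmx G)^T = invmx G.
Proof. by rewrite trmx_inv sG. Qed.

Lemma qf_inv u : qf (invmx G) u u = qf G (u *m invmx G) (u *m invmx G).
Proof.
by rewrite /qf trmx_mul elliptic_invC !mulmxA mulmxKV// elliptic_unit.
Qed.

(** For the row u = e_i G^-1, lam |u|^2 <= G(u, u) = u_i <= |u|: this bounds u_i by 1/lam, and then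
    every entry of u. *)
Lemma elliptic_inv_le i j : `|invmx G i j| <= lam^-1.
Proof.
pose d : 'rV[R]_n := delta_mx 0 i; pose u := d *m invmx G.
have uE k : u 0 k = invmx G i k by rewrite /u /d -rowE mxE.
have quE : qf G u u = u 0 i.
  by rewrite -qf_inv /qf /d -rowE trmx_delta -colE mxE mxE uE.
have l0 : 0 <= lam^-1 by rewrite invr_ge0 ltW.
have h1 : lam * sqn u <= `|u 0 i| by rewrite (le_trans (pG u))// quE ler_norm.
have h2 : `|u 0 i| <= lam^-1.
  have [->|ui0] := eqVneq (u 0 i) 0; first by rewrite normr0.
  rewrite -(ler_pM2l lam0) mulfV ?gt_eqF// -(ler_pM2r (_ : 0 < `|u 0 i|)) ?normr_gt0//.
  rewrite mul1r -mulrA -expr2 real_normK ?num_real//.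
  by rewrite (le_trans _ h1)// ler_pM2l// sqn_coord.
rewrite -uE -(ler_pXn2r (n := 2)) ?nnegrE//.
rewrite real_normK ?num_real// (le_trans (sqn_coord u j))//.
rewrite -(ler_pM2l lam0) (le_trans h1)// (le_trans h2)//.
by rewrite expr2 mulrA mulfV ?gt_eqF// mul1r.
Qed.

(** Cauchy-Schwarz for u G^-1 and u gives |u|^4 <= G^-1(u, u) G(u, u), and G(u, u) <= n b |u|^2. *)
Lemma qf_inv_ge (b : R) u : (forall i j, `|G i j| <= b) ->
  sqn u <= n%:R * b * qf (invmx G) u u.
Proof.
move=> hb; have [->|u0] := eqVneq u 0.
  have -> : sqn (0 : 'rV[R]_n) = 0 by apply/eqP; rewrite sqn_eq0.
  by rewrite /qf mul0mx mul0mx mxE mulr0.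
have su : 0 < sqn u by rewrite lt_def sqn_eq0 u0 sqn_ge0.
have h1 : sqn u ^+ 2 <= qf (invmx G) u u * qf G u u.
  rewrite qf_inv; have := qf_CS (u *m invmx G) u sG elliptic_ge0.
  suff -> : qf G (u *m invmx G) u = sqn u by [].
  rewrite /qf mulmxKV ?elliptic_unit// mxE; apply: eq_bigr => i _.
  by rewrite mxE expr2.
have h2 : qf G u u <= n%:R * b * sqn u.
  by rewrite (le_trans (ler_norm _))// qf_ge.
have k0 : 0 <= qf (invmx G) u u by rewrite qf_inv elliptic_ge0.
have := le_trans h1 (ler_wpM2l k0 h2).
rewrite expr2 !mulrA ler_pM2r//.
by rewrite -mulrA mulrC.
Qed.

End Inverse.

(* The principal part of h = f E -> DR(f E) at the metric with inverse K. *)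
Definition symb K E : 'M[R]_n := \tr (K *m E) *: K - K *m E *m K.

(** For E = G the symbol is (n - 1) G^-1. Replacing G by E changes the trace by at most n^2 kap /
    lam and the second term by n kap / lam times G^-1(u, u). The smallness of kap makes the total at
    most 1, which leaves n - 2 >= 1. *)
Lemma symb_elliptic (G E : 'M[R]_n) (lam kap b : R) u :
    (3 <= n)%N -> G^T = G -> 0 < lam -> (forall u, lam * sqn u <= qf G u u) ->
    (forall i j, `|G i j| <= b) -> (forall i j, `|G i j - E i j| <= kap) ->
    n%:R * (n%:R + 1) * kap <= lam ->
  sqn u <= n%:R * b * qf (symb (invmx G) E) u u.
Proof.
move=> n3 sG lam0 pG hb hk kl.
have uG := elliptic_unit lam0 pG; have sK := elliptic_invC sG.
set K := invmx G in sK *.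
have k0 : 0 <= kap.
  have i : 'I_n := Ordinal (leq_trans (isT : (0 < 3)%N) n3).
  exact: le_trans (normr_ge0 _) (hk i i).
pose v := u *m K; set q := qf K u u.
have qE : q = qf G v v by exact: (qf_inv sG lam0 pG u).
have q0 : 0 <= q by rewrite qE; exact: (elliptic_ge0 lam0 pG).
have EE : E = G - (G - E) by rewrite subKr.
have h1 : `|\tr (K *m (G - E))| <= n%:R ^+ 2 * (kap / lam).
  rewrite /mxtrace (le_trans (ler_norm_sum _ _ _))//.
  apply: (@le_trans _ _ (\sum_(i < n) n%:R * (kap / lam))); last first.
    by rewrite sumr_const card_ord -[leLHS]mulr_natl expr2 !mulrA.
  apply: ler_sum => i _; rewrite mxE (le_trans (ler_norm_sum _ _ _))//.
  apply: (@le_trans _ _ (\sum_(i < n) (kap / lam))); last first.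
    by rewrite sumr_const card_ord mulr_natl.
  apply: ler_sum => j _; rewrite normrM mulrC ler_pM//; first by rewrite !mxE.
  exact: elliptic_inv_le.
have h2 : `|qf (G - E) v v| <= n%:R * kap * (q / lam).
  have h := @qf_ge (G - E) kap v; rewrite (le_trans (h _))//.
    by move=> i j; rewrite !mxE.
  rewrite ler_wpM2l ?mulr_ge0// ler_pdivlMr// mulrC qE; exact: pG.
have -> : qf (symb K E) u u = (n%:R - \tr (K *m (G - E))) * q - (q - qf (G - E) v v).
  have eB (A B : 'M[R]_n) w : qf (A - B) w w = qf A w w - qf B w w.
    by rewrite qf_mxD -scaleN1r qf_mxZ mulN1r.
  rewrite /symb (eB (_ *: _)) qf_mxZ -/q; congr (_ * _ - _).
    rewrite [in LHS]EE mulmxBr mulVmx// linearB /= mxtrace1; ring.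
  rewrite eB -qE subKr /qf /v trmx_mul sK !mulmxA //.
have h3 : q <= (n%:R - \tr (K *m (G - E))) * q - (q - qf (G - E) v v).
  have n3' : (3%:R : R) <= n%:R by rewrite ler_nat.
  move: h1 h2; rewrite !ler_norml => /andP[_ h1] /andP[h2 _].
  have h4 : \tr (K *m (G - E)) * q <= n%:R ^+ 2 * (kap / lam) * q.
    exact: ler_wpM2r.
  have h5 : (n%:R ^+ 2 + n%:R) * (kap / lam) <= 1 :> R.
    by rewrite mulrA ler_pdivrMr// mul1r (le_trans _ kl)// le_eqVlt; apply/orP; left; apply/eqP; ring.
  have h6 := ler_wpM2r q0 h5.
  have h7 : 3%:R * q <= n%:R * q by exact: ler_wpM2r.
  have h8 : n%:R * kap * (q / lam) = n%:R * (kap / lam) * q by ring.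
  rewrite h8 in h2.
  have : (n%:R - \tr (K *m (G - E))) * q = n%:R * q - \tr (K *m (G - E)) * q by ring.
  move=> ->; move: h6; rewrite mulrDl mulrDl mul1r; move: h2 h4 h7.
  lra.
rewrite (le_trans (qf_inv_ge sG lam0 pG u hb))// -/K -/q ler_wpM2l//.
have i : 'I_n := Ordinal (leq_trans (isT : (0 < 3)%N) n3).
by rewrite mulr_ge0// (le_trans (normr_ge0 _) (hb i i)).
Qed.

End QuadraticForms.

(** * The curvature and the current as functions of jets *)

Section UniformlyClose.
Context {R : realType} {I : Type}.
Variables (S : set I) (e : I -> R).
Implicit Types v w : I -> R.

Definition bdd v : Prop := exists2 C : R, 0 <= C & forall z, S z -> `|v z| <= C.

(** Both families are bounded and v' = v + O(e), uniformly over S. Sums and products preserve this,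
    so estimates for polynomial expressions follow from their mere shape. *)
Definition cl v v' : Prop :=
  [/\ bdd v, bdd v' & exists2 C : R, 0 <= C &
     forall z, S z -> `|v' z - v z| <= C * e z].

Lemma bdd_cst (c : R) : bdd (fun=> c).
Proof. by exists `|c|. Qed.

Lemma bddD v w : bdd v -> bdd w -> bdd (fun z => v z + w z).
Proof.
move=> [C C0 hv] [B B0 hw]; exists (C + B); first exact: addr_ge0.
by move=> z Sz; rewrite (le_trans (ler_normD _ _))// lerD ?hv ?hw.
Qed.

Lemma bddM v w : bdd v -> bdd w -> bdd (fun z => v z * w z).
Proof.
move=> [C C0 hv] [B B0 hw]; exists (C * B); first exact: mulr_ge0.
by move=> z Sz; rewrite normrM ler_pM ?hv ?hw.
Qed.

Lemma bdd_unif (p q : nat) (A : I -> 'M[R]_(p, q)) :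
  (forall i j, bdd (fun z => A z i j)) ->
  exists2 C : R, 0 <= C & forall z, S z -> forall i j, `|A z i j| <= C.
Proof.
move=> h.
have /choice[c hc] (ij : 'I_p * 'I_q) : exists C : R, 0 <= C /\
    forall z, S z -> `|A z ij.1 ij.2| <= C.
  by have [C C0 h'] := h ij.1 ij.2; exists C.
exists (\sum_ij c ij); first by apply: sumr_ge0 => i _; exact: (hc i).1.
move=> z Sz i j; apply: le_trans ((hc (i, j)).2 z Sz) _.
by rewrite (bigD1 (i, j))//= lerDl sumr_ge0// => k _; exact: (hc k).1.
Qed.

Lemma cl_refl v : bdd v -> cl v v.
Proof.
by move=> hv; split=> //; exists 0 => // z _; rewrite subrr normr0 mul0r.
Qed.

Lemma cl_cst (c : R) : cl (fun=> c) (fun=> c).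
Proof. exact/cl_refl/bdd_cst. Qed.

Lemma cl_ext v v' w w' : (forall z, S z -> v z = w z) ->
  (forall z, S z -> v' z = w' z) -> cl v v' -> cl w w'.
Proof.
move=> vw vw' [[C C0 h1] [C' C'0 h2] [B B0 h3]]; split.
- by exists C => // z Sz; rewrite -vw// h1.
- by exists C' => // z Sz; rewrite -vw'// h2.
- by exists B => // z Sz; rewrite -vw// -vw'// h3.
Qed.

Lemma clD v v' w w' : cl v v' -> cl w w' ->
  cl (fun z => v z + w z) (fun z => v' z + w' z).
Proof.
move=> [h1 h2 [B B0 h3]] [k1 k2 [C C0 k3]]; split; [exact: bddD|exact: bddD|].
exists (B + C); first exact: addr_ge0.
move=> z Sz; rewrite opprD addrACA mulrDl (le_trans (ler_normD _ _))//.
by rewrite lerD ?h3 ?k3.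
Qed.

Lemma clM v v' w w' : cl v v' -> cl w w' ->
  cl (fun z => v z * w z) (fun z => v' z * w' z).
Proof.
move=> [h1 h2 [B B0 h3]] [k1 k2 [C C0 k3]]; split; [exact: bddM|exact: bddM|].
have [c1 c10 hc1] := k1; have [c2 c20 hc2] := h2.
exists (B * c1 + c2 * C); first by rewrite addr_ge0// mulr_ge0.
move=> z Sz.
have -> : v' z * w' z - v z * w z = (v' z - v z) * w z + v' z * (w' z - w z) by ring.
rewrite (le_trans (ler_normD _ _))// [leRHS]mulrDl lerD// normrM.
  by rewrite mulrAC ler_pM ?h3 ?hc1.
by rewrite -mulrA ler_pM ?k3 ?hc2.
Qed.

Lemma clN v v' : cl v v' -> cl (fun z => - v z) (fun z => - v' z).
Proof.
by move=> /(clM (cl_cst (-1))); apply: cl_ext => z _; rewrite mulN1r.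
Qed.

Lemma clB v v' w w' : cl v v' -> cl w w' ->
  cl (fun z => v z - w z) (fun z => v' z - w' z).
Proof. by move=> h k; apply: clD => //; exact: clN. Qed.

Lemma cl_sum (J : Type) (r : seq J) (P : pred J) (F F' : J -> I -> R) :
  (forall j, cl (F j) (F' j)) ->
  cl (fun z => \sum_(j <- r | P j) F j z) (fun z => \sum_(j <- r | P j) F' j z).
Proof.
move=> h; elim: r => [|j r IH].
  by apply: cl_ext (cl_cst 0) => z _; rewrite big_nil.
case Pj : (P j).
  by apply: cl_ext (clD (h j) IH) => z _; rewrite big_cons Pj.
by apply: cl_ext IH => z _; rewrite big_cons Pj.
Qed.

Definition clm (p q : nat) (A A' : I -> 'M[R]_(p, q)) : Prop :=
  forall i j, cl (fun z => A z i j) (fun z => A' z i j).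

Lemma clm_ext (p q : nat) (A A' B B' : I -> 'M[R]_(p, q)) :
  (forall z, S z -> A z = B z) -> (forall z, S z -> A' z = B' z) ->
  clm A A' -> clm B B'.
Proof.
by move=> AB AB' h i j; apply: cl_ext (h i j) => z Sz; rewrite ?AB ?AB'.
Qed.

Lemma clmD (p q : nat) (A A' B B' : I -> 'M[R]_(p, q)) : clm A A' -> clm B B' ->
  clm (fun z => A z + B z) (fun z => A' z + B' z).
Proof.
by move=> h k i j; apply: cl_ext (clD (h i j) (k i j)) => z _; rewrite mxE.
Qed.

Lemma clmB (p q : nat) (A A' B B' : I -> 'M[R]_(p, q)) : clm A A' -> clm B B' ->
  clm (fun z => A z - B z) (fun z => A' z - B' z).
Proof.
by move=> h k i j; apply: cl_ext (clB (h i j) (k i j)) => z _; rewrite !mxE.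
Qed.

Lemma clm_scale (p q : nat) v v' (A A' : I -> 'M[R]_(p, q)) : cl v v' -> clm A A' ->
  clm (fun z => v z *: A z) (fun z => v' z *: A' z).
Proof.
by move=> h k i j; apply: cl_ext (clM h (k i j)) => z _; rewrite mxE.
Qed.

Lemma clm_tr (p q : nat) (A A' : I -> 'M[R]_(p, q)) : clm A A' ->
  clm (fun z => (A z)^T) (fun z => (A' z)^T).
Proof. by move=> h i j; apply: cl_ext (h j i) => z _; rewrite mxE. Qed.

Lemma clm_mul (p q r : nat) (A A' : I -> 'M[R]_(p, q)) (B B' : I -> 'M[R]_(q, r)) :
  clm A A' -> clm B B' -> clm (fun z => A z *m B z) (fun z => A' z *m B' z).
Proof.
move=> h k i j; apply: cl_ext (cl_sum _ _ (fun l => clM (h i l) (k l j))) => z _;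
  by rewrite mxE.
Qed.

Lemma cl_tr (p : nat) (A A' : I -> 'M[R]_p) : clm A A' ->
  cl (fun z => \tr (A z)) (fun z => \tr (A' z)).
Proof. by move=> h; exact: cl_sum (fun i => h i i). Qed.

End UniformlyClose.

Arguments cl_refl {R I S e v}.

(* The part of the scalar curvature that is linear in the second derivatives W
   of the metric. *)
Definition scal2 (R : realType) (n : nat) (K : 'M[R]_n)
    (W : 'I_n -> 'I_n -> 'M[R]_n) : R :=
  2^-1 * \sum_a \sum_b \sum_c \sum_d K a b * K c d *
    (W c a b d + W c b a d - W c d a b - (W a c b d + W a b c d - W a d c b)).

Section ScalarSecondOrder.
Context {R : realType} {n : nat}.
Implicit Types (K E : 'M[R]_n) (W : 'I_n -> 'I_n -> 'M[R]_n).

Lemma scal2D K W W' : scal2 K (fun c a => W c a + W' c a) = scal2 K W + scal2 K W'.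
Proof.
rewrite /scal2 -mulrDr; congr (_ * _).
rewrite -big_split; apply: eq_bigr => a _ /=.
rewrite -big_split; apply: eq_bigr => b _ /=.
rewrite -big_split; apply: eq_bigr => c _ /=.
rewrite -big_split; apply: eq_bigr => d _ /=.
by rewrite !mxE; ring.
Qed.

Lemma prod4 (p q : 'I_n -> 'I_n -> R) :
  \sum_a \sum_b \sum_c \sum_d p a b * q c d =
  (\sum_a \sum_b p a b) * (\sum_c \sum_d q c d).
Proof.
rewrite mulr_suml; apply: eq_bigr => a _; rewrite mulr_suml.
apply: eq_bigr => b _; rewrite mulr_sumr; apply: eq_bigr => c _.
by rewrite mulr_sumr.
Qed.

(** Of the six contractions, two cancel by the symmetry of [phi]. The others coincide in pairs: [X]
    carries the coefficient K E K and [Y] the coefficient tr(K E) K. *)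
Lemma scal2_symb K E (phi : 'I_n -> 'I_n -> R) : K^T = K -> E^T = E ->
  (forall a b, phi a b = phi b a) ->
  scal2 K (fun c a => phi c a *: E) = - \sum_a \sum_b symb K E a b * phi a b.
Proof.
move=> sK sE sphi.
have KC a b : K a b = K b a by rewrite -[in LHS]sK mxE.
have EC a b : E a b = E b a by rewrite -[in LHS]sE mxE.
pose X := \sum_a \sum_b \sum_c \sum_d K a b * K c d * (phi c a * E b d).
pose Y := \sum_a \sum_b \sum_c \sum_d K a b * K c d * (phi c d * E a b).
have -> : \sum_a \sum_b symb K E a b * phi a b = Y - X.
  have -> : Y = \sum_a \sum_b \tr (K *m E) * K a b * phi a b.
    have -> : Y = (\sum_a \sum_b K a b * E a b) * (\sum_c \sum_d K c d * phi c d).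
      rewrite -(prod4 (fun a b => K a b * E a b) (fun c d => K c d * phi c d)).
      apply: eq_bigr => a _; apply: eq_bigr => b _; apply: eq_bigr => c _.
      by apply: eq_bigr => d _; ring.
    have -> : \sum_a \sum_b K a b * E a b = \tr (K *m E).
      apply: eq_bigr => a _; rewrite mxE; apply: eq_bigr => b _.
      by rewrite (EC a b).
    rewrite mulr_sumr; apply: eq_bigr => a _; rewrite mulr_sumr.
    by apply: eq_bigr => b _; ring.
  have -> : X = \sum_a \sum_b (K *m E *m K) a b * phi a b.
    apply: eq_bigr => a _; rewrite exchange_big; apply: eq_bigr => c _ /=.
    rewrite mxE mulr_suml exchange_big; apply: eq_bigr => d _ /=.
    rewrite mxE !mulr_suml; apply: eq_bigr => b _.
    by rewrite (KC d c) (sphi c a); ring.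
  rewrite -sumrB; apply: eq_bigr => a _; rewrite -sumrB; apply: eq_bigr => b _.
  rewrite /symb; move: (\tr _) (K *m E *m K) => u M; rewrite !mxE; ring.
pose X1 := \sum_a \sum_b \sum_c \sum_d K a b * K c d * (phi c b * E a d).
pose X2 := \sum_a \sum_b \sum_c \sum_d K a b * K c d * (phi a d * E c b).
pose Y2 := \sum_a \sum_b \sum_c \sum_d K a b * K c d * (phi a b * E c d).
have -> : scal2 K (fun c a => phi c a *: E) = 2^-1 * (X1 - Y - Y2 + X2).
  rewrite /scal2; congr (_ * _).
  rewrite -!(sumrB, big_split); apply: eq_bigr => a _ /=.
  rewrite -!(sumrB, big_split); apply: eq_bigr => b _ /=.
  rewrite -!(sumrB, big_split); apply: eq_bigr => c _ /=.
  rewrite -!(sumrB, big_split); apply: eq_bigr => d _ /=.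
  by rewrite !mxE (sphi c a); ring.
have -> : X1 = X.
  rewrite /X1 exchange_big; apply: eq_bigr => b _; apply: eq_bigr => a _ /=.
  by apply: eq_bigr => c _; apply: eq_bigr => d _; rewrite (KC a b).
have -> : X2 = X.
  apply: eq_bigr => a _; apply: eq_bigr => b _; rewrite exchange_big /=.
  by apply: eq_bigr => d _; apply: eq_bigr => c _; rewrite (KC c d) (sphi a d) (EC c b).
have -> : Y2 = Y.
  pose p a b := K a b * phi a b; pose q a b := K a b * E a b.
  transitivity (\sum_a \sum_b \sum_c \sum_d p a b * q c d).
    apply: eq_bigr => a _; apply: eq_bigr => b _; apply: eq_bigr => c _.
    by apply: eq_bigr => d _; rewrite /p /q; ring.
  rewrite prod4 mulrC -prod4.
  apply: eq_bigr => a _; apply: eq_bigr => b _; apply: eq_bigr => c _.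
  by apply: eq_bigr => d _; rewrite /p /q; ring.
by field.
Qed.

End ScalarSecondOrder.

(** Linear in [K]: with the derivative - K W K of the inverse metric in place of [K], it also gives
    the part of the derivative of the Christoffel symbols that is free of second derivatives of the
    metric. *)
Definition chr_jet (R : realType) (n : nat) (K : 'M[R]_n) (W : 'I_n -> 'M[R]_n)
    (a : 'I_n) : 'M[R]_n :=
  2^-1 *: ((\matrix_(b, d) (W a b d + W b a d - W d a b)) *m K^T).

Definition scal1 (R : realType) (n : nat) (K : 'M[R]_n) (W : 'I_n -> 'M[R]_n) : R :=
  \sum_a \sum_b K a b * \sum_c
    (chr_jet (- (K *m W c *m K)) W a - chr_jet (- (K *m W a *m K)) W c
     + chr_jet K W a *m chr_jet K W c - chr_jet K W c *m chr_jet K W a) b c.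

Section ScalarJets.
Context {R : realType} {n : nat}.
Variables (D : set 'rV[R]_n) (G : 'rV[R]_n -> 'M[R]_n) (x : 'rV[R]_n).
Hypotheses (oD : rop D) (Dx : D x) (CG : Ckm 2 D G).
Hypothesis uG : forall y, D y -> G y \in unitmx.
Implicit Types a b c d : 'I_n.

Let CG1 : Ckm 1 D G. Proof. exact: (@Ckm_le _ _ 1 2 _ _ _ _ isT CG). Qed.
Let CK1 : Ckm 1 D (fun y => invmx (G y)). Proof. exact: Ckm_inv. Qed.

Lemma pdm_inv c : pdm c (fun y => invmx (G y)) x =
  - (invmx (G x) *m pdm c G x *m invmx (G x)).
Proof.
have h := pdm_mul c oD CG1 CK1 Dx.
have : pdm c (fun y => G y *m invmx (G y)) x = 0.
  rewrite (pdm_ext c oD (B := fun=> 1%:M) _ Dx).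
    by apply/matrixP => i j; rewrite pdmE [RHS]mxE; exact: (pd_der (oD.1 _ Dx) (der_cst _ _ _)).
  by move=> y Dy; rewrite mulmxV// uG.
rewrite h => /eqP; rewrite addrC addr_eq0 => /eqP h'.
by rewrite -[LHS](mulKmx (uG Dx)) h' mulmxN mulmxA.
Qed.

Lemma chr_jetE a y : chr G a y = chr_jet (invmx (G y)) (fun a => pdm a G y) a.
Proof.
rewrite chrE /chr_jet; congr (_ *: (_ *m _)); apply/matrixP => b d.
by rewrite low_chrE mxE.
Qed.

Lemma pdm_low_chr c a : pdm c (low_chr G a) x =
  \matrix_(b, d) (pdm c (pdm a G) x b d + pdm c (pdm b G) x a d - pdm c (pdm d G) x a b).
Proof.
apply/matrixP => b d; rewrite pdmE [RHS]mxE.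
apply: pd_der; first exact: oD.1.
under eq_fun do rewrite low_chrE.
have h e i j : der c (fun y => pdm e G y i j) x (pdm c (pdm e G) x i j).
  by rewrite [pdm c _ _ _ _]pdmE; exact: Ck_der (Ckm_pdm e oD CG i j) Dx.
by apply: derB => //; exact: derD.
Qed.

Lemma Ckm_low_chr a : Ckm 1 D (low_chr G a).
Proof.
move=> b d; under eq_fun do rewrite low_chrE.
have h e i j : Ck 1 D (fun y => pdm e G y i j) := Ckm_pdm e oD CG i j.
by apply: CkB => //; exact: CkD.
Qed.

Lemma scalar_curvature_jets : scalar_curvature G x =
  scal2 (invmx (G x)) (fun c a => pdm c (pdm a G) x)
  + scal1 (invmx (G x)) (fun a => pdm a G x).
Proof.
set K := invmx (G x).
have dchr c a : pdm c (chr G a) x =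
    2^-1 *: ((pdm c (low_chr G a) x) *m K^T) + chr_jet (- (K *m pdm c G x *m K)) (fun a => pdm a G x) a.
  have E : forall y, D y -> chr G a y = 2^-1 *: (low_chr G a y *m (invmx (G y))^T).
    by move=> y _; rewrite chrE.
  have C1 := Ckm_mul oD (Ckm_low_chr a) (Ckm_tr CK1).
  rewrite (pdm_ext c oD E Dx) (pdmZ c oD (Ck_cst 1 (2^-1) oD) C1 Dx).
  rewrite (pd_der (oD.1 _ Dx) (der_cst _ _ _)) scale0r add0r.
  rewrite (pdm_mul c oD (Ckm_low_chr a) (Ckm_tr CK1) Dx) pdm_tr pdm_inv -/K.
  rewrite scalerDr; congr (_ + _ *: (_ *m _)); apply/matrixP => b d.
  by rewrite low_chrE mxE.
rewrite /scalar_curvature /scal2 /scal1 -/K mulr_sumr -big_split; apply: eq_bigr => a _ /=.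
rewrite mulr_sumr -big_split; apply: eq_bigr => b _ /=.
rewrite ricciE.
have -> : \sum_c curv G c a x b c = \sum_c
    (2^-1 *: (pdm c (low_chr G a) x *m K^T) - 2^-1 *: (pdm a (low_chr G c) x *m K^T)) b c +
    \sum_c (chr_jet (- (K *m pdm c G x *m K)) (fun a => pdm a G x) a -
      chr_jet (- (K *m pdm a G x *m K)) (fun a => pdm a G x) c +
      chr_jet K (fun a => pdm a G x) a *m chr_jet K (fun a => pdm a G x) c -
      chr_jet K (fun a => pdm a G x) c *m chr_jet K (fun a => pdm a G x) a) b c.
  rewrite -big_split; apply: eq_bigr => c _ /=.
  rewrite /curv !dchr !chr_jetE -/K.
  set u1 := 2^-1 *: _; set u2 := chr_jet _ _ _; set u3 := 2^-1 *: _.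
  set u4 := chr_jet _ _ _; set u5 := _ *m _; set u6 := _ *m _.
  by clearbody u1 u2 u3 u4 u5 u6; rewrite !mxE; ring.
rewrite mulrDr; congr (_ + _).
rewrite !mulr_sumr; apply: eq_bigr => c _.
rewrite !pdm_low_chr -scalerBr -mulmxBl mxE mxE !mulr_sumr; apply: eq_bigr => d _.
by rewrite !mxE; ring.
Qed.

End ScalarJets.

Definition current_jet (R : realType) (n : nat) (K : 'M[R]_n) (W : 'I_n -> 'M[R]_n)
    (P : 'M[R]_n) (P1 : 'I_n -> 'M[R]_n) : 'rV[R]_n :=
  \row_a \sum_b (P1 b + (chr_jet K W b)^T *m P + P *m chr_jet K W b) a b.

Section CloseJets.
Context {R : realType} {n : nat} {I : Type}.
Variables (S : set I) (e : I -> R).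
Implicit Types (K G P : I -> 'M[R]_n) (W : 'I_n -> I -> 'M[R]_n).

Lemma cl_scal2 K K' (W W' : 'I_n -> 'I_n -> I -> 'M[R]_n) :
  clm S e K K' -> (forall c a, clm S e (W c a) (W' c a)) ->
  cl S e (fun z => scal2 (K z) (fun c a => W c a z))
         (fun z => scal2 (K' z) (fun c a => W' c a z)).
Proof.
move=> hK hW; apply: clM; first exact: cl_cst.
apply: cl_sum => a; apply: cl_sum => b; apply: cl_sum => c; apply: cl_sum => d.
apply: clM; first exact: clM (hK a b) (hK c d).
apply: clB; (apply: clB; last exact: hW).
  by apply: clD; exact: hW.
by apply: clD; exact: hW.
Qed.

Lemma clm_chr_jet K K' W W' a : clm S e K K' -> (forall a, clm S e (W a) (W' a)) ->
  clm S e (fun z => chr_jet (K z) (fun a => W a z) a)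
          (fun z => chr_jet (K' z) (fun a => W' a z) a).
Proof.
move=> hK hW; apply: clm_scale; first exact: cl_cst.
apply: clm_mul; last exact: clm_tr.
move=> b d; have h := clB (clD (hW a b d) (hW b a d)) (hW d a b).
by apply: cl_ext h => z _; rewrite mxE.
Qed.

Lemma cl_scal1 K K' W W' : clm S e K K' -> (forall a, clm S e (W a) (W' a)) ->
  cl S e (fun z => scal1 (K z) (fun a => W a z)) (fun z => scal1 (K' z) (fun a => W' a z)).
Proof.
move=> hK hW; apply: cl_sum => a; apply: cl_sum => b; apply: clM; first exact: hK.
apply: cl_sum => c.
have hD d : clm S e (fun z => - (K z *m W d z *m K z)) (fun z => - (K' z *m W' d z *m K' z)).
  move=> i j; have h := clN (clm_mul (clm_mul hK (hW d)) hK i j).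
  by apply: cl_ext h => z _; rewrite [RHS]mxE.
have h1 := clm_chr_jet a (hD c) hW; have h2 := clm_chr_jet c (hD a) hW.
have h3 := clm_chr_jet a hK hW; have h4 := clm_chr_jet c hK hW.
exact: (clmB (clmD (clmB h1 h2) (clm_mul h3 h4)) (clm_mul h4 h3) b c).
Qed.

Lemma clm_current_jet K K' W W' P P' (Q Q' : 'I_n -> I -> 'M[R]_n) :
  clm S e K K' -> (forall a, clm S e (W a) (W' a)) -> clm S e P P' ->
  (forall a, clm S e (Q a) (Q' a)) ->
  clm S e (fun z => current_jet (K z) (fun a => W a z) (P z) (fun a => Q a z))
          (fun z => current_jet (K' z) (fun a => W' a z) (P' z) (fun a => Q' a z)).
Proof.
move=> hK hW hP hQ i a.
have h b : clm S e
    (fun z => Q b z + (chr_jet (K z) (fun a => W a z) b)^T *m P z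
              + P z *m chr_jet (K z) (fun a => W a z) b)
    (fun z => Q' b z + (chr_jet (K' z) (fun a => W' a z) b)^T *m P' z
              + P' z *m chr_jet (K' z) (fun a => W' a z) b).
  have hc := clm_chr_jet b hK hW.
  exact: clmD (clmD (hQ b) (clm_mul (clm_tr hc) hP)) (clm_mul hP hc).
by apply: cl_ext (cl_sum _ _ (fun b => h b a b)) => z _; rewrite mxE.
Qed.

End CloseJets.

Lemma current_jetE (R : realType) (n : nat) (G P : 'rV[R]_n -> 'M[R]_n) (x : 'rV[R]_n) :
  current G P x = current_jet (invmx (G x)) (fun a => pdm a G x) (P x) (fun a => pdm a P x).
Proof.
rewrite currentE; apply/rowP => a; rewrite !mxE; apply: eq_bigr => b _.
by rewrite /cov chr_jetE.
Qed.

(** * Local lower bound for sigma after a perturbation by t f E *)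

Section LocalEstimate.
Context {R : realType} {n : nat} {I : Type}.
Variables (S : set I) (D : I -> set 'rV[R]_n) (x : I -> 'rV[R]_n).
Variables (G E P : I -> 'rV[R]_n -> 'M[R]_n) (f : I -> 'rV[R]_n -> R) (t : I -> R).

(** All data are families indexed by z, so that a single constant serves all metrics, functions,
    factors t and points. *)
Definition conf z y : 'M[R]_n := G z y + (t z * f z y) *: E z y.
Local Notation G' := conf.

(** The error scale: every change that does not involve second derivatives of f will be O(e). *)
Definition jet1 z : R :=
  `|t z * f z (x z)| + \sum_a `|t z * pd a (f z) (x z)|.
Local Notation e := jet1.

Local Notation K z := (invmx (G z (x z))).
Local Notation K' z := (invmx (G' z (x z))).
Local Notation bddm A := (forall i j, bdd S (fun z => A z i j)).

Hypotheses (oD : forall z, S z -> rop (D z)) (Dx : forall z, S z -> D z (x z)).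
Hypotheses (CG : forall z, S z -> Ckm 2 (D z) (G z)).
Hypotheses (CE : forall z, S z -> Ckm 2 (D z) (E z)).
Hypotheses (Cf : forall z, S z -> Ck 2 (D z) (f z)).
Hypotheses (uG : forall z y, S z -> D z y -> G z y \in unitmx).
Hypotheses (uG' : forall z y, S z -> D z y -> G' z y \in unitmx).
Hypotheses (sG : forall z, S z -> (G z (x z))^T = G z (x z)).
Hypotheses (sE : forall z, S z -> (E z (x z))^T = E z (x z)).
Hypothesis f_le0 : forall z, S z -> t z * f z (x z) <= 0.
Hypothesis pE : forall z u, S z -> 0 <= qf (E z (x z)) u u.
Hypothesis pG' : forall z u, S z -> 0 <= qf (G' z (x z)) u u.
Hypothesis bG : bddm (fun z => G z (x z)).
Hypothesis bG1 : forall a, bddm (fun z => pdm a (G z) (x z)).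
Hypothesis bG2 : forall c a, bddm (fun z => pdm c (pdm a (G z)) (x z)).
Hypothesis bE : bddm (fun z => E z (x z)).
Hypothesis bE1 : forall a, bddm (fun z => pdm a (E z) (x z)).
Hypothesis bE2 : forall c a, bddm (fun z => pdm c (pdm a (E z)) (x z)).
Hypothesis bP : bddm (fun z => P z (x z)).
Hypothesis bP1 : forall a, bddm (fun z => pdm a (P z) (x z)).
Hypothesis bK : bddm (fun z => K z).
Hypothesis bK' : bddm (fun z => K' z).
Hypothesis bf : bdd S (fun z => t z * f z (x z)).
Hypothesis bf1 : forall a, bdd S (fun z => t z * pd a (f z) (x z)).

Let e_ge0 z : S z -> 0 <= e z.
Proof. by move=> _; rewrite addr_ge0// sumr_ge0. Qed.

Local Notation cl := (cl S e).
Local Notation clm := (clm S e).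
Local Notation small v := (cl (fun=> 0) v).

Let smallf : small (fun z => t z * f z (x z)).
Proof.
split=> //; first exact: bdd_cst.
by exists 1 => // z _; rewrite subr0 mul1r lerDl sumr_ge0.
Qed.

Let smallf1 a : small (fun z => t z * pd a (f z) (x z)).
Proof.
split=> //; first exact: bdd_cst.
exists 1 => // z _; rewrite subr0 mul1r /jet1 (bigD1 a)//= addrCA lerDl addr_ge0//.
by rewrite sumr_ge0.
Qed.

Let small_mul v w : small v -> bdd S w -> small (fun z => v z * w z).
Proof.
move=> hv hw; apply: cl_ext (clM hv (cl_refl hw)) => // z _.
by rewrite mul0r.
Qed.

Let clm_small p q (A : I -> 'M[R]_(p, q)) (B : I -> 'M[R]_(p, q)) :
  bddm A -> (forall i j, small (fun z => B z i j)) -> clm A (fun z => A z + B z).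
Proof.
move=> hA hB i j.
by apply: cl_ext (clD (cl_refl (hA i j)) (hB i j)) => z _; rewrite ?addr0 ?mxE.
Qed.

Let clG : clm (fun z => G z (x z)) (fun z => G' z (x z)).
Proof.
apply: clm_small => // i j; apply: cl_ext (small_mul smallf (bE i j)) => // z _.
by rewrite mxE.
Qed.

(** Resolvent identity K' = K - K' (G' - G) K. *)
Let clK : clm (fun z => K z) (fun z => K' z).
Proof.
have h : clm (fun z => K z) (fun z => K z - (t z * f z (x z)) *: (K' z *m E z (x z) *m K z)).
  apply: clm_small => // i j.
  have /cl_ext : small (fun z => - (t z * f z (x z) * (K' z *m E z (x z) *m K z) i j)).
    have b : bdd S (fun z => (K' z *m E z (x z) *m K z) i j).
      have hK' : clm (fun z => K' z) (fun z => K' z) by move=> k l; exact: cl_refl (bK' k l).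
      have hK : clm (fun z => K z) (fun z => K z) by move=> k l; exact: cl_refl (bK k l).
      have hE : clm (fun z => E z (x z)) (fun z => E z (x z)).
        by move=> k l; exact: cl_refl (bE k l).
      by have [] := clm_mul (clm_mul hK' hE) hK i j.
    by apply: cl_ext (clN (small_mul smallf b)) => // z _; rewrite oppr0.
  by apply=> // z _; rewrite !mxE.
apply: clm_ext h => // z Sz.
have u := uG Sz (Dx Sz); have u' := uG' Sz (Dx Sz).
have -> : (t z * f z (x z)) *: (K' z *m E z (x z) *m K z) =
    K' z *m (G' z (x z) - G z (x z)) *m K z.
  by rewrite /conf [G z _ + _]addrC addrK -scalemxAr -scalemxAl.
by rewrite mulmxBr mulmxBl mulVmx// mul1mx mulmxK// subKr.
Qed.

Let dG' z a y : S z -> D z y -> pdm a (G' z) y =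
  pdm a (G z) y + ((t z * pd a (f z) y) *: E z y + (t z * f z y) *: pdm a (E z) y).
Proof.
move=> Sz Dy; have o := oD Sz.
have C1 := Ckm_le (isT : (1 <= 2)%N) (CG Sz).
have C2 := Ckm_le (isT : (1 <= 2)%N) (CE Sz).
have C3 : Ck 1 (D z) (fun y => t z * f z y).
  by apply: CkZ => //; exact: Ck_le (isT : (1 <= 2)%N) (Cf Sz).
rewrite (pdmD a o C1 (CkmZ o C3 C2) Dy) (pdmZ a o C3 C2 Dy).
have -> // : pd a (fun y => t z * f z y) y = t z * pd a (f z) y.
by apply: pd_der; [exact: o.1|apply: derZ; exact: Ck_der (Cf Sz) Dy].
Qed.

Let clG1 a : clm (fun z => pdm a (G z) (x z)) (fun z => pdm a (G' z) (x z)).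
Proof.
apply: (clm_ext (fun _ _ => erefl) (fun z Sz => esym (dG' a Sz (Dx Sz)))).
apply: clm_small => // i j.
have h1 := small_mul (smallf1 a) (bE i j).
have h2 := small_mul smallf (bE1 a i j).
by apply: cl_ext (clD h1 h2) => z _; rewrite ?addr0// !mxE.
Qed.

(* Second derivatives of G' with the principal part t (d_c d_a f) E removed. *)
Let W c a z : 'M[R]_n := pdm c (pdm a (G z)) (x z)
  + ((t z * pd a (f z) (x z)) *: pdm c (E z) (x z)
     + (t z * pd c (f z) (x z)) *: pdm a (E z) (x z)
     + (t z * f z (x z)) *: pdm c (pdm a (E z)) (x z)).

Let clW c a : clm (fun z => pdm c (pdm a (G z)) (x z)) (W c a).
Proof.
apply: clm_small => // i j.
have h1 := small_mul (smallf1 a) (bE1 c i j).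
have h2 := small_mul (smallf1 c) (bE1 a i j).
have h3 := small_mul smallf (bE2 c a i j).
by apply: cl_ext (clD (clD h1 h2) h3) => z _; rewrite ?addr0// !mxE.
Qed.

Let ddG' c a z : S z -> pdm c (pdm a (G' z)) (x z) =
  W c a z + (t z * pd c (pd a (f z)) (x z)) *: E z (x z).
Proof.
move=> Sz; have o := oD Sz; have Dz := Dx Sz.
have C0 := Ckm_pdm a o (CG Sz).
have C1 := Ckm_le (isT : (1 <= 2)%N) (CE Sz).
have C2 := Ckm_pdm a o (CE Sz).
have C3 : Ck 1 (D z) (fun y => t z * pd a (f z) y).
  by apply: CkZ => //; exact: Ck_pd (Cf Sz).
have C4 : Ck 1 (D z) (fun y => t z * f z y).
  by apply: CkZ => //; exact: Ck_le (isT : (1 <= 2)%N) (Cf Sz).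
rewrite (pdm_ext c o (fun y => dG' a Sz) Dz).
rewrite (pdmD c o C0 (CkmD o (CkmZ o C3 C1) (CkmZ o C4 C2)) Dz).
rewrite (pdmD c o (CkmZ o C3 C1) (CkmZ o C4 C2) Dz) (pdmZ c o C3 C1 Dz) (pdmZ c o C4 C2 Dz).
have -> : pd c (fun y => t z * pd a (f z) y) (x z) = t z * pd c (pd a (f z)) (x z).
  by apply: pd_der; [exact: o.1|apply: derZ; exact: Ck_der (Ck_pd a (Cf Sz)) Dz].
have -> : pd c (fun y => t z * f z y) (x z) = t z * pd c (f z) (x z).
  by apply: pd_der; [exact: o.1|apply: derZ; exact: Ck_der (Cf Sz) Dz].
rewrite /W; set u1 := pdm _ _ _; set u2 := _ *: _; set u3 := _ *: _; set u4 := _ *: _.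
set u5 := _ *: _; rewrite -!addrA; congr (_ + _).
by rewrite addrC !addrA.
Qed.

Let symbf z : R := \sum_a \sum_b symb (K' z) (E z (x z)) a b * (t z * pd a (pd b (f z)) (x z)).

Let CG' z : S z -> Ckm 2 (D z) (G' z).
Proof.
move=> Sz; have o := oD Sz; apply: CkmD => //; first exact: CG.
by apply: CkmZ => //; [apply: CkZ => //; exact: Cf|exact: CE].
Qed.

Let symG' z : S z -> (G' z (x z))^T = G' z (x z).
Proof. by move=> Sz; rewrite /conf linearD linearZ /= sG// sE. Qed.

(** Second derivatives of f are not O(e). By linearity of [scal2] they are split off exactly, with
    the perturbed inverse K' as coefficient, and no error term contains them. *)
Let scal_diff : exists v v', [/\ cl v v',
  forall z, S z -> scalar_curvature (G z) (x z) = v z &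
  forall z, S z -> scalar_curvature (G' z) (x z) = v' z - symbf z].
Proof.
have h := clD (cl_scal2 clK clW) (cl_scal1 clK clG1).
eexists; eexists; split; first exact: h.
  move=> z Sz; exact: (scalar_curvature_jets (oD Sz) (Dx Sz) (CG Sz) (fun y => uG Sz)).
move=> z Sz; have o := oD Sz; have Dz := Dx Sz.
rewrite (scalar_curvature_jets o Dz (CG' Sz) (fun y => uG' Sz)).
have -> : (fun c a => pdm c (pdm a (G' z)) (x z)) =
    fun c a => W c a z + (t z * pd c (pd a (f z)) (x z)) *: E z (x z).
  by apply/funext => c; apply/funext => a; exact: ddG'.
rewrite scal2D scal2_symb; first by rewrite addrAC.
- by rewrite trmx_inv symG'.
- exact: sE.
- by move=> a b; exact: (congr1 (fun r => t z * r) (pd_comm a b o (Cf Sz) Dz)).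
Qed.

Let current_diff : clm (fun z => current (G z) (P z) (x z))
                       (fun z => current (G' z) (P z) (x z)).
Proof.
have hP : clm (fun z => P z (x z)) (fun z => P z (x z)) by move=> i j; exact: cl_refl.
have hP1 a : clm (fun z => pdm a (P z) (x z)) (fun z => pdm a (P z) (x z)).
  by move=> i j; exact: cl_refl (bP1 a i j).
have h := clm_current_jet clK clG1 hP hP1.
by apply: clm_ext h => z _; rewrite current_jetE.
Qed.

(** Triangle inequality in the metric G' for J' = J + (J' - J). As t f <= 0 and E >= 0, the norm of
    J for G' is at most the one for G; J' - J is O(e) because P is unchanged and the Christoffel
    symbols see one derivative of f. *)
Let normJ_conf : exists2 C : R, 0 <= C & forall z, S z ->
  normJ (G' z) (P z) (x z) <= normJ (G z) (P z) (x z) + C * e z.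
Proof.
have [B B0 hB] : exists2 B : R, 0 <= B & forall z, S z -> forall i j, `|G' z (x z) i j| <= B.
  apply: bdd_unif => i j; have [_ h _] := clG i j; exact: h.
have [C C0 hC] : exists2 C : R, 0 <= C & forall z, S z -> forall i,
    `|(current (G' z) (P z) (x z) - current (G z) (P z) (x z)) 0 i| <= C * e z.
  have h (i : 'I_n) : exists2 C : R, 0 <= C & forall z, S z ->
    `|(current (G' z) (P z) (x z) - current (G z) (P z) (x z)) 0 i| <= C * e z.
    by have [_ _ [C C0 h]] := current_diff 0 i; exists C => // z Sz; rewrite !mxE; have := h z Sz; rewrite !mxE.
  have /choice[c hc] (i : 'I_n) : exists C : R, 0 <= C /\ forall z, S z ->
    `|(current (G' z) (P z) (x z) - current (G z) (P z) (x z)) 0 i| <= C * e z.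
    by have [C C0 h'] := h i; exists C.
  exists (\sum_i c i); first by apply: sumr_ge0 => i _; exact: (hc i).1.
  move=> z Sz i; apply: le_trans ((hc i).2 z Sz) _; rewrite ler_wpM2r ?e_ge0//.
  by rewrite (bigD1 i)//= lerDl sumr_ge0// => j _; exact: (hc j).1.
(* The entries of G' are at most B, so G'(v, v) <= n B |v|^2, and |v|^2 <= n (C e)^2 for v = J' -
   J. *)
exists (Num.sqrt (n%:R * B * (n%:R * C ^+ 2))); first exact: sqrtr_ge0.
move=> z Sz; rewrite !normJE.
set J := current (G z) _ _; set J' := current (G' z) _ _.
have -> : J' = J + (J' - J) by rewrite addrC subrK.
have h := qf_minkowski J (J' - J) (symG' Sz) (fun u => pG' u Sz).
apply: (le_trans h); apply: lerD.
  apply: ler_wsqrtr; rewrite /conf qf_mxD qf_mxZ gerDl.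
  by rewrite mulr_le0_ge0// ?f_le0// pE.
have -> : Num.sqrt (n%:R * B * (n%:R * C ^+ 2)) * e z =
    Num.sqrt (n%:R * B * (n%:R * C ^+ 2) * e z ^+ 2).
  have c0 : 0 <= n%:R * B * (n%:R * C ^+ 2) by rewrite !mulr_ge0// sqr_ge0.
  by rewrite [RHS]sqrtrM// sqrtr_sqr ger0_norm// e_ge0.
apply: ler_wsqrtr; rewrite (le_trans (ler_norm _))//.
rewrite (le_trans (qf_ge _ (hB z Sz)))// -[leRHS]mulrA ler_wpM2l ?mulr_ge0//.
apply: (@le_trans _ _ (\sum_(i < n) (C * e z) ^+ 2)).
  apply: ler_sum => i _; rewrite -(real_normK (num_real _)).
  by rewrite ler_pXn2r ?nnegrE ?mulr_ge0 ?e_ge0//; exact: hC.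
by rewrite sumr_const card_ord -[leLHS]mulr_natl exprMn mulrA.
Qed.

Theorem sigma_loc_conf : exists2 C : R, 0 <= C & forall z, S z ->
  sigma_loc (G z) (P z) (x z)
    - \sum_a \sum_b symb (K' z) (E z (x z)) a b * (t z * pd a (pd b (f z)) (x z))
    - C * e z
  <= sigma_loc (G' z) (P z) (x z).
Proof.
have [v [v' [hv vE v'E]]] := scal_diff.
have [C1 C10 hC1] := normJ_conf.
have hP : clm (fun z => P z (x z)) (fun z => P z (x z)) by move=> i j; exact: cl_refl.
have hT : cl (fun z => tr_g (G z) (P z) (x z)) (fun z => tr_g (G' z) (P z) (x z)).
  by apply: cl_ext (cl_tr (clm_mul clG (clm_tr hP))) => z _; rewrite tr_gE.
have hN : cl (fun z => normsq_g (G z) (P z) (x z)) (fun z => normsq_g (G' z) (P z) (x z)).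
  have h := cl_tr (clm_mul hP (clm_tr (clm_mul (clm_mul clG hP) (clm_tr clG)))).
  by apply: cl_ext h => z _; rewrite normsq_gE.
have h := clB (clD hv (clM (cl_cst S e (n%:R - 1)^-1) (clM hT hT))) hN.
have [_ _ [C2 C20 hC2]] := h.
(* In sigma = 2 (mu - |J|) the factor 2 cancels the one half in mu, so only the error of |J| is
   doubled. *)
exists (C2 + 2 * C1); first by rewrite addr_ge0// mulr_ge0.
move=> z Sz; have := hC2 z Sz; have := hC1 z Sz.
rewrite /sigma_loc /energy_density vE// v'E// -/(symbf z) ler_norml.
set m := (n%:R - 1)^-1; set j := normJ _ _ _; set j' := normJ _ _ _.
set T := tr_g _ _ _; set T' := tr_g _ _ _; set N := normsq_g _ _ _; set N' := normsq_g _ _ _.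
rewrite !expr2 => h1 /andP[h2 _].
move: (m * (T * T)) (m * (T' * T')) h2 => p p' h2.
have -> : (C2 + 2 * C1) * e z = C2 * e z + 2 * (C1 * e z) by ring.
move: (C2 * e z) (C1 * e z) (symbf z) h1 h2 => A B' s.
lra.
Qed.

End LocalEstimate.

Local Notation coord := Defs.coord.
Local Notation jacobian := Defs.jacobian.
Local Notation coordK := Defs.coordK.

(** * Tensor fields in charts *)

Section Charts.
Context {R : realType} {n : nat} {M : topologicalType} (A : bd_atlas R n M).
Implicit Types (i j : chart A) (p q : M) (W : set M) (x y : 'rV[R]_n).

Definition img i W : set 'rV[R]_n := coord i @` (dom i `&` W).

Definition trans i j x : 'rV[R]_n := coord j (param i x).

Lemma img_sub i W : img i W `<=` coord i @` dom i.
Proof. by move=> _ [p [ip _] <-]; exists p. Qed.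

Lemma rop_dom i : rop (coord i @` dom i).
Proof. by have [U oU ->] := open_image i; exact: rop_openI. Qed.

Lemma rop_img i W : open W -> rop (img i W).
Proof.
move=> oW; split=> [x /img_sub|_ [p [ip Wp] <-]]; first exact: (rop_dom i).1.
have Dp : (coord i @` dom i) (coord i p) by exists p.
have /subspace_continuousP/(_ _ Dp) := @param_cont _ _ _ A i.
rewrite /from_subspace (hnbhs_within (rop_dom i) Dp) coordK// => h.
have hW : \forall y \near hnbhs (coord i p), W (param i y).
  by apply: h; exact: open_nbhs_nbhs.
near=> y; have [q iq qy] : (coord i @` dom i) y.
  by near: y; exact: (rop_dom i).2.
by exists q => //; split=> //; rewrite -(coordK iq) qy; near: y.
Unshelve. all: by end_near.
Qed.

Lemma coordE i x : (coord i @` dom i) x -> coord i (param i x) = x.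
Proof. by move=> [p ip <-]; rewrite coordK. Qed.

Lemma param_dom i x : (coord i @` dom i) x -> dom i (param i x).
Proof. by move=> [p ip <-]; rewrite coordK. Qed.

Lemma img_param i W x : img i W x -> W (param i x).
Proof. by move=> [p [ip Wp] <-]; rewrite coordK. Qed.

Lemma img_coord i W p : dom i p -> W p -> img i W (coord i p).
Proof. by move=> ip Wp; exists p. Qed.

Lemma Ck_trans i j k b : Ck k (img i (dom j)) (fun x => trans i j x 0 b).
Proof. exact: transition_smooth. Qed.

Lemma transE i j p : dom i p -> trans i j (coord i p) = coord j p.
Proof. by move=> ip; rewrite /trans coordK. Qed.

Lemma jacobianE i j p : jacobian i j p = jac (trans i j) (coord i p).
Proof. by apply/matrixP => a b; rewrite jacE mxE. Qed.

Definition loc i (h : tensor A) x : 'M[R]_n := h i (param i x).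

Definition locf i (u : M -> R) x : R := u (param i x).

Lemma Ck_field_loc k h i : Ck_field k setT h -> Ckm k (coord i @` dom i) (loc i h).
Proof. by move=> hh a b; have := hh a b i; rewrite setIT. Qed.

Definition smooth_fun k (u : M -> R) : Prop :=
  forall i, Ck k (coord i @` dom i) (locf i u).

Lemma rop_dom2 i j : rop (img i (dom j)).
Proof. by apply: rop_img; exact: open_dom. Qed.

Lemma riemannian_posdef (g : tensor A) i p v : riemannian g -> dom i p -> v != 0 ->
  0 < qf (g i p) v v.
Proof. by move=> [_ h] ip v0; exact: h. Qed.

Lemma posdef_unit (m : nat) (G : 'M[R]_m) : (forall v, v != 0 -> 0 < qf G v v) -> G \in unitmx.
Proof.
move=> h; rewrite -row_free_unit -kermx_eq0; apply/rowV0P => v /sub_kermxP vG.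
apply/eqP; apply: contraT => v0; have := h v v0.
by rewrite /qf vG mul0mx mxE ltxx.
Qed.

Lemma riemannian_unit (g : tensor A) i p : riemannian g -> dom i p -> g i p \in unitmx.
Proof. by move=> hg ip; apply: posdef_unit => v v0; exact: riemannian_posdef. Qed.

Lemma riemannian_ge0 (g : tensor A) i p v : riemannian g -> dom i p -> 0 <= qf (g i p) v v.
Proof.
move=> hg ip; have [->|v0] := eqVneq v 0; first by rewrite /qf !mul0mx mxE.
exact/ltW/riemannian_posdef.
Qed.

Lemma sym_02_jac (g : tensor A) i j p : sym_02 g -> dom i p -> dom j p ->
  g i p = jac (trans i j) (coord i p) *m g j p *m (jac (trans i j) (coord i p))^T.
Proof. by move=> [_ h] ip jp; rewrite (h i j p ip jp) jacobianE. Qed.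

(** The metric in one chart is J G J^T with G the metric in the other; as it is invertible, so is
    J. *)
Lemma jac_unit (g : tensor A) i j p : riemannian g -> dom i p -> dom j p ->
  jac (trans i j) (coord i p) \in unitmx.
Proof.
move=> hg ip jp; have := riemannian_unit hg ip.
by rewrite (sym_02_jac hg.1 ip jp) !unitmx_mul => /andP[/andP[]].
Qed.

(** Replaces the chart [chart_at], over which nothing is known, by a chart of the cover, where the
    norms give bounds. *)
Lemma sigma_chart (g pi : tensor A) i p : riemannian g -> sym_20 pi ->
  Ck_field 2 setT g -> Ck_field 1 setT pi -> dom i p ->
  sigma g pi p = sigma_loc (loc i g) (loc i pi) (coord i p).
Proof.
move=> hg hpi Cg Cpi ip; rewrite /sigma; set j := chart_at A p.
have jp : dom j p by exact: dom_chart_at.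
rewrite -/(loc j g) -/(loc j pi) -(transE j ip).
have Dp : img i (dom j) (coord i p) by exact: img_coord.
have sub k (h : tensor A) (l l' : chart A) : Ck_field k setT h -> Ckm k (img l (dom l')) (loc l h).
  move=> Ch a b; have hl := Ck_field_loc l Ch a b.
  exact: (Ck_sub (rop_dom l) (rop_dom2 l l') (@img_sub l _) hl).
have TD x : img i (dom j) x -> img j (dom i) (trans i j x).
  by move=> [q [iq jq] <-]; rewrite transE//; exact: img_coord.
apply/esym; apply: (@sigma_loc_trans _ _ (img i (dom j)) (img j (dom i)) (trans i j)
  (loc i g) (loc j g) (loc i pi) (loc j pi)) => //.
- exact: rop_dom2.
- exact: rop_dom2.
- by move=> b; exact: Ck_trans.
- exact: sub.
- exact: sub.
- exact: sub.
- exact: sub.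
- by move=> _ [q [iq jq] <-]; rewrite /loc coordK//; exact: riemannian_unit.
- by move=> _ [q [jq iq] <-]; rewrite /loc coordK//; exact: riemannian_unit.
- by move=> _ [q [iq jq] <-]; rewrite /loc coordK//; exact: hg.1.1.
- by move=> _ [q [jq iq] <-]; rewrite /loc coordK//; exact: hg.1.1.
- by move=> _ [q [iq jq] <-]; rewrite transE// /loc !coordK//; exact: sym_02_jac hg.1 _ _.
- move=> _ [q [iq jq] <-]; rewrite transE// /loc !coordK//.
  by rewrite (hpi.2 i j q iq jq) jacobianE.
Qed.

End Charts.

(** * Compactness and Hoelder norms *)

Section CompactBounds.
Context {R : realType} {n : nat}.
Implicit Types (x y : 'rV[R]_n) (D C : set 'rV[R]_n) (F H : 'rV[R]_n -> R).

Lemma compact_within_bdd (T : topologicalType) (C : set T) (F : T -> R) : compact C ->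
  {within C, continuous F} -> exists2 B : R, 0 <= B & forall z, C z -> `|F z| <= B.
Proof.
move=> cC cF; have := compact_bounded (continuous_compact cF cC).
move=> /ex_strict_bound_gt0[B B0 hB]; exists B; first exact: ltW.
by move=> z Cz; apply/ltW; apply: hB; exists z.
Qed.

Lemma Ck_bdd k D C F : Ck k D F -> compact C -> C `<=` D ->
  exists2 B : R, 0 <= B & forall x, C x -> `|F x| <= B.
Proof.
move=> /Ck_cont cF cC CD; apply: compact_within_bdd cC _.
exact: continuous_subspaceW CD cF.
Qed.

Lemma pdsZ (c : R) k D F s x : rop D -> Ck k D F -> (size s <= k)%N -> D x ->
  pds s (fun y => c * F y) x = c * pds s F x.
Proof.
move=> oD hF; elim: s x => [//|a s IH] x /= sk Dx; have sk' := ltnW sk.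
have hx := oD.1 _ Dx; apply: pd_der => //.
apply: (eq_der (f := fun y => c * pds s F y)) => //.
  by apply: filterS (oD.2 _ Dx) => y Dy; rewrite IH.
by apply: derZ; apply: der_pd; exact: hF.2.
Qed.

Lemma pdsB k D F H s x : rop D -> Ck k D F -> Ck k D H -> (size s <= k)%N -> D x ->
  pds s (fun y => F y - H y) x = pds s F x - pds s H x.
Proof.
move=> oD hF hH; elim: s x => [//|a s IH] x /= sk Dx; have sk' := ltnW sk.
have hx := oD.1 _ Dx; apply: pd_der => //.
apply: (eq_der (f := fun y => pds s F y - pds s H y)) => //.
  by apply: filterS (oD.2 _ Dx) => y Dy; rewrite IH.
by apply: derB; apply: der_pd; [exact: hF.2|exact: hH.2].
Qed.

(* C need not be convex: nearby points are compared by strict differentiability,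
   distant ones by the bound on F. *)
Lemma C1_holder (alpha : R) D C F : 0 < alpha -> alpha < 1 -> rop D -> Ck 1 D F ->
  compact C -> C `<=` D -> exists2 L : R, 0 <= L &
    forall x y, C x -> C y -> x != y -> `|F x - F y| / `|x - y| `^ alpha <= L.
Proof.
move=> a0 a1 oD hF cC CD; have [B B0 hB] := Ck_bdd hF cC CD.
(* Compactness in near-covering form: the constant L tends to infinity along a filter, and a local
   choice of L becomes a global one. *)
have /compact_near_coveringP/(_ R +oo%R (fun L x => C x -> forall y, C y ->
    `|F x - F y| <= L * `|x - y| `^ alpha) _) := cC.
case.
  move=> x Cx; have [d [c [d0 c0 H]]] := sdiff_lip (Ck_sdiff oD hF (CD _ Cx)).
  (* With r <= 1/2 the points z, y compared in the near case are at distance less than 1, and there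
     the distance is at most its power alpha. *)
  pose r := Num.min d 2^-1.
  have r0 : 0 < r by rewrite lt_min d0 invr_gt0 ltr0n.
  pose L0 := Num.max c (2 * B / (r / 2) `^ alpha).
  exists ([set y | `|x - y| < r / 2], [set L | L0 < L]) => /=.
    split; last by exists L0; split; rewrite ?num_real.
    suff : \forall y \near x, `|x - y| < r / 2 by [].
    by apply/nbhs_normP; exists (r / 2); rewrite //= divr_gt0.
  move=> [z L] /= [zx LL] Cz y Cy.
  have L0L : c <= L /\ 2 * B / (r / 2) `^ alpha <= L.
    by move: LL; rewrite /L0 gt_max => /andP[/ltW ? /ltW ?].
  have pz : 0 <= `|z - y| `^ alpha := powR_ge0 _ _.
  have [yx|yx] := ltP `|y - x| r.
    have zy1 : `|z - y| < 1.
      rewrite -(subrKA x) (le_lt_trans (ler_normD _ _))// distrC.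
      have : r <= 2^-1 by rewrite /r ge_min lexx orbT.
      move: zx yx; rewrite (distrC x y); lra.
    have [->|zny] := eqVneq z y; first by rewrite subrr normr0 mulr_ge0 ?powR_ge0// (le_trans c0 L0L.1).
    have hz := oD.1 _ (CD _ Cz); have hy := oD.1 _ (CD _ Cy).
    have yd : `|y - x| < d by rewrite (lt_le_trans yx)// /r ge_min lexx.
    have zd : `|z - x| < d.
      rewrite distrC (lt_le_trans zx)// (le_trans (_ : _ <= r))//.
        by rewrite ler_pdivrMr// ler_pMr// ler1n.
      by rewrite /r ge_min lexx.
    rewrite (le_trans (H _ _ hy hz yd zd))// ler_pM//; first exact: L0L.1.
    by apply: ger1_powR => //; [rewrite normr_gt0 subr_eq0 zny ltW|exact: ltW].
  have zy : r / 2 <= `|z - y|.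
    have := ler_normD (y - z) (z - x); rewrite subrKA (distrC y z) (distrC z x).
    move: zx yx; lra.
  apply: (@le_trans _ _ (2 * B)).
    rewrite (le_trans (ler_normB _ _))// mulr2n mulrDl mul1r lerD//; exact/hB.
  have pr : 0 < (r / 2) `^ alpha by rewrite powR_gt0// divr_gt0.
  have h1 : 2 * B <= L * (r / 2) `^ alpha by rewrite -ler_pdivrMr//; exact: L0L.2.
  rewrite (le_trans h1)// ler_wpM2l//; first exact: (le_trans c0 L0L.1).
  have r20 : 0 < r / 2 by rewrite divr_gt0.
  by apply: ge0_ler_powR => //; rewrite ?nnegrE ?normr_ge0 ?(ltW a0) ?(ltW r20).
move=> L0 [_ hL0].
pose L := Num.max 0 (L0 + 1).
exists L; first by rewrite /L le_max lexx.
move=> x y Cx Cy xy; rewrite ler_pdivrMr; last first.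
  by rewrite powR_gt0// normr_gt0 subr_eq0.
have := hL0 (L0 + 1); rewrite ltrDl ltr01 => /(_ isT x Cx Cx y Cy) h.
rewrite (le_trans h)// ler_wpM2r ?powR_ge0//.
by rewrite /L le_max lexx orbT.
Qed.

End CompactBounds.

Section HolderNorms.
Context {R : realType} {n : nat}.
Implicit Types (x y : 'rV[R]_n) (D C : set 'rV[R]_n) (F H : 'rV[R]_n -> R).
Local Open Scope ereal_scope.

Lemma esup0_ge0 (Z : set \bar R) : 0 <= esup0 Z.
Proof. by apply: ereal_sup_ubound; left. Qed.

Lemma esup0_le (Z : set \bar R) (b : R) : (0 <= b)%R -> (forall z, Z z -> z <= b%:E) ->
  esup0 Z <= b%:E.
Proof. by move=> b0 h; apply: ge_ereal_sup => z [->|/h//]; rewrite lee_fin. Qed.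

Lemma sup_norm_ge C F x : C x -> `|F x|%:E <= sup_norm C F.
Proof. by move=> Cx; apply: ereal_sup_ubound; right; exists x. Qed.

Lemma sup_norm_ge0 C F : 0 <= sup_norm C F. Proof. exact: esup0_ge0. Qed.

Lemma holder_seminorm_ge0 (alpha : R) C F : 0 <= holder_seminorm alpha C F.
Proof. exact: esup0_ge0. Qed.

Lemma holder_norm_ge0 k (alpha : R) C F : 0 <= holder_norm k alpha C F.
Proof.
apply: adde_ge0; last by apply: sume_ge0 => s _; exact: holder_seminorm_ge0.
by apply: sume_ge0 => j _; apply: sume_ge0 => s _; exact: sup_norm_ge0.
Qed.

Lemma sup_norm_le_holder k (alpha : R) C F (s : seq 'I_n) : (size s <= k)%N ->
  sup_norm C (pds s F) <= holder_norm k alpha C F.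
Proof.
move=> sk; apply: (@le_trans _ _ (\sum_(j < k.+1) \sum_(s : j.-tuple 'I_n)
    sup_norm C (pds s F))); last first.
  by apply: leeDl; apply: sume_ge0 => r _; exact: holder_seminorm_ge0.
pose j : 'I_k.+1 := Ordinal (leq_ltn_trans sk (ltnSn k)).
have h0 (i : 'I_k.+1) : 0 <= \sum_(s : i.-tuple 'I_n) sup_norm C (pds s F).
  by apply: sume_ge0 => r _; exact: sup_norm_ge0.
rewrite (bigD1 j)//=; apply: (@le_trans _ _ (\sum_(r : (size s).-tuple 'I_n)
    sup_norm C (pds r F))); last first.
  by apply: leeDl; apply: sume_ge0 => i _; exact: h0.
rewrite (bigD1 (in_tuple s))//=; apply: leeDl.
by apply: sume_ge0 => r _; exact: sup_norm_ge0.
Qed.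

Lemma le_holder_norm k (alpha : R) C F x (s : seq 'I_n) : (size s <= k)%N -> C x ->
  `|pds s F x|%:E <= holder_norm k alpha C F.
Proof.
by move=> sk Cx; exact: le_trans (sup_norm_ge (pds s F) Cx) (sup_norm_le_holder _ _ _ sk).
Qed.

(* Linearity in t makes the constant independent of t. *)
Lemma holder_norm_scale (alpha : R) k D C F : (0 < alpha < 1)%R -> rop D ->
    Ck k.+1 D F -> compact C -> C `<=` D ->
  exists2 b : R, (0 <= b)%R & forall t : R, (0 <= t)%R ->
    holder_norm k alpha C (fun x => t * F x)%R <= (t * b)%:E.
Proof.
move=> /andP[a0 a1] oD hF cC CD.
(* Stated for all lists so that [choice] applies; beyond length k the claim is empty. *)
have hs (s : seq 'I_n) : exists b : R, (size s <= k)%N -> (0 <= b)%R /\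
    forall t : R, (0 <= t)%R -> sup_norm C (pds s (fun x => t * F x)%R) <= (t * b)%:E.
  case: (leqP (size s) k) => [sk|]; last by exists 0%R.
  have hk : Ck (size s + (k.+1 - size s)) D F by rewrite subnKC// ltnW.
  have [b b0 hb] := Ck_bdd (Ck_pds hk) cC CD.
  exists b => _; split=> // t t0; apply: esup0_le; first exact: mulr_ge0.
  move=> _ [x Cx <-]; have E := pdsZ t oD hF (leqW sk) (CD _ Cx).
  rewrite lee_fin E.
  by rewrite normrM ger0_norm// ler_wpM2l// hb.
have ht (s : k.-tuple 'I_n) : exists b : R, (0 <= b)%R /\ forall t : R, (0 <= t)%R ->
    holder_seminorm alpha C (pds s (fun x => t * F x)%R) <= (t * b)%:E.
  have hk : Ck (size s + 1) D F by rewrite size_tuple addn1.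
  have [b b0 hb] := C1_holder a0 a1 oD (Ck_pds hk) cC CD.
  exists b; split=> // t t0; apply: esup0_le; first exact: mulr_ge0.
  move=> _ [x [y [Cx Cy xy ->]]]; rewrite lee_fin.
  have sk : (size s <= k.+1)%N by rewrite size_tuple.
  have E1 := pdsZ t oD hF sk (CD _ Cx); have E2 := pdsZ t oD hF sk (CD _ Cy).
  by rewrite E1 E2 -mulrBr normrM ger0_norm// -mulrA ler_wpM2l// hb.
have [b hb] := choice hs; have [c hc] := choice ht.
exists (\sum_(j < k.+1) \sum_(s : j.-tuple 'I_n) b s + \sum_(s : k.-tuple 'I_n) c s)%R.
  rewrite addr_ge0//; last by apply: sumr_ge0 => s _; exact: (hc s).1.
  apply: sumr_ge0 => j _; apply: sumr_ge0 => s _.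
  have sk : (size s <= k)%N by rewrite size_tuple -ltnS.
  exact: (hb s sk).1.
move=> t t0; rewrite mulrDr EFinD; apply: leeD.
  rewrite mulr_sumr -sumEFin; apply: lee_sum => j _.
  rewrite mulr_sumr -sumEFin; apply: lee_sum => s _.
  have sk : (size s <= k)%N by rewrite size_tuple -ltnS.
  exact: (hb s sk).2.
by rewrite mulr_sumr -sumEFin; apply: lee_sum => s _; exact: (hc s).2.
Qed.

End HolderNorms.

Section FieldNorms.
Context {R : realType} {n : nat} {M : topologicalType} (A : bd_atlas R n M).
Variables (K : norm_cover A) (alpha : R).
Implicit Types (h : tensor A) (m : 'I_(csize K)).
Local Open Scope ereal_scope.

Definition piece m : set 'rV[R]_n := Defs.coord (cchart m) @` cset m.

Lemma piece_sub m : piece m `<=` Defs.coord (cchart m) @` dom (cchart m).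
Proof. by move=> _ [p mp <-]; exists p => //; exact: cset_dom. Qed.

Lemma compact_piece m : compact (piece m).
Proof.
apply: continuous_compact; last exact: cset_compact.
exact: continuous_subspaceW (@cset_dom _ _ _ _ K m) (@coord_cont _ _ _ A (cchart m)).
Qed.

Lemma norm_comp_ge k (f : chart A -> M -> R) m p (s : seq 'I_n) :
  (size s <= k)%N -> cset m p ->
  `|pds s (fun x => f (cchart m) (param (cchart m) x)) (Defs.coord (cchart m) p)|%:E
    <= norm_comp K k alpha f.
Proof.
move=> sk mp; have mp' : piece m (Defs.coord (cchart m) p) by exists p.
apply: le_trans (le_holder_norm alpha _ sk mp') _.
rewrite /norm_comp (bigD1 m)//=; apply: leeDl.
by apply: sume_ge0 => i _; exact: holder_norm_ge0.
Qed.

Lemma norm_comp_ge0 k (f : chart A -> M -> R) : 0 <= norm_comp K k alpha f.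
Proof. by apply: sume_ge0 => i _; exact: holder_norm_ge0. Qed.

Lemma norm_field_ge0 k h : 0 <= norm_field K k alpha h.
Proof.
by apply: sume_ge0 => i _; apply: sume_ge0 => j _; exact: norm_comp_ge0.
Qed.

(** Turns closeness in norm into closeness of jets at the points of the cover. *)
Lemma norm_field_ge k h m p (s : seq 'I_n) a b : (size s <= k)%N -> cset m p ->
  `|pds s (fun x => loc (cchart m) h x a b) (Defs.coord (cchart m) p)|%:E
    <= norm_field K k alpha h.
Proof.
move=> sk mp.
apply: le_trans (norm_comp_ge (fun i p => h i p a b) sk mp) _.
rewrite /norm_field (bigD1 a)//= (bigD1 b)//= -addeA; apply: leeDl.
apply: adde_ge0; first by apply: sume_ge0 => i _; exact: norm_comp_ge0.
by apply: sume_ge0 => i _; apply: sume_ge0 => j _; exact: norm_comp_ge0.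
Qed.

Lemma norm_fun_ge (u : M -> R) p : `|u p|%:E <= norm_fun K 0 alpha u.
Proof.
have [m /interior_subset mp] := @cset_cover _ _ _ _ K p.
have := @norm_comp_ge 0 (fun _ => u) m p [::] isT mp.
by rewrite /= (Defs.coordK (cset_dom mp)).
Qed.

Lemma norm_field_scale k h : (0 < alpha < 1)%R -> Ck_field k.+1 setT h ->
  exists2 b : R, (0 <= b)%R & forall t : R, (0 <= t)%R ->
    norm_field K k alpha (fun i p => t *: h i p) <= (t * b)%:E.
Proof.
move=> a01 Ch.
have /choice[b hb] (q : 'I_n * 'I_n * 'I_(csize K)) : exists b : R, (0 <= b)%R /\
    forall t : R, (0 <= t)%R -> holder_norm k alpha (piece q.2)
      (fun x => t * loc (cchart q.2) h x q.1.1 q.1.2)%R <= (t * b)%:E.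
  have [b b0 hb] := holder_norm_scale a01 (@rop_dom _ _ _ A (cchart q.2))
    (Ck_field_loc (cchart q.2) Ch q.1.1 q.1.2) (@compact_piece q.2) (@piece_sub q.2).
  by exists b.
exists (\sum_i \sum_j \sum_m b (i, j, m))%R.
  by apply: sumr_ge0 => i _; apply: sumr_ge0 => j _; apply: sumr_ge0 => m _; exact: (hb (i, j, m)).1.
move=> t t0; rewrite /norm_field mulr_sumr -sumEFin; apply: lee_sum => i _.
rewrite mulr_sumr -sumEFin; apply: lee_sum => j _.
rewrite mulr_sumr -sumEFin; apply: lee_sum => m _.
have := (hb (i, j, m)).2 t t0.
have -> // : (fun x => (t *: h (cchart m) (param (cchart m) x)) i j) =
  (fun x => t * loc (cchart m) h x i j)%R.
by apply/funext => x; rewrite mxE.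
Qed.

End FieldNorms.

(** * The effect of a conformal perturbation on sigma *)

Section MainEstimate.
Context {R : realType} {n : nat} {M : topologicalType} (A : bd_atlas R n M).
Variables (K : norm_cover A) (alpha : R) (g pi : tensor A).
Implicit Type m : 'I_(csize K).
Hypothesis n_ge3 : (3 <= n)%N.
Variable p0 : M.
Hypothesis g_pi_data : init_data K alpha (g, pi).

Definition conf_tensor (f : M -> R) (h : tensor A) : tensor A := fun i p => f p *: h i p.

(** Bundles all that the constants must not depend on; it is the index type to which the local
    estimate is applied. *)
Record config := Config {
  cg : tensor A; ctau : tensor A; cf : M -> R; cs : R;
  cm : 'I_(csize K); cp : M }.

Let hg : riemannian g. Proof. by have [] := g_pi_data. Qed.

Lemma pds_pdm1 (G : 'rV[R]_n -> 'M[R]_n) a x i j :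
  pdm a G x i j = pds [:: a] (fun y => G y i j) x.
Proof. exact: pdmE. Qed.

Lemma pds_pdm2 (G : 'rV[R]_n -> 'M[R]_n) c a x i j :
  pdm c (pdm a G) x i j = pds [:: c; a] (fun y => G y i j) x.
Proof.
rewrite pdmE /=; congr (pd c _ x).
by apply/funext => y; rewrite pdmE.
Qed.

Lemma Ck_field_le j k (D : set M) (h : tensor A) : (j <= k)%N -> Ck_field k D h -> Ck_field j D h.
Proof. by move=> jk hh a b i; exact: Ck_le jk (hh a b i). Qed.

Let bound_field k (h : tensor A) : holder_field K k alpha h ->
  exists2 b : R, 0 <= b & forall m p s i j, (size s <= k)%N -> cset m p ->
    `|pds s (fun x => loc (cchart m) h x i j) (coord (cchart m) p)| <= b.
Proof.
move=> [_]; move: (norm_field_ge0 K alpha k h) (@norm_field_ge _ _ _ _ K alpha k h).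
case: (norm_field K k alpha h) => // b b0 hb _.
exists b; first by rewrite -lee_fin.
by move=> m p s i j sk mp; rewrite -lee_fin; exact: hb.
Qed.

Let pds_tensorB k (h h' : tensor A) m p s i j : Ck_field k setT h -> Ck_field k setT h' ->
  (size s <= k)%N -> cset m p ->
  pds s (fun x => loc (cchart m) (tensorB h' h) x i j) (coord (cchart m) p) =
  pds s (fun x => loc (cchart m) h' x i j) (coord (cchart m) p)
  - pds s (fun x => loc (cchart m) h x i j) (coord (cchart m) p).
Proof.
move=> Ch Ch' sk mp.
have Dp : (coord (cchart m) @` dom (cchart m)) (coord (cchart m) p).
  by exists p => //; exact: cset_dom.
rewrite -(pdsB (rop_dom (cchart m)) (Ck_field_loc (cchart m) Ch' i j)
  (Ck_field_loc (cchart m) Ch i j) sk Dp).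
congr (pds s _ _); apply/funext => x.
by rewrite /loc /tensorB [LHS]mxE [X in _ + X]mxE.
Qed.

Let inv_bound : exists2 b : R, 0 < b & forall m p i j, cset m p ->
  `|invmx (g (cchart m) p) i j| <= b.
Proof.
have /choice[b hb] (q : 'I_(csize K) * 'I_n * 'I_n) : exists b : R, 0 <= b /\
    forall p, cset q.1.1 p -> `|invmx (g (cchart q.1.1) p) q.1.2 q.2| <= b.
  set i := cchart q.1.1.
  have Cg : Ckm 4 (coord i @` dom i) (loc i g).
    by apply: Ck_field_loc; have [_ _ []] := g_pi_data.
  have uD x : (coord i @` dom i) x -> loc i g x \in unitmx.
    by move=> [p ip <-]; rewrite /loc coordK//; exact: riemannian_unit.
  have [b b0 hb] := Ck_bdd (Ckm_inv (rop_dom i) uD Cg q.1.2 q.2)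
    (@compact_piece _ _ _ _ K q.1.1) (@piece_sub _ _ _ _ K q.1.1).
  exists b; split=> // p mp; have := hb (coord i p); rewrite /loc coordK//; last exact: cset_dom.
  by apply; exists p.
exists (1 + \sum_q b q).
  by rewrite ltr_wpDr// sumr_ge0// => q _; exact: (hb q).1.
move=> m p i j mp; apply: le_trans ((hb (m, i, j)).2 p mp) _.
rewrite (bigD1 (m, i, j))//= addrCA lerDl addr_ge0// sumr_ge0// => q _.
exact: (hb q).1.
Qed.

(** A bound b on the entries of G^-1 is enough: |u|^4 <= G(u, u) G^-1(u, u) <= G(u, u) n b |u|^2. *)
Let g_elliptic : exists2 lam : R, 0 < lam & forall m p u, cset m p ->
  lam * sqn u <= qf (g (cchart m) p) u u.
Proof.
have [b b0 hb] := inv_bound.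
have n0 : (0 : R) < n%:R by rewrite ltr0n (leq_trans _ n_ge3).
exists (n%:R * b)^-1; first by rewrite invr_gt0 mulr_gt0.
move=> m p u mp; have ip : dom (cchart m) p by exact: cset_dom.
have nb : 0 < n%:R * b by rewrite mulr_gt0.
rewrite ler_pdivrMl//.
set G := g (cchart m) p; have uG : G \in unitmx by exact: riemannian_unit.
have sG : G^T = G by exact: hg.1.1.
have G0 v : 0 <= qf G v v by exact: riemannian_ge0.
have [->|u0] := eqVneq u 0.
  have -> : sqn (0 : 'rV[R]_n) = 0 by apply/eqP; rewrite sqn_eq0.
  by rewrite mulr_ge0// ltW.
have su : 0 < sqn u by rewrite lt_def sqn_eq0 u0 sqn_ge0.
have h1 := qf_CS (u *m invmx G) u sG G0.
have E1 : qf G (u *m invmx G) u = sqn u.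
  rewrite /qf mulmxKV// mxE; apply: eq_bigr => i _.
  by rewrite mxE expr2.
have E2 : qf G (u *m invmx G) (u *m invmx G) = qf (invmx G) u u.
  by rewrite /qf trmx_mul trmx_inv sG !mulmxA mulmxKV.
have h2 : qf (invmx G) u u <= n%:R * b * sqn u.
  by rewrite (le_trans (ler_norm _))// qf_ge// => i j; exact: hb.
rewrite E1 E2 in h1; have := le_trans h1 (ler_wpM2r (G0 u) h2).
by rewrite expr2 mulrAC ler_pM2r.
Qed.

(** The matrix a depends on the data and on the point, but its ellipticity and its bound do not. The
    bounds on t f and t df make terms quadratic in them comparable to linear ones. *)
Theorem main_estimate : exists r k1 C1 l2 L : R,
  [/\ 0 < r, 0 < k1, 0 <= C1, 0 < l2 & 0 <= L] /\
  forall (gamma tau : tensor A) (f : M -> R) (t : R),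
    init_data K alpha (gamma, tau) ->
    (norm_field K 4 alpha (tensorB gamma g) + norm_field K 3 alpha (tensorB tau pi)
       < r%:E)%E ->
    smooth_fun A 2 f -> 0 <= t -> (forall q, - k1 <= t * f q <= 0) ->
    (forall m p a, cset m p ->
       `|t * pd a (locf (cchart m) f) (coord (cchart m) p)| <= 1 :> R) ->
    riemannian (tensorD gamma (conf_tensor (fun q => t * f q) g)) /\
    forall m p, cset m p -> exists a : 'M[R]_n,
      [/\ forall u, sqn u <= l2 * qf a u u, forall i j, `|a i j| <= L &
      sigma gamma tau p
        - t * (\sum_i \sum_j a i j * pd i (pd j (locf (cchart m) f)) (coord (cchart m) p))
        - C1 * (t * (`|f p| + \sum_i `|pd i (locf (cchart m) f) (coord (cchart m) p)|))
      <= sigma (tensorD gamma (conf_tensor (fun q => t * f q) g)) tau p].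
Proof.
have [lam lam0 hlam] := g_elliptic.
have n0 : (0 : R) < n%:R by rewrite ltr0n (leq_trans _ n_ge3).
have [_ hpi Hg Hpi] := g_pi_data; rewrite /= in Hg Hpi.
have [Cg Cpi] := (Hg.1, Hpi.1).
have [bg bg0 hbg] := bound_field Hg.
have [bp bp0 hbp] := bound_field Hpi.
have nn0 : (0 : R) < n%:R * (n%:R + 1) by rewrite mulr_gt0// addr_gt0.
(* The admissible entrywise distance to g: it leaves the ellipticity constant lam / 2, for which
   [symb_elliptic] asks n (n + 1) kap <= lam / 2. *)
pose kap := lam / 2 / (n%:R * (n%:R + 1)).
have kap0 : 0 < kap by rewrite !divr_gt0.
have kapE : n%:R * (n%:R + 1) * kap = lam / 2 by rewrite /kap mulrC divfK// gt_eqF.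
have nkap : n%:R * kap <= lam / 2.
  by rewrite -kapE ler_wpM2r ?(ltW kap0)// ler_pMr// lerDr ltW.
(* One half of kap is for gamma - g, the other for t f g, whose entries are at most k1 (bg + 1). *)
pose r := kap / 2; have r0 : 0 < r by rewrite divr_gt0.
pose k1 := kap / (2 * (bg + 1)); have k10 : 0 < k1.
  by rewrite divr_gt0// mulr_gt0// ltr_wpDl.
pose S (z : config) : Prop := [/\ init_data K alpha (cg z, ctau z),
  (norm_field K 4 alpha (tensorB (cg z) g) + norm_field K 3 alpha (tensorB (ctau z) pi)
       < r%:E)%E,
  smooth_fun A 2 (cf z) /\ 0 <= cs z, forall q, - k1 <= cs z * cf z q <= 0 &
  cset (cm z) (cp z) /\ forall a, `|cs z * pd a (locf (cchart (cm z)) (cf z))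
     (coord (cchart (cm z)) (cp z))| <= 1].
have Sdiff z m p s i j : S z -> cset m p ->
  ((size s <= 4)%N -> `|pds s (fun x => loc (cchart m) (cg z) x i j) (coord (cchart m) p)
    - pds s (fun x => loc (cchart m) g x i j) (coord (cchart m) p)| <= r) /\
  ((size s <= 3)%N -> `|pds s (fun x => loc (cchart m) (ctau z) x i j) (coord (cchart m) p)
    - pds s (fun x => loc (cchart m) pi x i j) (coord (cchart m) p)| <= r).
  move=> [[_ _ [/= Hz _] [/= Hz' _]] hN _ _ _] mp; split=> sk.
    rewrite -(pds_tensorB i j Cg Hz sk mp) -lee_fin (le_trans (norm_field_ge alpha _ i j sk mp))//.
    by rewrite ltW// (le_lt_trans _ hN)// leeDl// norm_field_ge0.
  rewrite -(pds_tensorB i j Cpi Hz' sk mp) -lee_fin (le_trans (norm_field_ge alpha _ i j sk mp))//.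
  by rewrite ltW// (le_lt_trans _ hN)// leeDr// norm_field_ge0.
have Sdiff0 z m p i j : S z -> cset m p -> `|cg z (cchart m) p i j - g (cchart m) p i j| <= r.
  move=> Sz mp; have [/(_ isT) + _] := Sdiff z m p [::] i j Sz mp.
  by rewrite /= /loc coordK//; exact: cset_dom.
have bg' m p i j : cset m p -> `|g (cchart m) p i j| <= bg.
  move=> mp; have := hbg m p [::] i j isT mp.
  by rewrite /= /loc coordK//; exact: cset_dom.
pose cg' z := tensorD (cg z) (conf_tensor (fun q => cs z * cf z q) g).
have Sr z : S z -> riemannian (cg z) by move=> [[]].
have hk z m p s i j : S z -> cset m p -> - k1 <= s <= 0 ->
    `|(cg z (cchart m) p + s *: g (cchart m) p) i j - g (cchart m) p i j| <= kap.
  move=> Sz mp /andP[s1 s2]; rewrite [X in `|X - _|]mxE [X in _ + X - _]mxE addrAC.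
  rewrite (le_trans (ler_normD _ _))// [leRHS]splitr lerD//; first exact: Sdiff0.
  rewrite normrM; apply: (@le_trans _ _ (k1 * (bg + 1))).
    rewrite ler_pM//; first by rewrite ler_norml s1 (le_trans s2)// ltW.
    by rewrite (le_trans (bg' m p i j mp))// lerDl.
  have bg1 : 0 < bg + 1 by rewrite ltr_wpDl.
  by rewrite /k1 le_eqVlt; apply/orP; left; apply/eqP; field; rewrite gt_eqF.
have el z m p s u : S z -> cset m p -> - k1 <= s <= 0 ->
    lam / 2 * sqn u <= qf (cg z (cchart m) p + s *: g (cchart m) p) u u.
  move=> Sz mp hs; set G := _ + _.
  have -> : G = g (cchart m) p + (G - g (cchart m) p) by rewrite addrC subrK.
  rewrite qf_mxD.
  have h1 : `|qf (G - g (cchart m) p) u u| <= n%:R * kap * sqn u.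
    apply: qf_ge => i j; rewrite [X in `|X|]mxE [X in `|_ + X|]mxE.
    exact: (hk z m p s i j).
  have h2 := hlam m p u mp; have h3 := ler_wpM2r (sqn_ge0 u) nkap.
  move: h1; rewrite ler_norml => /andP[h1 _].
  have -> : lam / 2 * sqn u = lam * sqn u - lam / 2 * sqn u by field.
  by apply: lerD => //; rewrite (le_trans _ h1)// lerN2.
have Sr' z : S z -> riemannian (cg' z).
  move=> Sz; have hr := Sr z Sz; have [_ _ _ hf _] := Sz.
  have sym' : sym_02 (cg' z).
    split=> [i p ip|i j p ip jp]; rewrite /cg' /tensorD /conf_tensor.
      by rewrite linearD linearZ /= hr.1.1// hg.1.1.
    rewrite {1}(hr.1.2 i j p ip jp) {1}(hg.1.2 i j p ip jp).
    by rewrite mulmxDr mulmxDl -scalemxAr -scalemxAl.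
  split=> // i p ip v v0; rewrite -/(qf _ v v).
  (* The bounds hold in the charts of the cover only; positivity is carried to an arbitrary chart by
     the Jacobian. *)
  have [m /interior_subset mp] := @cset_cover _ _ _ _ K p.
  have jp : dom (cchart m) p by exact: cset_dom.
  have uJ := jac_unit hg ip jp.
  rewrite (sym_02_jac sym' ip jp); set J := jac _ _.
  have -> : qf (J *m cg' z (cchart m) p *m J^T) v v = qf (cg' z (cchart m) p) (v *m J) (v *m J).
    by rewrite /qf trmx_mul !mulmxA.
  have vJ : v *m J != 0.
    by apply: contra_neq v0 => vJ; rewrite -(mulmxK uJ v) vJ mul0mx.
  apply: lt_le_trans (el z m p _ (v *m J) Sz mp (hf p)).
  by rewrite mulr_gt0 ?divr_gt0// lt_def sqn_eq0 vJ sqn_ge0.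
pose ch (z : config) := cchart (cm z).
pose x (z : config) := coord (ch z) (cp z).
have ip z : S z -> dom (ch z) (cp z) by move=> [_ _ _ _ [mp _]]; exact: cset_dom.
have mp z : S z -> cset (cm z) (cp z) by move=> [_ _ _ _ []].
have px z : S z -> param (ch z) (x z) = cp z by move=> Sz; rewrite /x coordK//; exact: ip.
have bnd z s i j : S z -> (size s <= 2)%N ->
    `|pds s (fun y => loc (ch z) (cg z) y i j) (x z)| <= bg + r.
  move=> Sz sk; have [+ _] := Sdiff z _ _ s i j Sz (mp z Sz).
  move=> /(_ (leq_trans sk (isT : (2 <= 4)%N))) h.
  have h' := hbg (cm z) (cp z) s i j (leq_trans sk (isT : (2 <= 4)%N)) (mp z Sz).
  rewrite -(subrK (pds s (fun x => loc (ch z) g x i j) (x z)) (pds s _ _)) addrC.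
  by rewrite (le_trans (ler_normD _ _))// lerD.
have bndg z s i j : S z -> (size s <= 2)%N ->
    `|pds s (fun y => loc (ch z) g y i j) (x z)| <= bg.
  by move=> Sz sk; exact: hbg (leq_trans sk (isT : (2 <= 4)%N)) (mp z Sz).
have bndt z s i j : S z -> (size s <= 2)%N ->
    `|pds s (fun y => loc (ch z) (ctau z) y i j) (x z)| <= bp + r.
  move=> Sz sk; have [_] := Sdiff z _ _ s i j Sz (mp z Sz).
  move=> /(_ (leq_trans sk (isT : (2 <= 3)%N))) h.
  have h' := hbp (cm z) (cp z) s i j (leq_trans sk (isT : (2 <= 3)%N)) (mp z Sz).
  rewrite -(subrK (pds s (fun x => loc (ch z) pi x i j) (x z)) (pds s _ _)) addrC.
  by rewrite (le_trans (ler_normD _ _))// lerD.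
have bgr : 0 <= bg + r by rewrite addr_ge0// ltW.
have bpr : 0 <= bp + r by rewrite addr_ge0// ltW.
have k00 : - k1 <= (0 : R) <= 0 by rewrite lexx andbT oppr_le0 ltW.
have symG z s : S z -> (cg z (ch z) (cp z) + s *: g (ch z) (cp z))^T =
    cg z (ch z) (cp z) + s *: g (ch z) (cp z).
  by move=> Sz; rewrite linearD linearZ /= (Sr z Sz).1.1 ?hg.1.1//; exact: ip.
have l20 : 0 < lam / 2 by rewrite divr_gt0.
have bK' z s i j : S z -> - k1 <= s <= 0 ->
    `|invmx (cg z (ch z) (cp z) + s *: g (ch z) (cp z)) i j| <= (lam / 2)^-1.
  move=> Sz hs; apply: (elliptic_inv_le (symG z s Sz) l20) => u.
  exact: el (mp z Sz) hs.
have il0 : 0 <= (lam / 2)^-1 by rewrite invr_ge0 ltW.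
have fk z : S z -> - k1 <= cs z * cf z (cp z) <= 0 by move=> [_ _ _ h _]; exact: h.
pose D z := coord (ch z) @` dom (ch z).
pose G z := loc (ch z) (cg z); pose E z := loc (ch z) g; pose P z := loc (ch z) (ctau z).
pose f z := locf (ch z) (cf z).
have GE z : S z -> G z (x z) = cg z (ch z) (cp z) by move=> Sz; rewrite /G /loc px.
have EE z : S z -> E z (x z) = g (ch z) (cp z) by move=> Sz; rewrite /E /loc px.
have fE z : S z -> f z (x z) = cf z (cp z) by move=> Sz; rewrite /f /locf px.
have confE z : S z -> conf G E f cs z (x z) =
    cg z (ch z) (cp z) + (cs z * cf z (cp z)) *: g (ch z) (cp z).
  by move=> Sz; rewrite /conf GE// EE// fE.
have bKc i j : bdd S (fun z => invmx (conf G E f cs z (x z)) i j).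
  by exists (lam / 2)^-1 => // z Sz; rewrite confE//; apply: bK' => //; exact: fk.
have bE i j : bdd S (fun z => E z (x z) i j).
  by exists bg => // z Sz; exact: (bndg z [::] i j Sz isT).
have [C C0 hC] : exists2 C : R, 0 <= C & forall z, S z ->
  sigma_loc (G z) (P z) (x z)
    - \sum_a \sum_b symb (invmx (conf G E f cs z (x z))) (E z (x z)) a b
         * (cs z * pd a (pd b (f z)) (x z))
    - C * jet1 x f cs z <= sigma_loc (conf G E f cs z) (P z) (x z).
  apply: (@sigma_loc_conf _ _ _ S D) => //.
  - by move=> z _; exact: rop_dom.
  - by move=> z Sz; exists (cp z) => //; exact: ip.
  - move=> z [[_ _ [/= h _] _] _ _ _ _]; apply: Ck_field_loc.
    exact: Ck_field_le (isT : (2 <= 4)%N) h.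
  - by move=> z _; apply: Ck_field_loc; exact: Ck_field_le (isT : (2 <= 4)%N) Cg.
  - by move=> z [_ _ [h _] _ _]; exact: h.
  - move=> z y Sz [p ip' <-]; rewrite /G /loc coordK//.
    exact: riemannian_unit (Sr z Sz) ip'.
  - move=> z y Sz [p ip' <-]; rewrite /conf /G /E /f /loc /locf coordK//.
    exact: riemannian_unit (Sr' z Sz) ip'.
  - by move=> z Sz; rewrite GE//; apply: (Sr z Sz).1.1; exact: ip.
  - by move=> z Sz; rewrite EE//; apply: hg.1.1; exact: ip.
  - by move=> z Sz; rewrite fE//; have /andP[] := fk z Sz.
  - by move=> z u Sz; rewrite EE//; apply: riemannian_ge0 => //; exact: ip.
  - move=> z u Sz; rewrite confE// (le_trans _ (el z _ _ _ u Sz (mp z Sz) (fk z Sz)))//.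
    by rewrite mulr_ge0 ?sqn_ge0// ltW.
  - by move=> i j; exists (bg + r) => // z Sz; exact: (bnd z [::] i j Sz isT).
  - move=> a i j; exists (bg + r) => // z Sz.
    by rewrite pds_pdm1; exact: bnd.
  - move=> c a i j; exists (bg + r) => // z Sz.
    by rewrite pds_pdm2; exact: bnd.
  - by move=> a i j; exists bg => // z Sz; rewrite pds_pdm1; exact: bndg.
  - by move=> c a i j; exists bg => // z Sz; rewrite pds_pdm2; exact: bndg.
  - by move=> i j; exists (bp + r) => // z Sz; exact: (bndt z [::] i j Sz isT).
  - by move=> a i j; exists (bp + r) => // z Sz; rewrite pds_pdm1; exact: bndt.
  - move=> i j; exists (lam / 2)^-1 => // z Sz.
    by have := bK' z 0 i j Sz k00; rewrite scale0r addr0 GE.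
  - exists k1; first exact: ltW.
    move=> z Sz; rewrite fE// ler_norml; have /andP[-> h] := fk z Sz.
    by rewrite (le_trans h)// ltW.
  - move=> a; exists 1 => // z Sz; have [_ _ _ _ [_ h]] := Sz; exact: h.
have [L L0 hL] : exists2 L : R, 0 <= L & forall z, S z -> forall i j,
    `|symb (invmx (conf G E f cs z (x z))) (E z (x z)) i j| <= L.
  apply: bdd_unif.
  have cK : clm S (fun=> 0) (fun z => invmx (conf G E f cs z (x z)))
     (fun z => invmx (conf G E f cs z (x z))) by move=> i j; exact: cl_refl (bKc i j).
  have cE : clm S (fun=> 0) (fun z => E z (x z)) (fun z => E z (x z)).
    by move=> i j; exact: cl_refl (bE i j).
  have h := clmB (clm_scale (cl_tr (clm_mul cK cE)) cK) (clm_mul (clm_mul cK cE) cK).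
  by move=> i j; have [] := h i j.
exists r, k1, C, (n%:R * (bg + kap)), L; split.
  by split=> //; rewrite mulr_gt0// ltr_wpDl.
move=> gamma tau f0 t hdata hN hf0 t0 htf hpd.
have mkS m p : cset m p -> S (Config gamma tau f0 t m p).
  by move=> mp'; split=> //; split=> // a; exact: hpd.
(* [Sr'] takes a configuration, hence a point of some piece of the cover; [p0] provides one. *)
have [m0 [p1 mp1]] : exists m p, cset m p.
  by have [m /interior_subset mp'] := @cset_cover _ _ _ _ K p0; exists m, p0.
split; first exact: (Sr' _ (mkS m0 p1 mp1)).
move=> m p mp'; have Sz := mkS m p mp'; set z := Config gamma tau f0 t m p in Sz.
have fkz := fk z Sz.
exists (symb (invmx (conf G E f cs z (x z))) (E z (x z))); split.
- move=> u; apply: (@symb_elliptic _ _ _ _ (lam / 2) kap) => //.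
  + by rewrite confE//; exact: symG.
  + by move=> v; rewrite confE//; exact: el.
  + move=> i j; rewrite confE//; have h1 := hk z m p _ i j Sz mp' fkz.
    have h2 := bg' m p i j mp'.
    rewrite -(subrK (g (cchart m) p i j) ((cg z (ch z) (cp z) + _) i j)) addrC.
    by rewrite (le_trans (ler_normD _ _))// lerD.
  + by move=> i j; rewrite confE// EE//; exact: hk.
  + by rewrite kapE.
- exact: hL.
- have hr := Sr z Sz; have hr' := Sr' z Sz.
  have [[_ ht [/= Ch _] [/= Ct _]] _ _ _ _] := Sz.
  have C2 := Ck_field_le (isT : (2 <= 4)%N) Ch.
  have Ct1 := Ck_field_le (isT : (1 <= 3)%N) Ct.
  have C2' : Ck_field 2 setT (cg' z).
    move=> a b i; rewrite setIT.
    have o := @rop_dom _ _ _ A i.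
    apply: (Ck_ext (f := fun y => loc i (cg z) y a b + t * locf i f0 y * loc i g y a b)) => //.
      by move=> y _; rewrite /cg' /tensorD /conf_tensor [RHS]mxE [X in _ = _ + X]mxE.
    apply: CkD => //; first exact: (Ck_field_loc i C2 a b).
    apply: CkM => //; first by apply: CkZ => //; exact: hf0.
    exact: (Ck_field_loc i (Ck_field_le (isT : (2 <= 4)%N) Cg) a b).
  have i1 : dom (cchart m) p by exact: cset_dom.
  rewrite (sigma_chart hr ht C2 Ct1 i1).
  have := sigma_chart hr' ht C2' Ct1 i1; rewrite /cg' /= => ->.
  apply: le_trans (hC z Sz); rewrite -!addrA; apply: lerD => //.
  rewrite -!opprD lerN2; apply: lerD.
    rewrite mulr_sumr; apply: ler_sum => i _; rewrite mulr_sumr; apply: ler_sum => j _.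
    by rewrite mulrCA.
  rewrite ler_wpM2l// /jet1 fE// mulrDr normrM ger0_norm//; apply: lerD => //.
  by rewrite mulr_sumr; apply: ler_sum => i _; rewrite normrM ger0_norm.
Qed.

End MainEstimate.

(** * Powers of the positive part *)

Section MaxPower.
Context {R : realType} {n : nat}.
Implicit Types (D : set 'rV[R]_n) (F : 'rV[R]_n -> R).

(** At z = 0 the difference quotient is at most |r|^(m+1), which tends to 0 since the power is at
    least 2. *)
Lemma is_derive_maxpow (m : nat) (z : R) :
  is_derive z 1 (fun w => Num.max 0 w ^+ m.+2) (m.+2%:R * Num.max 0 z ^+ m.+1).
Proof.
suff h : (r^-1 *: (((fun w => Num.max 0 w ^+ m.+2) \o shift z) (r *: 1) -
    Num.max 0 z ^+ m.+2)) @[r --> 0^'] --> m.+2%:R * Num.max 0 z ^+ m.+1.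
  by apply: DeriveDef; [apply/cvg_ex; eexists; exact: h|exact: cvg_lim h].
have [z0|z0|->] := ltgtP z 0.
- apply: (cvg_near_eq (f := fun=> 0)); last first.
    by rewrite expr0n mulr0; exact: cvg_cst.
  have nz : 0 < - z by rewrite oppr_gt0.
  have : \forall r \near nbhs (0 : R), `|r| < - z by exact: (@nbhs0_lt R R^o _ nz).
  move=> /nbhs_dnbhs; apply: filterS => r /=.
  rewrite ltr_norml opprK => /andP[_ rz].
  rewrite [r *: 1]mulr1 max_l; last by rewrite -lerBrDr sub0r ltW.
  by rewrite subrr scaler0.
- have [_ h] := @is_deriveX R R id m.+2 z 1 1 (is_derive_id z 1).
  have d := @exprn_derivable R m.+2 z 1.
  have h' : (r^-1 *: (((fun w : R => w ^+ m.+2) \o shift z) (r *: 1) - z ^+ m.+2))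
     @[r --> 0^'] --> m.+2%:R * z ^+ m.+1.
    have <- : 'D_1 (fun w : R => w ^+ m.+2) z = m.+2%:R * z ^+ m.+1.
      by rewrite exp_derive [_ *: 1]mulr1.
    exact: d.
  apply: (cvg_near_eq _ h').
  have : \forall r \near nbhs (0 : R), `|r| < z.
    by exact: (@nbhs0_lt R R^o _ z0).
  move=> /nbhs_dnbhs; apply: filterS => r /=.
  rewrite ltr_norml => /andP[rz _].
  by rewrite [r *: 1]mulr1 max_r// -lerBlDr sub0r ltW.
- rewrite !expr0n /= mulr0; apply/cvgrPdist_le => e e0.
  have e1 : 0 < Num.min 1 e by rewrite lt_min ltr01.
  have : \forall r \near nbhs (0 : R), `|r| < Num.min 1 e by exact: (@nbhs0_lt R R^o _ e1).
  move=> /nbhs_dnbhs; apply: filterS2 (nbhs_dnbhs_neq _) => r /= r0.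
  rewrite lt_min => /andP[r1 re]; rewrite [r *: 1]mulr1 addr0 subr0 sub0r normrN.
  rewrite normrM normfV normrX ler_pdivrMl ?normr_gt0//.
  have mr : `|Num.max 0 r| <= `|r|.
    by have [r0'|r0'] := leP 0 r; rewrite ?(max_r _ _) ?(max_l _ _) ?normr0.
  rewrite exprS ler_pM//.
  rewrite exprS (le_trans _ (ltW re))// -[leRHS]mulr1 ler_pM ?exprn_ge0//.
  by rewrite exprn_ile1// (le_trans mr)// ltW.
Qed.

Lemma CkX k D F (m : nat) : rop D -> Ck k D F -> Ck k D (fun x => F x ^+ m).
Proof.
move=> oD hF; elim: m => [|m IH]; first by under eq_fun do rewrite expr0; exact: Ck_cst.
by under eq_fun do rewrite exprS; exact: CkM.
Qed.

Lemma Ck0_maxpow D F (m : nat) : rop D -> Ck 0 D F ->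
  Ck 0 D (fun x => Num.max 0 (F x) ^+ m).
Proof.
move=> oD hF; apply: CkX => //.
apply: (Ck_ext (f := fun x => 2^-1 * (F x + `|F x|))) => //.
  move=> x _; have [F0|F0] := leP 0 (F x).
    by rewrite ger0_norm//; lra.
  by rewrite ltr0_norm// subrr mulr0.
apply: CkZ => //; apply: CkD => //; apply/Ck0P/within_contP => // x Dx.
by apply: cvg_norm; exact: Ck_hcont hF Dx.
Qed.

(** Each derivative costs one power. *)
Lemma Ck_maxpow k D F (m : nat) : rop D -> (k < m)%N -> Ck k D F ->
  Ck k D (fun x => Num.max 0 (F x) ^+ m).
Proof.
move=> oD; elim: k m => [|k IH] m km hF; first exact: Ck0_maxpow.
case: m km => [//|[//|m]] km.
have hF' := Ck_le (leqnSn k) hF.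
apply: CkSI => //.
  exact/within_contP/Ck0P/Ck0_maxpow/(Ck_le (leq0n _) hF).
move=> a; exists (fun x => (m.+2%:R * Num.max 0 (F x) ^+ m.+1) * pd a F x).
  by apply: CkM => //; [apply: CkZ => //; exact: IH|exact: Ck_pd].
move=> x Dx; apply: (der_comp1 (F := fun w => Num.max 0 w ^+ m.+2)).
  exact: Ck_der hF Dx.
exact: is_derive_maxpow.
Qed.

End MaxPower.

(** * Subsolutions *)

Section Subsolutions.
Context {R : realType} {n : nat} {M : topologicalType} (A : bd_atlas R n M).
Variables (K : norm_cover A) (C1 l2 L : R).
Hypotheses (C10 : 0 <= C1) (l20 : 0 < l2) (L0 : 0 <= L).
Implicit Types (m : 'I_(csize K)) (f : M -> R) (p : M).

(** The class of all matrices that [main_estimate] may return. *)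
Definition adm (a : 'M[R]_n) : Prop :=
  (forall u, sqn u <= l2 * qf a u u) /\ forall i j, `|a i j| <= L.

Definition Pop (a : 'M[R]_n) (F : 'rV[R]_n -> R) x : R :=
  - (\sum_i \sum_j a i j * pd i (pd j F) x) - C1 * (`|F x| + \sum_i `|pd i F x|).

(** A lower bound for an extremal operator of Pucci type, the infimum of [Pop a] over the class. *)
Definition plow f m p (c : R) : Prop := forall a, adm a ->
  c <= Pop a (locf (cchart m) f) (coord (cchart m) p).

Let Dm m : set 'rV[R]_n := coord (cchart m) @` dom (cchart m).
Let oDm m : rop (Dm m). Proof. exact: rop_dom. Qed.
Let inD m p : cset m p -> Dm m (coord (cchart m) p).
Proof. by move=> mp; exists p => //; exact: cset_dom. Qed.

Lemma smooth_funD k f g : smooth_fun A k f -> smooth_fun A k g ->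
  smooth_fun A k (fun p => f p + g p).
Proof. by move=> hf hg i; exact: CkD (rop_dom i) (hf i) (hg i). Qed.

Lemma smooth_funZ k (c : R) f : smooth_fun A k f -> smooth_fun A k (fun p => c * f p).
Proof. by move=> hf i; exact: CkZ (rop_dom i) (hf i). Qed.

Lemma smooth_fun_le j k f : (j <= k)%N -> smooth_fun A k f -> smooth_fun A j f.
Proof. by move=> jk hf i; exact: Ck_le (hf i). Qed.

Lemma pdsD D k (F G : 'rV[R]_n -> R) s x : rop D -> Ck k D F -> Ck k D G ->
  (size s <= k)%N -> D x -> pds s (fun y => F y + G y) x = pds s F x + pds s G x.
Proof.
move=> oD hF hG sk Dx.
have h := pdsB oD hF (CkN oD hG) sk Dx.
have E : (fun y => F y - - G y) = (fun y => F y + G y).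
  by apply/funext => y; rewrite opprK.
have h' : pds s (fun y => - G y) x = - pds s G x.
  have := pdsZ (-1) oD hG sk Dx; rewrite mulN1r => <-.
  by congr (pds s _ x); apply/funext => y; rewrite mulN1r.
by rewrite E h' opprK in h.
Qed.

Lemma plowD f g m p (c d : R) : smooth_fun A 2 f -> smooth_fun A 2 g -> cset m p ->
  plow f m p c -> plow g m p d -> plow (fun q => f q + g q) m p (c + d).
Proof.
move=> hf hg mp hc hd a ha; have := hc a ha; have := hd a ha.
have Dp := inD mp; set x := coord _ p in Dp *.
set F := locf _ f; set G := locf _ g.
have -> : locf (cchart m) (fun q => f q + g q) = (fun y => F y + G y) by [].
have E s : (size s <= 2)%N -> pds s (fun y => F y + G y) x = pds s F x + pds s G x.
  by move=> sk; exact: (pdsD (oDm m) (hf _) (hg _) sk Dp).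
rewrite /Pop.
have E1 i : pd i (fun y => F y + G y) x = pd i F x + pd i G x by exact: (E [:: i] isT).
have E2 i j : pd i (pd j (fun y => F y + G y)) x = pd i (pd j F) x + pd i (pd j G) x.
  by exact: (E [:: i; j] isT).
have -> : \sum_i \sum_j a i j * pd i (pd j (fun y => F y + G y)) x =
  \sum_i \sum_j a i j * pd i (pd j F) x + \sum_i \sum_j a i j * pd i (pd j G) x.
  rewrite -big_split; apply: eq_bigr => i _; rewrite -big_split; apply: eq_bigr => j _ /=.
  by rewrite E2 mulrDr.
have h : `|F x + G x| + \sum_i `|pd i (fun y => F y + G y) x| <=
  (`|F x| + \sum_i `|pd i F x|) + (`|G x| + \sum_i `|pd i G x|).
  rewrite addrACA lerD ?ler_normD// -big_split ler_sum// => i _.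
  by rewrite E1 ler_normD.
have := ler_wpM2l C10 h; rewrite [X in _ <= X]mulrDr.
move: (C1 * _) (C1 * _) (C1 * _) (\sum_i _) (\sum_i _) => u v w s t; lra.
Qed.

Lemma plowZ f m p (c t : R) : smooth_fun A 2 f -> cset m p -> 0 <= t ->
  plow f m p c -> plow (fun q => t * f q) m p (t * c).
Proof.
move=> hf mp t0 hc a ha; have := ler_wpM2l t0 (hc a ha).
have Dp := inD mp; set x := coord _ p in Dp *; set F := locf _ f.
have -> : locf (cchart m) (fun q => t * f q) = (fun y => t * F y) by [].
have E s : (size s <= 2)%N -> pds s (fun y => t * F y) x = t * pds s F x.
  by move=> sk; exact: (pdsZ t (oDm m) (hf _) sk Dp).
have E1 i : pd i (fun y => t * F y) x = t * pd i F x by exact: (E [:: i] isT).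
have E2 i j : pd i (pd j (fun y => t * F y)) x = t * pd i (pd j F) x.
  by exact: (E [:: i; j] isT).
have -> // : Pop a (fun y => t * F y) x = t * Pop a F x.
have e1 : \sum_i \sum_j a i j * pd i (pd j (fun y => t * F y)) x =
    t * \sum_i \sum_j a i j * pd i (pd j F) x.
  rewrite mulr_sumr; apply: eq_bigr => i _; rewrite mulr_sumr; apply: eq_bigr => j _.
  by rewrite E2 mulrCA.
have e2 : \sum_i `|pd i (fun y => t * F y) x| = t * \sum_i `|pd i F x|.
  by rewrite mulr_sumr; apply: eq_bigr => i _; rewrite E1 normrM ger0_norm.
rewrite /Pop e1 e2 normrM ger0_norm//; ring.
Qed.

Lemma plow_le f m p (c d : R) : d <= c -> plow f m p c -> plow f m p d.
Proof. by move=> dc h a ha; exact: le_trans dc (h a ha). Qed.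

Lemma plow_flat f m p : cset m p -> (\forall q \near p, f q = 0) -> plow f m p 0.
Proof.
move=> mp; have nE := @nbhsE M p.
move=> hf; have : nbhs p [set q | f q = 0] by exact: hf.
rewrite nE => -[W [oW Wp] f0] a _.
set i := cchart m; have ip : dom i p by exact: cset_dom.
have z : \forall y \near hnbhs (coord i p), locf i f y = (fun=> 0) y.
  have oI := rop_img i oW; apply: filterS (oI.2 _ (img_coord ip Wp)) => y Wy.
  by apply: f0; exact: img_param Wy.
have hp : halfspace (coord i p) by apply: (oDm m).1; exact: inD.
have z0 s : pds s (fun=> 0 : R) (coord i p) = 0.
  have := pdsZ 0 (oDm m) (@Ck_cst _ _ (size s) _ 0 (oDm m)) (leqnn _) (inD mp).
  rewrite [X in _ = X]mul0r; apply: etrans; congr (pds s _ _).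
  by apply/funext => y; rewrite mul0r.
have E s : pds s (locf i f) (coord i p) = 0 by rewrite (eq_pds s hp z).
rewrite /Pop (_ : \sum_i0 \sum_j _ = 0); last first.
  apply: big1 => k _; apply: big1 => l _.
  have := E [:: k; l]; rewrite /= => ->; exact: mulr0.
have E0 : locf i f (coord i p) = 0 by exact: (E [::]).
rewrite E0 normr0 add0r big1 ?mulr0 ?subr0 ?oppr0// => k _.
by have := E [:: k]; rewrite /= => ->; rewrite normr0.
Qed.

Lemma smooth_bdd k f s : smooth_fun A k f -> (size s <= k)%N ->
  exists2 B : R, 0 <= B & forall m p, cset m p ->
    `|pds s (locf (cchart m) f) (coord (cchart m) p)| <= B.
Proof.
move=> hf sk; have /choice[b hb] m : exists b : R, 0 <= b /\ forall p, cset m p ->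
    `|pds s (locf (cchart m) f) (coord (cchart m) p)| <= b.
  have hk : Ck (size s + 0) (Dm m) (locf (cchart m) f).
    by apply: Ck_le (hf _); rewrite addn0.
  have [b b0 hb] := Ck_bdd (Ck_pds hk) (@compact_piece _ _ _ _ K m) (@piece_sub _ _ _ _ K m).
  by exists b; split=> // p mp; apply: hb; exists p.
exists (\sum_m b m); first by apply: sumr_ge0 => m _; exact: (hb m).1.
move=> m p mp; apply: le_trans ((hb m).2 p mp) _.
by rewrite (bigD1 m)//= lerDl sumr_ge0// => k' _; exact: (hb k').1.
Qed.

(** Bounds the loss where nothing better is known: inside the given ball and near the centers of
    bumps. *)
Lemma plow_bdd f : smooth_fun A 2 f ->
  exists2 B : R, 0 <= B & forall m p, cset m p -> plow f m p (- B).
Proof.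
move=> hf.
have [B0 B00 h0] := smooth_bdd (s := [::]) hf isT.
have /choice[b1 h1] i : exists b : R, 0 <= b /\ forall m p, cset m p ->
    `|pds [:: i] (locf (cchart m) f) (coord (cchart m) p)| <= b.
  by have [b b0 hb] := smooth_bdd (s := [:: i]) hf isT; exists b.
have /choice[b2 h2] (ij : 'I_n * 'I_n) : exists b : R, 0 <= b /\ forall m p, cset m p ->
    `|pds [:: ij.1; ij.2] (locf (cchart m) f) (coord (cchart m) p)| <= b.
  by have [b b0 hb] := smooth_bdd (s := [:: ij.1; ij.2]) hf isT; exists b.
exists (\sum_i \sum_j L * b2 (i, j) + C1 * (B0 + \sum_i b1 i)).
  rewrite addr_ge0//.
    by apply: sumr_ge0 => i _; apply: sumr_ge0 => j _; rewrite mulr_ge0//; exact: (h2 (i, j)).1.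
  by rewrite mulr_ge0// addr_ge0// sumr_ge0// => i _; exact: (h1 i).1.
move=> m p mp a [_ ha]; rewrite opprD; apply: lerB.
  rewrite lerN2; apply: ler_sum => i _; apply: ler_sum => j _.
  rewrite (le_trans (ler_norm _))// normrM ler_pM//.
  exact: (h2 (i, j)).2.
rewrite ler_wpM2l// lerD//; first exact: (h0 m p mp).
by apply: ler_sum => i _; exact: (h1 i).2.
Qed.

End Subsolutions.

Lemma near_coord {R : realType} {n : nat} {M : topologicalType} (A : bd_atlas R n M)
    (j : chart A) p (Q : set 'rV[R]_n) : dom j p -> hnbhs (coord j p) Q ->
  \forall q \near p, dom j q /\ Q (coord j q).
Proof.
move=> jp hQ; apply: filterI; first exact: open_nbhs_nbhs (conj (@open_dom _ _ _ A j) jp).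
have /subspace_continuousP/(_ _ jp) := @coord_cont _ _ _ A j.
rewrite /from_subspace => /(_ [set y | halfspace y -> Q y] hQ) h.
have h' : \forall q \near p, dom j q -> halfspace (coord j q) -> Q (coord j q) := h.
have hj : \forall q \near p, dom j q := open_nbhs_nbhs (conj (@open_dom _ _ _ A j) jp).
near=> q; have jq : dom j q by near: q.
have : halfspace (coord j q) by apply: (rop_dom j).1; exists q.
by move: jq; near: q.
Unshelve. all: by end_near.
Qed.

(** * A radial bump in a coordinate ball *)

Section Bump.
Context {R : realType} {n : nat} {M : topologicalType} (A : bd_atlas R n M).
Variables (K : norm_cover A) (C1 l2 L : R) (g : tensor A).
Hypotheses (C10 : 0 <= C1) (l20 : 0 < l2) (L0 : 0 <= L).
Hypotheses (hg : riemannian g) (M_T2 : hausdorff_space M).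
Implicit Types (m : 'I_(csize K)) (p : M).
Implicit Type j : chart A.
Variables (i : chart A) (x0 : 'rV[R]_n) (rho : R).
Hypothesis rho0 : 0 < rho.

(** A Euclidean ball rather than one for the maximum norm, so that its defining function is
    smooth. *)
Definition eball : set 'rV[R]_n := [set y | sqn (y - x0) <= rho ^+ 2].

Hypothesis ball_dom : eball `<=` coord i @` dom i.
Hypothesis ball_int : forall y (a : 'I_n), eball y -> a = 0%N :> nat -> 0 < y 0 a.

Definition quad (y : 'rV[R]_n) : R := 1 - rho ^- 2 * sqn (y - x0).

Lemma norm_sqn (u : 'rV[R]_n) : `|u| ^+ 2 <= sqn u.
Proof.
have h : `|u| <= Num.sqrt (sqn u).
  apply: rowv_normP => [|b]; first exact: sqrtr_ge0.
  by rewrite -sqrtr_sqr ler_wsqrtr// sqn_coord.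
by rewrite -[leRHS]sqr_sqrtr ?sqn_ge0// ler_pXn2r ?nnegrE ?sqrtr_ge0.
Qed.

Lemma quad_ge0 y : (0 <= quad y) = (sqn (y - x0) <= rho ^+ 2).
Proof. by rewrite subr_ge0 ler_pdivrMl ?mulr1// exprn_gt0. Qed.

Lemma quad_gt0 y : (0 < quad y) = (sqn (y - x0) < rho ^+ 2).
Proof. by rewrite subr_gt0 ltr_pdivrMl ?mulr1// exprn_gt0. Qed.

Lemma quad_le1 y : quad y <= 1.
Proof. by rewrite gerBl mulr_ge0 ?sqn_ge0// invr_ge0 exprn_ge0// ltW. Qed.

Lemma Ck_quad k (D : set 'rV[R]_n) : rop D -> Ck k D quad.
Proof.
move=> oD; apply: CkB => //; first exact: Ck_cst.
apply: CkZ => //; apply: Ck_sum => // b; apply: CkX => //.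
apply: (Ck_ext (f := fun y => y 0 b - x0 0 b)) => //.
  by move=> y _; rewrite !mxE.
by apply: CkB => //; [exact: Ck_coord|exact: Ck_cst].
Qed.

Lemma pd_quad (y : 'rV[R]_n) c : halfspace y ->
  pd c quad y = - (2 * rho ^- 2 * (y - x0) 0 c).
Proof.
move=> hy; apply: pd_der => //.
have h b : der c (fun y => (y - x0) 0 b ^+ 2) y (2 * (y - x0) 0 b * (b == c)%:R).
  have d : der c (fun y : 'rV[R]_n => y 0 b - x0 0 b) y (b == c)%:R.
    by have := derB (@der_coord R n c b y) (@der_cst R n c y (x0 0 b)); rewrite subr0.
  apply: (eq_der (f := fun y => (y 0 b - x0 0 b) * (y 0 b - x0 0 b))) => //.
    by near=> z; rewrite !mxE expr2.
  have -> : 2 * (y - x0) 0 b * (b == c)%:R =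
    (b == c)%:R * (y 0 b - x0 0 b) + (y 0 b - x0 0 b) * (b == c)%:R.
    by rewrite !mxE; ring.
  exact: derM.
have := derB (@der_cst R n c y 1) (derZ (c := rho ^- 2) (@der_sum R n _ (index_enum _) xpredT c _ y _ h)).
congr (der c _ y _); rewrite sub0r; congr (- _).
rewrite (bigD1 c)//= big1 ?addr0 ?eqxx ?mulr1; first by rewrite mulrCA mulrA.
by move=> b /negPf ->; rewrite mulr0.
Unshelve. all: by end_near.
Qed.

Lemma compact_eball : compact eball.
Proof.
apply: bounded_closed_compact.
  exists (`|x0| + rho); split; first by rewrite num_real.
  move=> r hr y /= yb; apply/ltW/(le_lt_trans _ hr).
  rewrite -(subrK x0 y) addrC (le_trans (ler_normD _ _))// lerD2l.
  rewrite -(ler_pXn2r (n := 2)) ?nnegrE//; last exact: ltW.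
  exact: le_trans (norm_sqn _) yb.
have -> : eball = (fun y => sqn (y - x0)) @^-1` [set r | r <= rho ^+ 2] by [].
apply: closed_comp; last exact: closed_le.
move=> y _.
suff h s : (fun z : 'rV[R]_n => \sum_(b <- s) (z - x0) 0 b ^+ 2) z @[z --> y] -->
    \sum_(b <- s) (y - x0) 0 b ^+ 2 by exact: h.
elim: s => [|b s IH].
  have -> : (fun z : 'rV[R]_n => \sum_(b <- [::]) (z - x0) 0 b ^+ 2) = cst 0.
    by apply/funext => z; rewrite big_nil.
  rewrite big_nil.
  have FF : Filter (nbhs y) := nbhs_filter y.
  move=> U /nbhs_singleton U0; change (nbhs y (fun z => U 0)); exact: filterE.
have -> : (fun z : 'rV[R]_n => \sum_(b <- b :: s) (z - x0) 0 b ^+ 2) =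
    (fun z => (z - x0) 0 b * (z - x0) 0 b + \sum_(b <- s) (z - x0) 0 b ^+ 2).
  by apply/funext => z; rewrite big_cons expr2.
have FF : Filter (nbhs y) := nbhs_filter y.
rewrite big_cons expr2; apply: (@cvgD _ _ _ (nbhs y) FF); last exact: IH.
have h : (z - x0) 0 b @[z --> y] --> (y - x0) 0 b.
  apply/cvgrPdist_lt => e e0.
  suff : \forall z \near y, `|(y - x0) 0 b - (z - x0) 0 b| < e by [].
  apply/nbhs_normP; exists e => //= z; rewrite /ball_ /= => yz.
  have -> : (y - x0) 0 b - (z - x0) 0 b = (y - z) 0 b by rewrite !mxE; ring.
  exact: le_lt_trans (ler_coord_norm _ _) yz.
exact: (@cvgM _ _ (nbhs y) FF _ _ _ _ h h).
Qed.

Definition mball : set M := param i @` eball.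

Lemma mball_dom p : mball p -> dom i p.
Proof. by move=> [y /ball_dom Dy <-]; exact: param_dom. Qed.

Lemma mball_coord p : dom i p -> sqn (coord i p - x0) <= rho ^+ 2 -> mball p.
Proof. by move=> ip h; exists (coord i p) => //; exact: coordK. Qed.

Lemma coord_mball p : mball p -> eball (coord i p).
Proof. by move=> [y yB <-]; rewrite coordE//; exact: ball_dom. Qed.

Lemma compact_mball : compact mball.
Proof.
apply: continuous_compact; last exact: compact_eball.
exact: continuous_subspaceW ball_dom (@param_cont _ _ _ A i).
Qed.

Lemma closed_mball : closed mball.
Proof. exact: compact_closed M_T2 compact_mball. Qed.

Lemma mball_Int : mball `<=` Int A.
Proof.
move=> p pB; exists i; first exact: mball_dom.
by move=> a a0; apply: ball_int a0; exact: coord_mball.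
Qed.

(** The default -1 is negative, so the positive part vanishes outside the chart as it does in the
    chart off the ball. *)
Definition mquad p : R := if pselect (dom i p) then quad (coord i p) else - 1.

Definition bumpf (k : nat) p : R := - Num.max 0 (mquad p) ^+ k.

Lemma mquadE p : dom i p -> mquad p = quad (coord i p).
Proof. by rewrite /mquad; case: pselect. Qed.

Lemma mquad_out p : ~ mball p -> mquad p < 0.
Proof.
rewrite /mquad; case: pselect => [ip|nip] /= np; last by rewrite oppr_lt0.
by rewrite ltNge quad_ge0; apply/negP => h; apply: np; exact: mball_coord.
Qed.

Lemma bumpf_out k p : (0 < k)%N -> ~ mball p -> bumpf k p = 0.
Proof.
move=> k0 /mquad_out h; rewrite /bumpf max_l ?ltW// expr0n.
by case: k k0 => // k _; rewrite oppr0.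
Qed.

Lemma bumpf_le0 k p : bumpf k p <= 0.
Proof. by rewrite oppr_le0 exprn_ge0// le_max lexx. Qed.

Lemma locf_mquad j x : img j (dom i) x -> locf j mquad x = quad (trans j i x).
Proof. by move=> [p [jp ip] <-]; rewrite /locf coordK// mquadE// transE. Qed.

Let oT j : rop (img j (dom i)). Proof. exact: rop_dom2. Qed.
Let TD j x : img j (dom i) x -> (coord i @` dom i) (trans j i x).
Proof. by move=> [p [jp ip] <-]; rewrite transE//; exists p. Qed.

Lemma Ck_mquad k j : Ck k (img j (dom i)) (locf j mquad).
Proof.
apply: (Ck_ext (f := fun x => quad (trans j i x))) => //.
  by move=> x Dx; rewrite locf_mquad.
apply: (Ck_comp (oT j) (rop_dom i) (@TD j)); first by move=> b; exact: Ck_trans.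
by apply: Ck_quad; exact: rop_dom.
Qed.

(** Two open sets cover the manifold: the chart domain, and the complement of the ball, which is
    closed because it is compact in a Hausdorff space. On the second one the function is zero. *)
Lemma smooth_bumpf k l : (k < l)%N -> smooth_fun A k (bumpf l).
Proof.
move=> kl j; apply: Ck_local; first exact: rop_dom.
move=> x [p jp <-]; have [ip|ip] := pselect (dom i p).
  exists (img j (dom i)); split=> //; first exact: img_coord.
  by apply: CkN => //; apply: Ck_maxpow => //; exact: Ck_mquad.
have oU : open (~` mball) by rewrite openC; exact: closed_mball.
exists (img j (~` mball)); split; first exact: rop_img.
  by apply: img_coord => // /mball_dom.
apply: (Ck_ext (f := fun=> 0)); [exact: rop_img| |by apply: Ck_cst; exact: rop_img].
move=> y /img_param np; rewrite /locf bumpf_out//; exact: leq_ltn_trans kl.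
Qed.

Lemma supp_bumpf k : (0 < k)%N -> supp_fun (bumpf k) `<=` mball.
Proof.
move=> k0; rewrite [mball](closure_id _).1; last exact: closed_mball.
apply: closure_subset => p /= /eqP h; apply: contrapT => np; apply: h.
exact: bumpf_out.
Qed.

Lemma compact_supp_bumpf k : (0 < k)%N -> compact (supp_fun (bumpf k)).
Proof.
move=> k0; apply: subclosed_compact (supp_bumpf k0); first exact: closed_closure.
exact: compact_mball.
Qed.

Lemma pd_bumpf j a k x : img j (dom i) x -> pd a (locf j (bumpf k.+2)) x =
  - (k.+2%:R * Num.max 0 (locf j mquad x) ^+ k.+1 * pd a (locf j mquad) x).
Proof.
move=> Dx; apply: pd_der; first exact: (oT j).1.
apply: derN; apply: (der_comp1 (F := fun w => Num.max 0 w ^+ k.+2)).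
  exact: Ck_der (Ck_mquad 1 j) Dx.
exact: is_derive_maxpow.
Qed.

Lemma pd2_bumpf j a b k x : img j (dom i) x -> pd a (pd b (locf j (bumpf k.+3))) x =
  - (k.+3%:R * k.+2%:R * Num.max 0 (locf j mquad x) ^+ k.+1
        * (pd a (locf j mquad) x * pd b (locf j mquad) x)
     + k.+3%:R * Num.max 0 (locf j mquad x) ^+ k.+2 * pd a (pd b (locf j mquad)) x).
Proof.
move=> Dx; have hx := (oT j).1 _ Dx; apply: pd_der => //.
pose F y := - (k.+3%:R * Num.max 0 (locf j mquad y) ^+ k.+2 * pd b (locf j mquad) y).
apply: (eq_der (f := F)) => //.
  by apply: filterS ((oT j).2 _ Dx) => y Dy; rewrite /F -pd_bumpf.
apply: derN.
have d1 : der a (fun y => k.+3%:R * Num.max 0 (locf j mquad y) ^+ k.+2) x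
    (k.+3%:R * (k.+2%:R * Num.max 0 (locf j mquad x) ^+ k.+1 * pd a (locf j mquad) x)).
  apply: derZ; apply: (der_comp1 (F := fun w => Num.max 0 w ^+ k.+2)).
    exact: Ck_der (Ck_mquad 1 j) Dx.
  exact: is_derive_maxpow.
have d2 := Ck_der (Ck_pd b (Ck_mquad 2 j)) Dx.
have := derM d1 (d2 a); congr (der a _ x _).
ring.
Qed.

Definition grad2 j x : R := \sum_a pd a (locf j mquad) x ^+ 2.

(** In the chart of the ball the gradient of [quad] vanishes at the center only; the invertible
    Jacobian transports this to the chart j. *)
Lemma grad2_gt0 j p : dom i p -> dom j p -> coord i p != x0 ->
  0 < grad2 j (coord j p).
Proof.
move=> ip jp px; have Dx : img j (dom i) (coord j p) by exact: img_coord.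
have g0 : 0 <= grad2 j (coord j p) by apply: sumr_ge0 => a _; exact: sqr_ge0.
rewrite lt_def g0 andbT; apply: contra_neq px => gE.
have d0 a : pd a (locf j mquad) (coord j p) = 0.
  apply/eqP; rewrite -sqrf_eq0 eq_le sqr_ge0 andbT -gE /grad2 (bigD1 a)//= lerDl.
  by apply: sumr_ge0 => b _; exact: sqr_ge0.
have E a : pd a (locf j mquad) (coord j p) =
    \sum_c jac (trans j i) (coord j p) a c * pd c quad (coord i p).
  rewrite -(transE i jp) -(Ck_comp1 a (oT j) (rop_dom i) (@TD j) _ (Ck_quad 1 (rop_dom i)) Dx).
    apply: eq_pd; first exact: (oT j).1.
    by apply: filterS ((oT j).2 _ Dx) => y Dy; rewrite locf_mquad.
  by move=> b; exact: Ck_trans.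
pose w : 'cV[R]_n := \col_c pd c quad (coord i p).
have Jw : jac (trans j i) (coord j p) *m w = 0.
  apply/matrixP => a b; rewrite [LHS]mxE [RHS]mxE; apply: etrans (d0 a); rewrite E.
  by apply: eq_bigr => c _; rewrite [w _ _]mxE.
have w0 : w = 0 by rewrite -(mulKmx (jac_unit hg jp ip) w) Jw mulmx0.
have hp : halfspace (coord i p) by apply: (rop_dom i).1; exists p.
apply/rowP => c; have /matrixP/(_ c 0) := w0; rewrite [LHS]mxE [RHS]mxE pd_quad//.
move=> /eqP; rewrite oppr_eq0 !mulf_eq0 pnatr_eq0 invr_eq0 expf_eq0 /= (gt_eqF rho0) /=.
by rewrite !mxE subr_eq0 => /eqP.
Qed.

Variable W : set M.
Hypotheses (oW : open W) (W0 : W (param i x0)).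

(** The part of the ball off the neighborhood [W] of the center: a compact set without critical
    points of psi. *)
Let bad m : set M := cset m `&` (mball `&` ~` W).

Let compact_bad m : compact (coord (cchart m) @` bad m).
Proof.
have bm : bad m `<=` dom (cchart m) by move=> p [mp _]; exact: cset_dom.
apply: continuous_compact.
  exact: continuous_subspaceW bm (@coord_cont _ _ _ A (cchart m)).
apply: compact_closedI; first exact: cset_compact.
by apply: closedI; [exact: closed_mball|rewrite closedC].
Qed.

(** A relatively open set containing the compact one, on which |d psi|^2 has no zero, so that its
    inverse is continuous there. *)
Let D' m := img (cchart m) (dom i `&` ~` [set param i x0]).

Let oD' m : rop (D' m).
Proof.
apply: rop_img; apply: openI; first exact: open_dom.
by rewrite openC; apply: accessible_closed_set1; exact: hausdorff_accessible.
Qed.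

Let bad_D' m : coord (cchart m) @` bad m `<=` D' m.
Proof.
move=> _ [p [mp [pB pW]] <-]; apply: img_coord; first exact: cset_dom.
by split; [exact: mball_dom|move=> E; apply: pW; rewrite E].
Qed.

Let D'_sub m : D' m `<=` img (cchart m) (dom i).
Proof. by move=> _ [p [jp [ip _]] <-]; exact: img_coord. Qed.

Let Cq k m : Ck k (D' m) (locf (cchart m) mquad).
Proof. exact: Ck_sub (oT _) (oD' m) (@D'_sub m) (Ck_mquad k _). Qed.

Let grad_bound : exists2 c : R, 0 < c & forall m p, bad m p ->
  c <= grad2 (cchart m) (coord (cchart m) p).
Proof.
have /choice[b hb] m : exists b : R, 0 <= b /\ forall p, bad m p ->
    `|(grad2 (cchart m) (coord (cchart m) p))^-1| <= b.
  have Cg : Ck 0 (D' m) (grad2 (cchart m)).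
    apply: Ck_sum => // a; apply: CkX => //; exact: Ck_pd (Cq 1 m).
  have g0 x : D' m x -> grad2 (cchart m) x != 0.
    move=> [p [jp [ip np]] <-]; rewrite gt_eqF// grad2_gt0//.
    by apply/eqP => E; apply: np; rewrite /= -E coordK.
  have [b b0 hb] := Ck_bdd (CkV (oD' m) g0 Cg) (@compact_bad m) (@bad_D' m).
  by exists b; split=> // p pb; apply: hb; exists p.
have B0 : 0 < 1 + \sum_m b m by rewrite ltr_wpDr// sumr_ge0// => m _; exact: (hb m).1.
exists (1 + \sum_m b m)^-1; first by rewrite invr_gt0.
move=> m p pb; have [mp [pB pW]] := pb.
have ip := mball_dom pB; have jp := cset_dom mp.
have gp : 0 < grad2 (cchart m) (coord (cchart m) p).
  apply: grad2_gt0 => //; apply/eqP => E; apply: pW.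
  by rewrite -(coordK ip) E.
rewrite -[leRHS]invrK lef_pV2 ?posrE ?invr_gt0//.
rewrite (le_trans (ler_norm _))// (le_trans ((hb m).2 p pb))// (bigD1 m)//= addrCA lerDl.
by rewrite addr_ge0// sumr_ge0// => k _; exact: (hb k).1.
Qed.

Let deriv_bound s : exists2 b : R, 0 <= b & forall m p, bad m p ->
  `|pds s (locf (cchart m) mquad) (coord (cchart m) p)| <= b.
Proof.
have /choice[b hb] m : exists b : R, 0 <= b /\ forall p, bad m p ->
    `|pds s (locf (cchart m) mquad) (coord (cchart m) p)| <= b.
  have [b b0 hb] := Ck_bdd (Ck_pds (Cq (size s + 0) m)) (@compact_bad m) (@bad_D' m).
  by exists b; split=> // p pb; apply: hb; exists p.
exists (\sum_m b m); first by apply: sumr_ge0 => m _; exact: (hb m).1.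
move=> m p pb; apply: le_trans ((hb m).2 p pb) _.
by rewrite (bigD1 m)//= lerDl sumr_ge0// => k _; exact: (hb k).1.
Qed.

(* For a large exponent the term z^(k+1) |d psi|^2 dominates all the others,
   except where d psi = 0, that is, at the center. *)
Lemma bump_plow : exists k : nat, forall m p, cset m p -> ~ W p ->
  plow C1 l2 L (bumpf k.+4) m p (Num.max 0 (mquad p) ^+ k.+2).
Proof.
have [c c0 hc] := grad_bound.
have /choice[b1 h1] a : exists b : R, 0 <= b /\ forall m p, bad m p ->
    `|pds [:: a] (locf (cchart m) mquad) (coord (cchart m) p)| <= b.
  by have [b b0 hb] := deriv_bound [:: a]; exists b.
have /choice[b2 h2] (ab : 'I_n * 'I_n) : exists b : R, 0 <= b /\ forall m p, bad m p ->
    `|pds [:: ab.1; ab.2] (locf (cchart m) mquad) (coord (cchart m) p)| <= b.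
  by have [b b0 hb] := deriv_bound [:: ab.1; ab.2]; exists b.
pose Q1 := \sum_a b1 a; pose Q2 := \sum_a \sum_b L * b2 (a, b).
have Q10 : 0 <= Q1 by apply: sumr_ge0 => a _; exact: (h1 a).1.
have Q20 : 0 <= Q2.
  by apply: sumr_ge0 => a _; apply: sumr_ge0 => b _; rewrite mulr_ge0//; exact: (h2 (a, b)).1.
(* Q2 pays for the second derivatives of psi, C1 Q1 for the first order term, C1 for the zeroth
   order term; the last 1 is the surplus. *)
pose T := Q2 + C1 * (1 + Q1) + 1.
have T0 : 0 <= T by rewrite !addr_ge0// mulr_ge0// addr_ge0.
have Tl : 0 <= T * l2 / c by rewrite divr_ge0 ?mulr_ge0 ?(ltW l20) ?(ltW c0).
pose k := Num.bound (T * l2 / c); exists k => m p mp Wp.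
have hk : T * l2 <= k.+3%:R * c.
  rewrite -ler_pdivrMr// ltW// (lt_le_trans (archi_boundP Tl))// ler_nat -/k.
  by do 3!apply: leqW.
have [pB|pB] := pselect (mball p); last first.
  rewrite max_l; last by rewrite ltW// mquad_out.
  rewrite expr0n; apply: plow_flat => //.
  have oB : open (~` mball) by rewrite openC; exact: closed_mball.
  have : \forall q \near p, ~ mball q := open_nbhs_nbhs (conj oB pB).
  by apply: filterS => q; exact: bumpf_out.
have pb : bad m p by [].
have ip := mball_dom pB; have jp := cset_dom mp.
set j := cchart m in jp *; set x := coord j p.
have Dx : img j (dom i) x by exact: img_coord.
have zE : locf j mquad x = mquad p by rewrite /locf coordK.
move=> a [pa ba]; set z := Num.max 0 (mquad p).
have z0 : 0 <= z by rewrite le_max lexx.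
have z1 : z <= 1 by rewrite ge_max ler01 mquadE// quad_le1.
pose d : 'rV[R]_n := \row_c pd c (locf j mquad) x.
have sd : sqn d = grad2 j x.
  by rewrite /sqn /grad2; apply: eq_bigr => e _; rewrite mxE.
have E2 : \sum_i0 \sum_j0 a i0 j0 * pd i0 (pd j0 (locf j (bumpf k.+4))) x =
   - (k.+4%:R * z ^+ k.+2 * (k.+3%:R * qf a d d
       + z * \sum_i0 \sum_j0 a i0 j0 * pd i0 (pd j0 (locf j mquad)) x)).
  rewrite qfE mulrDr !mulr_sumr -big_split -sumrN; apply: eq_bigr => u _ /=.
  rewrite !mulr_sumr -big_split -sumrN; apply: eq_bigr => v _ /=.
  by rewrite pd2_bumpf// zE -/z [d _ _]mxE [d _ v]mxE [z ^+ k.+3]exprS; ring.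
have E1 : \sum_i0 `|pd i0 (locf j (bumpf k.+4)) x| =
    k.+4%:R * z ^+ k.+2 * (z * \sum_i0 `|pd i0 (locf j mquad) x|).
  rewrite !mulr_sumr; apply: eq_bigr => u _; rewrite pd_bumpf// zE -/z normrN normrM.
  have e : 0 <= k.+4%:R * z ^+ k.+3 by rewrite mulr_ge0// exprn_ge0.
  by rewrite (ger0_norm e) [z ^+ k.+3]exprS; ring.
have E0 : `|locf j (bumpf k.+4) x| = z ^+ k.+2 * (z * z).
  rewrite /locf coordK// /bumpf -/z normrN ger0_norm ?exprn_ge0// !exprS; ring.
rewrite /Pop E2 E1 E0 opprK.
have S1 : \sum_i0 `|pd i0 (locf j mquad) x| <= Q1.
  by apply: ler_sum => u _; exact: (h1 u).2.
have S2 : `|\sum_i0 \sum_j0 a i0 j0 * pd i0 (pd j0 (locf j mquad)) x| <= Q2.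
  rewrite (le_trans (ler_norm_sum _ _ _))// ler_sum// => u _.
  rewrite (le_trans (ler_norm_sum _ _ _))// ler_sum// => v _.
  by rewrite normrM ler_pM//; exact: (h2 (u, v)).2.
have S0 : 0 <= \sum_i0 `|pd i0 (locf j mquad) x| by exact: sumr_ge0.
set s1 := \sum_i0 `|_| in S1 S0 *; set s2 := \sum_i0 \sum_j0 _ in S2 *.
have q1 : c <= l2 * qf a d d by rewrite (le_trans (hc m p pb))// -sd.
have q2 : T <= k.+3%:R * qf a d d.
  rewrite -(ler_pM2r l20) (le_trans hk)// -mulrA ler_wpM2l//.
  by rewrite mulrC.
set N : R := k.+4%:R; have N1 : 1 <= N by rewrite ler1n.
have Z0 : 0 <= z ^+ k.+2 by exact: exprn_ge0.
(* After z^(k+2) is factored out, the bracket multiplied by N = k + 4 is at least 1 + C1, so N >= 1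
   may be dropped, and C1 z^2 <= C1 is subtracted. *)
have -> : N * z ^+ k.+2 * (k.+3%:R * qf a d d + z * s2)
    - C1 * (z ^+ k.+2 * (z * z) + N * z ^+ k.+2 * (z * s1)) =
  z ^+ k.+2 * (N * (k.+3%:R * qf a d d + z * s2 - C1 * (z * s1)) - C1 * (z * z)).
  by ring.
rewrite -[leLHS]mulr1 ler_wpM2l//.
have t1 : - Q2 <= z * s2.
  have : `|z * s2| <= Q2.
    by rewrite normrM ger0_norm// -[leRHS]mul1r ler_pM.
  by rewrite ler_norml => /andP[].
have t2 : C1 * (z * s1) <= C1 * Q1.
  by rewrite ler_wpM2l// -[leRHS]mul1r ler_pM.
have t3 : C1 * (z * z) <= C1 by rewrite -[leRHS]mulr1 ler_wpM2l// -[leRHS]mul1r ler_pM.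
have t4 : 1 + C1 <= k.+3%:R * qf a d d + z * s2 - C1 * (z * s1).
  move: q2; rewrite /T mulrDr mulr1; move: t1 t2.
  move: (z * s2) (C1 * (z * s1)) (C1 * Q1) (k.+3%:R * _) => a1 a2 a3 a4; lra.
move: (_ - C1 * (z * s1)) t4 => y t4.
have t5 : y <= N * y by rewrite ler_peMl// (le_trans _ t4)// addr_ge0.
move: t3 t4 t5; move: (C1 * (z * z)) (N * y) => a1 a2; lra.
Qed.

Theorem bump_exists : exists f : M -> R, [/\ smooth_fun A 3 f, forall p, f p <= 0,
  compact (supp_fun f) /\ supp_fun f `<=` Int A,
  forall m p, cset m p -> ~ W p -> plow C1 l2 L f m p 0 &
  forall p, dom i p -> sqn (coord i p - x0) < rho ^+ 2 ->
    exists2 c : R, 0 < c & \forall q \near p, forall m, cset m q -> ~ W q ->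
      plow C1 l2 L f m q c].
Proof.
have [k hk] := bump_plow; exists (bumpf k.+4); split.
- exact: smooth_bumpf.
- exact: bumpf_le0.
- split; first exact: compact_supp_bumpf.
  by apply: subset_trans mball_Int; exact: supp_bumpf.
- move=> m p mp Wp; apply: plow_le (hk m p mp Wp).
  by rewrite exprn_ge0// le_max lexx.
move=> p ip hp; have qp : 0 < quad (coord i p) by rewrite quad_gt0.
exists ((quad (coord i p) / 2) ^+ k.+2); first by rewrite exprn_gt0// divr_gt0.
have Cq0 : quad y @[y --> hnbhs (coord i p)] --> quad (coord i p).
  by apply: Ck_hcont (rop_dom i) (Ck_quad 0 (rop_dom i)) _; exists p.
have h : hnbhs (coord i p) [set y | quad (coord i p) / 2 < quad y].
  apply: (cvgr_gt _ Cq0).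
  by rewrite ltr_pdivrMr// ltr_pMr// ltr1n.
apply: filterS (near_coord ip h) => q [iq hq] m mq Wq.
apply: plow_le (hk m q mq Wq).
rewrite ler_pXn2r ?nnegrE ?le_max ?lexx// ?divr_ge0 ?(ltW qp)// mquadE//.
by rewrite (ltW hq) orbT.
Qed.

End Bump.

(** * Propagation of subsolutions *)

Section Chain.
Context {R : realType} {n : nat} {M : topologicalType} (A : bd_atlas R n M).
Variables (K : norm_cover A) (C1 l2 L : R) (g : tensor A).
Hypotheses (C10 : 0 <= C1) (l20 : 0 < l2) (L0 : 0 <= L).
Hypotheses (hg : riemannian g) (M_T2 : hausdorff_space M).
Implicit Types (m : 'I_(csize K)) (p q : M) (f h : M -> R) (i j : chart A).
Variable B : set M.

Local Notation plow := (plow C1 l2 L).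

(** A convex cone: stability under sums and nonnegative multiples is what the gluing rests on. *)
Record good f : Prop := Good {
  good_smooth : smooth_fun A 3 f;
  good_le0 : forall p, f p <= 0;
  good_compact : compact (supp_fun f);
  good_Int : supp_fun f `<=` Int A;
  good_plow : forall m p, cset m p -> ~ B p -> plow f m p 0 }.

Let s2 f : smooth_fun A 3 f -> smooth_fun A 2 f.
Proof. by move=> h i; exact: Ck_le (isT : (2 <= 3)%N) (h i). Qed.

Lemma good0 : good (fun=> 0).
Proof.
have E : supp_fun (fun=> 0 : R) = set0 :> set M.
  rewrite /supp_fun (_ : [set _ | _] = set0) ?closure0//.
  by apply/seteqP; split=> // x /=; rewrite eqxx.
split=> //.
- by move=> i; apply: Ck_cst; exact: rop_dom.
- by rewrite E; exact: compact0.
- by rewrite E.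
- by move=> m p mp _; apply: plow_flat => //; apply: nearW.
Qed.

Lemma good_supp f (S : set M) : compact S -> S `<=` Int A -> closed S ->
  (forall p, ~ S p -> f p = 0) -> compact (supp_fun f) /\ supp_fun f `<=` Int A.
Proof.
move=> cS SI clS fS; have h : supp_fun f `<=` S.
  rewrite [X in _ `<=` X](closure_id _).1//; apply: closure_subset => p /= /eqP fp.
  by apply: contrapT => /fS.
split; last exact: subset_trans SI.
by apply: subclosed_compact h => //; exact: closed_closure.
Qed.

Lemma supp_out f p : ~ supp_fun f p -> f p = 0.
Proof.
by move=> np; apply: contrapT => /eqP fp; apply: np; exact: subset_closure.
Qed.

Lemma goodD f h : good f -> good h -> good (fun p => f p + h p).
Proof.
move=> gf gh.
have [] := @good_supp (fun p => f p + h p) (supp_fun f `|` supp_fun h).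
- by apply: compactU; exact: good_compact.
- by move=> p [/(good_Int gf)|/(good_Int gh)].
- by apply: closedU; exact: closed_closure.
- by move=> p /not_orP[/supp_out -> /supp_out ->]; rewrite addr0.
move=> c1 c2; split=> //.
- by apply: smooth_funD; exact: good_smooth.
- by move=> p; rewrite -[leRHS]addr0 lerD// good_le0.
- move=> m p mp Bp; rewrite -[0]addr0.
  by apply: plowD => //; [exact/s2/good_smooth|exact/s2/good_smooth|
    exact: good_plow|exact: good_plow].
Qed.

Lemma goodZ (t : R) f : 0 <= t -> good f -> good (fun p => t * f p).
Proof.
move=> t0 gf.
have [] := @good_supp (fun p => t * f p) (supp_fun f).
- exact: good_compact.
- exact: good_Int.
- exact: closed_closure.
- by move=> p /supp_out ->; rewrite mulr0.
move=> c1 c2; split=> //.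
- by apply: smooth_funZ; exact: good_smooth.
- by move=> p; rewrite mulr_ge0_le0// good_le0.
- move=> m p mp Bp; rewrite -[0](mulr0 t).
  by apply: plowZ => //; [exact/s2/good_smooth|exact: good_plow].
Qed.

(** The value 1 is a normalization, as any positive bound can be rescaled to it. *)
Definition reach : set M := [set q | exists f, good f /\
  \forall p \near q, forall m, cset m p -> ~ B p -> plow f m p 1].

Lemma open_reach q : reach q -> \forall p \near q, reach p.
Proof.
move=> [f [gf]]; rewrite -nbhs_nearE nbhsE => -[W [oW Wq] hW].
have : \forall p \near q, W p := open_nbhs_nbhs (conj oW Wq).
apply: filterS => p Wp; exists f; split=> //.
have : \forall p' \near p, W p' := open_nbhs_nbhs (conj oW Wp).
by apply: filterS => p' /hW.
Qed.

(** The start of every chain: inside [B] nothing is required, so the zero function will do. *)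
Lemma reach_B q : nbhs q B -> reach q.
Proof.
move=> hB; exists (fun=> 0); split; first exact: good0.
by apply: filterS hB => p Bp m _ /(_ Bp).
Qed.

(* The defect of a bump at its center is paid for by the subsolution that is
   already available there. *)
Lemma reach_step i x0 (rho : R) p : 0 < rho ->
    eball x0 rho `<=` coord i @` dom i ->
    (forall y (a : 'I_n), eball x0 rho y -> a = 0%N :> nat -> 0 < y 0 a) ->
    reach (param i x0) -> dom i p -> sqn (coord i p - x0) < rho ^+ 2 ->
  reach p.
Proof.
move=> rho0 hb1 hb2 [f [gf]]; rewrite -nbhs_nearE nbhsE => -[W [oW W0] hW] ip px.
have [b [sb b0 [cb ib] hb hc]] := bump_exists K C10 l20 L0 hg M_T2 rho0 hb1 hb2 oW W0.
have [bb bb0 hbb] := plow_bdd K l2 C10 L0 (s2 sb).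
have [c c0 hN] := hc p ip px.
(* On [W] the bump loses at most bb while t f gains at least t, which leaves 1. *)
pose t := bb + 1; have t0 : 0 <= t by rewrite addr_ge0.
have sf := s2 (good_smooth gf); have sb2 := s2 sb.
have stf : smooth_fun A 2 (fun q => t * f q) by exact: smooth_funZ.
have inW m q : W q -> cset m q -> ~ B q -> plow (fun q => b q + t * f q) m q 1.
  move=> Wq mq Bq; have -> : 1 = - bb + t * 1 by rewrite /t; ring.
  by apply: plowD => //; [exact: hbb|apply: plowZ => //; exact: hW].
have outW m q (d : R) : ~ W q -> cset m q -> ~ B q -> plow b m q d ->
    plow (fun q => b q + t * f q) m q d.
  move=> Wq mq Bq hd; have -> : d = d + t * 0 by rewrite mulr0 addr0.
  by apply: plowD => //; apply: plowZ => //; exact: good_plow.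
have gF : good (fun q => b q + t * f q).
  have gtf := goodZ t0 gf.
  have [] := @good_supp (fun q => b q + t * f q) (supp_fun b `|` supp_fun (fun q => t * f q)).
  - by apply: compactU => //; exact: good_compact.
  - by move=> q [/ib|/(good_Int gtf)].
  - by apply: closedU; exact: closed_closure.
  - by move=> q /not_orP[/supp_out -> /supp_out ->]; rewrite addr0.
  move=> c1 c2; split=> //.
  - by apply: smooth_funD => //; exact: good_smooth gtf.
  - by move=> q; rewrite -[leRHS]addr0 lerD//; exact: (good_le0 gtf).
  - move=> m q mq Bq; have [Wq|Wq] := pselect (W q).
      by apply: plow_le (inW m q Wq mq Bq); exact: ler01.
    by apply: outW => //; exact: hb.
(* Near p the sum gains c off [W] and 1 on [W]; dividing by the smaller one normalizes the gain. *)
pose e := Num.min c 1; have e0 : 0 < e by rewrite lt_min c0 ltr01.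
exists (fun q => e^-1 * (b q + t * f q)); split.
  by apply: goodZ => //; rewrite invr_ge0 ltW.
apply: filterS hN => q hq m mq Bq.
have -> : 1 = e^-1 * e by rewrite mulVf// gt_eqF.
apply: plowZ => //; first exact: smooth_funD.
  by rewrite invr_ge0 ltW.
have [Wq|Wq] := pselect (W q).
  by apply: plow_le (inW m q Wq mq Bq); rewrite /e ge_min lexx orbT.
apply: outW => //; apply: plow_le (hq m mq Wq).
by rewrite /e ge_min lexx.
Qed.

(** The basic sets of the filter [F] are the translates f + (good functions). A bound 1 obtained
    from f survives the addition of any good function, so near-covering compactness does the finite
    summation. *)
Lemma reach_sum V : compact V -> V `<=` reach ->
  exists2 f, good f & forall m p, V p -> cset m p -> ~ B p -> plow f m p 1.
Proof.
move=> cV VE.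
pose F : set_system (M -> R) := filter_from [set f | good f]
  (fun f => [set f' | exists2 h, good h & f' = (fun p => f p + h p)]).
have FF : Filter F.
  apply: filter_from_filter; first by exists (fun=> 0); exact: good0.
  move=> f1 f2 /= g1 g2; exists (fun p => f1 p + f2 p); first exact: goodD.
  move=> _ [h gh ->]; split.
    by exists (fun p => f2 p + h p); [exact: goodD|apply/funext => p; rewrite addrA].
  exists (fun p => f1 p + h p); first exact: goodD.
  by apply/funext => p; rewrite addrA [f1 p + _]addrC.
have /compact_near_coveringP/(_ _ F (fun f p => forall m, cset m p -> ~ B p -> plow f m p 1) FF) := cV.
case.
  move=> q /VE[f [gf hf]].
  exists ([set p | forall m, cset m p -> ~ B p -> plow f m p 1],
          [set f' | exists2 h, good h & f' = (fun p => f p + h p)]) => /=.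
    by split; [exact: hf|exists f].
  move=> [p f'] /= [hp [h gh ->]] m mp Bp; rewrite -[1]addr0.
  by apply: plowD => //; [exact/s2/good_smooth|exact/s2/good_smooth|exact: hp|exact: good_plow].
move=> f gf hf; exists (fun p => f p + 0).
  by apply: goodD => //; exact: good0.
move=> m p Vp; apply: (hf (fun p => f p + 0)) => //.
by exists (fun=> 0) => //; exact: good0.
Qed.

End Chain.

(** * Chains of coordinate balls *)

Section ReachInterior.
Context {R : realType} {n : nat} {M : topologicalType} (A : bd_atlas R n M).
Variables (K : norm_cover A) (C1 l2 L : R) (g : tensor A).
Hypotheses (C10 : 0 <= C1) (l20 : 0 < l2) (L0 : 0 <= L).
Hypotheses (hg : riemannian g) (M_T2 : hausdorff_space M).
Hypothesis n_gt0 : (0 < n)%N.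
Variable B : set M.
Implicit Types (p q : M) (i j : chart A).

Local Notation reach := (reach K C1 l2 L B).
Local Notation o := (Ordinal n_gt0).
Local Notation E0 := (delta_mx 0 (Ordinal n_gt0) : 'rV[R]_n).

Let o_eq (a : 'I_n) : a = 0%N :> nat -> a = o.
Proof. by move=> h; apply: val_inj. Qed.

Let halfspaceE (y : 'rV[R]_n) : halfspace y <-> 0 <= y 0 o.
Proof. by split=> [h|h a /o_eq ->//]; exact: h. Qed.

Lemma IntP p : Int A p <-> exists2 i : chart A, dom i p & 0 < coord i p 0 o.
Proof.
split=> [[i ip h]|[i ip h]]; exists i => //; first exact: h.
by move=> a /o_eq ->.
Qed.

Section Box.
Variables (i : chart A) (xb : 'rV[R]_n) (d : R).
Hypothesis box_dom : forall y, halfspace y -> `|y - xb| < d -> (coord i @` dom i) y.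

Let box y : Prop := `|y - xb| < d /\ 0 < y 0 o.

Let boxD y : box y -> (coord i @` dom i) y.
Proof. by move=> [h1 h2]; apply: box_dom => //; apply/halfspaceE; exact: ltW. Qed.

Lemma box_Int y : box y -> Int A (param i y).
Proof.
move=> hy; have Dy := boxD hy; apply/IntP; exists i; first exact: param_dom.
by rewrite coordE//; exact: hy.2.
Qed.

(** The box is convex: along the segment from y to y', balls of one radius r stay inside it, and
    finitely many steps shorter than r pass the property on. *)
Lemma box_reach y y' : box y -> box y' -> reach (param i y) -> reach (param i y').
Proof.
move=> by_ by' ry.
pose md := Num.max `|y - xb| `|y' - xb|; pose mo := Num.min (y 0 o) (y' 0 o).
have md_d : md < d by rewrite gt_max by_.1 by'.1.
have mo0 : 0 < mo by rewrite lt_min by_.2 by'.2.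
pose rho := Num.min (d - md) mo; have rho0 : 0 < rho by rewrite lt_min subr_gt0 md_d mo0.
pose r := rho / 2; have r0 : 0 < r by rewrite divr_gt0.
have rrho : r < rho by rewrite ltr_pdivrMr// ltr_pMr// ltr1n.
pose z (t : R) := y + t *: (y' - y).
have zb t : 0 <= t <= 1 -> `|z t - xb| <= md /\ mo <= z t 0 o.
  move=> /andP[t0 t1]; split.
    have -> : z t - xb = (1 - t) *: (y - xb) + t *: (y' - xb).
      by apply/rowP => b; rewrite !mxE; ring.
    rewrite (le_trans (ler_normD _ _))// !normrZ (ger0_norm t0) ger0_norm ?subr_ge0//.
    have -> : md = (1 - t) * md + t * md by ring.
    by rewrite lerD// ler_wpM2l ?subr_ge0// le_max lexx ?orbT.
  have -> : z t 0 o = (1 - t) * y 0 o + t * y' 0 o by rewrite !mxE; ring.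
  have -> : mo = (1 - t) * mo + t * mo by ring.
  by rewrite lerD// ler_wpM2l ?subr_ge0// ge_min lexx ?orbT.
have ball_box t w : 0 <= t <= 1 -> eball (z t) r w -> box w.
  move=> /zb[h1 h2] hw.
  have wr : `|w - z t| <= r.
    rewrite -(ler_pXn2r (n := 2)) ?nnegrE//; last exact: ltW.
    exact: le_trans (norm_sqn _) hw.
  have wrho := le_lt_trans wr rrho; split.
    rewrite -(subrKA (z t)) (le_lt_trans (ler_normD _ _))//.
    apply: (@lt_le_trans _ _ (rho + md)); first by rewrite ltr_leD.
    by rewrite -lerBrDr ge_min lexx.
  have : `|(w - z t) 0 o| < rho by rewrite (le_lt_trans (ler_coord_norm _ _)).
  rewrite ltr_norml => /andP[+ _]; rewrite [(w - z t) 0 o]mxE [(- z t) 0 o]mxE.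
  have : rho <= mo by rewrite ge_min lexx orbT.
  move: h2; move: (w 0 o) (z t 0 o) => u v; lra.
(* N exceeds |y' - y|^2 / r^2 and N^2 >= N, so the N-th part of the segment is shorter than r. *)
pose N := (Num.bound (sqn (y' - y) / r ^+ 2)).+1.
have N0 : (0 : R) < N%:R by rewrite ltr0n.
have hN : sqn (N%:R^-1 *: (y' - y)) < r ^+ 2.
  have -> : sqn (N%:R^-1 *: (y' - y)) = sqn (y' - y) / N%:R ^+ 2.
    by rewrite /sqn mulr_suml; apply: eq_bigr => b _; rewrite mxE exprMn exprVn mulrC.
  have r2 : 0 < r ^+ 2 by rewrite exprn_gt0.
  rewrite ltr_pdivrMr ?exprn_gt0// mulrC -ltr_pdivrMr//.
  have h0 : 0 <= sqn (y' - y) / r ^+ 2 by rewrite divr_ge0 ?sqn_ge0// ltW.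
  rewrite (lt_le_trans (archi_boundP h0))// (le_trans (_ : _ <= N%:R))//.
    by rewrite ler_nat /N leqnSn.
  by rewrite expr2 ler_peMl ?ler1n// ltW.
have step k : (k <= N)%N -> reach (param i (z (k%:R / N%:R))).
  elim: k => [_|k IH kN]; first by rewrite mul0r /z scale0r addr0.
  have t01 : 0 <= (k%:R / N%:R : R) <= 1.
    by rewrite divr_ge0//= ler_pdivrMr// mul1r ler_nat ltnW.
  have t01' : 0 <= (k.+1%:R / N%:R : R) <= 1.
    by rewrite divr_ge0//= ler_pdivrMr// mul1r ler_nat.
  have bz : box (z (k.+1%:R / N%:R)).
    have [h1 h2] := zb _ t01'; split; first exact: le_lt_trans md_d.
    exact: lt_le_trans h2.
  have Dz := boxD bz.
  apply: (reach_step C10 l20 L0 hg M_T2 (i := i) (x0 := z (k%:R / N%:R)) (rho := r)) => //.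
  - by move=> w /(ball_box _ _ t01) /boxD.
  - by move=> w a /(ball_box _ _ t01) [_ h] /o_eq ->.
  - by apply: IH; exact: ltnW.
  - exact: param_dom.
  rewrite coordE//.
  have -> // : z (k.+1%:R / N%:R) - z (k%:R / N%:R) = N%:R^-1 *: (y' - y).
  apply/rowP => b; rewrite !mxE -natr1; field.
  by rewrite gt_eqF.
have := step N (leqnn N); rewrite divff ?gt_eqF// /z scale1r addrC subrK.
exact.
Qed.

(* Points of the interior on the wall x_0 = 0 of the chart i are not excluded;
   they are approached by pushing them inside. *)
Lemma push q : dom i q -> `|coord i q - xb| < d -> forall U : set M, nbhs q U ->
  exists2 y, box y & U (param i y).
Proof.
move=> iq qd U hU; set x := coord i q in qd *.
have Dx : (coord i @` dom i) x by exists q.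
have hx : halfspace x by exact: (rop_dom i).1.
have /subspace_continuousP/(_ _ Dx) := @param_cont _ _ _ A i.
rewrite /from_subspace (hnbhs_within (rop_dom i) Dx) coordK// => hc.
have /hnbhsP[e e0 he] : hnbhs x [set y | U (param i y)] by exact: hc.
pose s := Num.min e (d - `|x - xb|) / 2.
have s0' : 0 < Num.min e (d - `|x - xb|) by rewrite lt_min e0 subr_gt0.
have s0 : 0 < s by rewrite divr_gt0.
have ss : s < Num.min e (d - `|x - xb|) by rewrite ltr_pdivrMr// ltr_pMr// ltr1n.
have hy : halfspace (x + s *: E0) by apply: halfspace_shift => //; exact: ltW.
exists (x + s *: E0).
  split.
    rewrite addrAC (le_lt_trans (ler_normD _ _))// norm_deltaZ gtr0_norm//.
    move: ss; rewrite lt_min => /andP[_].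
    by rewrite ltrBrDl.
  rewrite coord_shift eqxx mulr1 ltr_wpDl//.
  by apply: hx.
apply: he => //; rewrite addrC addKr norm_deltaZ gtr0_norm//.
by move: ss; rewrite lt_min => /andP[].
Qed.

(** In the chart i the point q' may sit on the wall. A point p of the open box close to q' is
    reached there, and one last step is made in a chart j that shows q' as interior, with a ball
    around p that contains q'. *)
Lemma box_reach_Int q q' : dom i q -> `|coord i q - xb| < d ->
  dom i q' -> `|coord i q' - xb| < d -> reach q -> Int A q' -> reach q'.
Proof.
move=> iq qd iq' qd' rq /IntP[j jq' j0].
have [y hy ry] := push iq qd (open_reach rq).
have all_box y' : box y' -> reach (param i y') by move=> hy'; exact: box_reach ry.
have Dx : (coord j @` dom j) (coord j q') by exists q'.
have /hnbhsP[e e0 he] := (rop_dom j).2 _ Dx.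
(* A ball of radius s whose center is within s of q' stays in the chart j and off its wall, as 2 s
   is below both bounds. *)
pose s := Num.min e (coord j q' 0 o) / 4%:R.
have s0' : 0 < Num.min e (coord j q' 0 o) by rewrite lt_min e0.
have s0 : 0 < s by rewrite divr_gt0.
have s4 : s + s < Num.min e (coord j q' 0 o).
  by rewrite /s -mulrDr gtr_pMr//; lra.
pose c : R := n%:R; have c0 : 0 < c by rewrite ltr0n.
(* Maximum-norm distance s / (n + 1) makes the Euclidean distance less than s. *)
pose s' := s / (c + 1); have s'0 : 0 < s' by rewrite divr_gt0// addr_gt0.
have near_j : nbhs q' [set p | dom j p /\ `|coord j p - coord j q'| < s'].
  by apply: (near_coord (Q := fun y => `|y - coord j q'| < s')) => //; apply/hnbhsP; exists s'.
have [y' hy' [jp pd]] := push iq' qd' near_j.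
set p := param i y' in jp pd *; have rp : reach p by exact: all_box.
have s's : s' <= s by rewrite ler_pdivrMr ?addr_gt0// ler_peMr ?(ltW s0)// lerDr ltW.
have ball_in w : eball (coord j p) s w -> `|w - coord j q'| < s + s.
  move=> hw; rewrite -(subrKA (coord j p)) (le_lt_trans (ler_normD _ _))//.
  apply: ler_ltD; last exact: lt_le_trans s's.
  rewrite -(ler_pXn2r (n := 2)) ?nnegrE//; last exact: ltW.
  exact: le_trans (norm_sqn _) hw.
have w0 w : eball (coord j p) s w -> 0 < w 0 o.
  move=> /ball_in h; have := le_lt_trans (ler_coord_norm _ o) h.
  rewrite [(w - coord j q') 0 o]mxE [(- coord j q') 0 o]mxE ltr_norml => /andP[+ _].
  move: s4; rewrite lt_min => /andP[_]; lra.
apply: (reach_step C10 l20 L0 hg M_T2 (i := j) (x0 := coord j p) (rho := s)) => //.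
- move=> w hw; apply: he.
    by apply/halfspaceE/ltW/w0.
  by rewrite (lt_trans (ball_in w hw))//; move: s4; rewrite lt_min => /andP[].
- by move=> w a hw /o_eq ->; exact: w0.
- by rewrite coordK.
apply: (@le_lt_trans _ _ (\sum_(b < n) s' ^+ 2)).
  apply: ler_sum => b _; rewrite -(real_normK (num_real _)) ler_pXn2r ?nnegrE//; last exact: ltW.
  by rewrite (le_trans (ler_coord_norm _ _))// distrC ltW.
rewrite sumr_const card_ord -[ltLHS]mulr_natl -/c /s' exprMn exprVn mulrCA.
rewrite gtr_pMr ?exprn_gt0// ltr_pdivrMr ?exprn_gt0 ?addr_gt0// mul1r.
rewrite sqrrD1 expr2.
have : 0 < c * c by rewrite mulr_gt0.
lra.
Qed.

End Box.

(** Connectedness is known for the whole manifold and not for its interior. The set [H] shown to be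
    open and closed therefore admits boundary points: it asks that all nearby interior points be
    reached. *)
Lemma reach_Int p0 : connected [set: M] -> nbhs p0 B -> Int A `<=` reach.
Proof.
move=> cM hB.
pose H : set M := [set p | \forall q \near p, Int A q -> reach q].
have oH : open H.
  rewrite openE => p; rewrite /H /= => hp.
  have := hp; rewrite -[X in X -> _]nbhs_nearE nbhsE => -[W [oW Wp] hW].
  have : \forall q \near p, W q := open_nbhs_nbhs (conj oW Wp).
  apply: filterS => q Wq.
  have : \forall q' \near q, W q' := open_nbhs_nbhs (conj oW Wq).
  by apply: filterS => q' /hW.
have cH : closed H.
  (* If p is outside [H], so is every point of a chart box around p: a point of [H] in the box would
     give a reached interior point, then all interior points of the box, and p would be in [H]. *)
  rewrite -[H]setCK closedC openE => p Hp.
  pose i := chart_at A p; have ip : dom i p by exact: dom_chart_at.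
  have Dp : (coord i @` dom i) (coord i p) by exists p.
  have /hnbhsP[d d0 hd] := (rop_dom i).2 _ Dp.
  have near_i : \forall q \near p, dom i q /\ `|coord i q - coord i p| < d.
    by apply: (near_coord (Q := fun y => `|y - coord i p| < d)) => //; apply/hnbhsP; exists d.
  apply: filterS (near_i) => q [iq qd] Hq; apply: Hp; rewrite /H /=.
  have box_dom y : halfspace y -> `|y - coord i p| < d -> (coord i @` dom i) y.
    by move=> hy dy; apply: hd.
  have [y hy ry] := push iq qd Hq.
  have Iy := box_Int box_dom hy.
  have iy : dom i (param i y) by apply: param_dom; apply: box_dom hy.1; apply/halfspaceE/ltW; exact: hy.2.
  have yd : `|coord i (param i y) - coord i p| < d.
    by rewrite coordE ?hy.1//; apply: box_dom hy.1; apply/halfspaceE/ltW; exact: hy.2.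
  apply: filterS (near_i) => q' [iq' qd'] Iq'.
  exact: (box_reach_Int box_dom iy yd iq' qd' (ry Iy) Iq').
have HT : H = setT.
  apply: cM.
  - exists p0; rewrite /H /=.
    have := hB; rewrite nbhsE => -[W [oW Wp] hW].
    have : \forall q \near p0, W q := open_nbhs_nbhs (conj oW Wp).
    apply: filterS => q Wq _; apply: reach_B.
    have : \forall q' \near q, W q' := open_nbhs_nbhs (conj oW Wq).
    by apply: filterS => q' /hW.
  - by exists H; rewrite ?setTI.
  - by exists H; rewrite ?setTI.
move=> p Ip; have : H p by rewrite HT.
by rewrite /H /= => /nbhs_singleton; exact.
Qed.

End ReachInterior.

(** * Riemannian balls are neighborhoods of their center *)

Import HBNNSimple.

Section Curves.
Context {R : realType} {n : nat}.
Implicit Types (D : set 'rV[R]_n) (f : 'rV[R]_n -> R) (x v : 'rV[R]_n).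

(** The direction v is arbitrary, not a coordinate axis, so strict differentiability is used
    directly. *)
Lemma is_derive_line D f x v (z : R) : rop D -> Ck 1 D f -> D (x + z *: v) ->
  (\forall w \near z, halfspace (x + w *: v)) ->
  is_derive z 1 (fun w => f (x + w *: v)) (\sum_a pd a f (x + z *: v) * v 0 a).
Proof.
move=> oD hf Dz hz; set l := \sum_a _.
suff h : (r^-1 *: (((fun w => f (x + w *: v)) \o shift z) (r *: 1) -
    f (x + z *: v))) @[r --> 0^'] --> l.
  by apply: DeriveDef; [apply/cvg_ex; eexists; exact: h|exact: cvg_lim h].
apply/cvgrPdist_le => e e0; pose c := `|v| + 1.
have c0 : 0 < c by rewrite ltr_wpDl.
have [d d0 hd] := Ck_sdiff oD hf Dz (divr_gt0 e0 c0).
have dc0 : 0 < d / c by rewrite divr_gt0.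
have /nbhs_normP[d' /= d'0 hd'] := hz.
have m0 : 0 < Num.min d' (d / c) by rewrite lt_min d'0.
have : \forall r \near nbhs (0 : R), `|r| < Num.min d' (d / c) by exact: (@nbhs0_lt R R^o _ m0).
move=> /nbhs_dnbhs; apply: filterS2 (nbhs_dnbhs_neq _) => r /= r0.
rewrite lt_min => /andP[rd' rd]; rewrite [r *: 1]mulr1 [_ *: _]mulrC.
have h1 : halfspace (x + (r + z) *: v).
  by apply: hd'; rewrite /= /ball_ /= opprD addrCA subrr addr0 normrN.
have h0 : halfspace (x + z *: v) by apply: hd'; rewrite /= /ball_ /= subrr normr0.
have E : x + (r + z) *: v - (x + z *: v) = r *: v.
  by rewrite scalerDl [_ + z *: v]addrC opprD addrACA subrr add0r addrC addrA addNr add0r.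
have rv : `|r *: v| <= `|r| * c by rewrite normrZ ler_wpM2l// lerDl.
have := hd _ _ h0 h1; rewrite subrr normr0 E => /(_ d0).
have rvd : `|r *: v| < d by rewrite (le_lt_trans rv)// -ltr_pdivlMr.
move=> /(_ rvd).
have -> : \sum_a pd a f (x + z *: v) * (r *: v) 0 a = r * l.
  by rewrite mulr_sumr; apply: eq_bigr => a _; rewrite mxE mulrCA.
move: (f _) (f _) => F0 F1 H.
have -> : l - (F1 - F0) / r = - ((F1 - F0 - r * l) / r) by field.
rewrite normrN normrM normfV ler_pdivrMr ?normr_gt0// (le_trans H)//.
rewrite (le_trans (ler_wpM2l (ltW (divr_gt0 e0 c0)) rv))//.
by rewrite mulrCA divfK ?gt_eqF// mulrC.
Qed.

(* No measurability assumption on f: its integral is a supremum over simple functions. *)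
Lemma integral_le_cst (f : R -> R) (c : R) : (forall t, 0 <= f t <= c) ->
  (\int[lebesgue_measure]_(t in `[0%R, 1%R]) (f t)%:E <= c%:E)%E.
Proof.
move=> hf; rewrite ge0_integralE; last by move=> t _; rewrite lee_fin; case/andP: (hf t).
apply: ge_ereal_sup => _ [h hh <-]; rewrite -integralT_nnsfun.
have mI : measurable (`[0, 1]%classic : set R) by [].
have IE : (\int[lebesgue_measure]_(t in `[0%R, 1%R]) (cst c%:E) t = c%:E :> \bar R)%E.
  rewrite integral_cst// /=; rewrite [X in (_ * X)%E](_ : _ = 1%E) ?mule1//.
  by rewrite lebesgue_measure_itv/= lte_fin ltr01 oppr0 adde0.
rewrite -IE [leRHS]integral_mkcond; apply: ge0_le_integral => //.
- by move=> t _; rewrite lee_fin fun_ge0.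
- by apply/measurable_EFinP.
- exact/(measurable_restrictT (cst c%:E : measurableTypeR R -> \bar R) mI)/measurable_cst.
- move=> t _; rewrite (le_trans (hh t))// /patch; case: ifP => // _.
  by rewrite lee_fin; case/andP: (hf t).
Qed.

End Curves.

Section MetricBall.
Context {R : realType} {n : nat} {M : topologicalType} (A : bd_atlas R n M).
Variable g : tensor A.
Hypotheses (hg : riemannian g) (Cg : Ck_field 1 setT g).
Implicit Types (p q : M) (i j : chart A).

Lemma metric_ball_center p (r : R) : 0 < r -> metric_ball g p r p.
Proof.
move=> r0; exists (fun=> p); split=> //; last first.
  rewrite /curve_length integral0_eq ?lte_fin// => t _; congr EFin.
  suff : velocity A (fun=> p) t = 0.
    by move=> v0; rewrite /speed v0 !mul0mx mxE sqrtr0.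
  by apply/rowP => b; rewrite !mxE derive1E derive_cst.
split=> [t|t i ip b]; first exact: cst_continuous.
split; first exact: derivable_cst.
rewrite (_ : derive1 _ = fun=> 0); first exact: cst_continuous.
by apply/funext => s; rewrite derive1E derive_cst.
Qed.

Section Segment.
Variables (i : chart A) (x0 v : 'rV[R]_n).

(* The parametrization by a sine keeps the segment inside the chart for all times. *)
Let T (s : R) : 'rV[R]_n := x0 + sin (s * (pi / 2)) *: v.
Let c (s : R) : M := param i (T s).

Hypothesis hdom : forall z : R, `|z| < 2 -> (coord i @` dom i) (x0 + z *: v).

Let T_dom s : (coord i @` dom i) (T s).
Proof. by apply: hdom; rewrite (le_lt_trans (sin_max _))// ltr1n. Qed.

Let ip s : dom i (c s). Proof. exact: param_dom. Qed.

Let coord_c s : coord i (c s) = T s. Proof. exact: coordE. Qed.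

Let T_half s : halfspace (T s). Proof. exact: (rop_dom i).1. Qed.

Let cont_chi : continuous (fun s : R => sin (s * (pi / 2))).
Proof. by move=> s; apply: continuous_comp; [exact: mulrr_continuous|exact: continuous_sin]. Qed.

Let cvg_T t : T s @[s --> t] --> hnbhs (T t).
Proof.
apply: cvg_hnbhs_rowv => [|b]; first by near=> s; exact: T_half.
under eq_fun do rewrite !mxE; rewrite !mxE.
apply: cvgD; first exact: cvg_cst.
by apply: cvgMl; exact: cont_chi.
Unshelve. all: by end_near.
Qed.

Let cont_c : continuous c.
Proof.
move=> t; have Dt := T_dom t.
have /subspace_continuousP/(_ _ Dt) := @param_cont _ _ _ A i.
by rewrite (hnbhs_within (rop_dom i) Dt) => h P /h; exact: cvg_T.
Qed.

Let dchi (s : R) : R := cos (s * (pi / 2)) * (pi / 2).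

Let is_derive_c j b t : dom j (c t) -> is_derive t 1 (fun s => coord j (c s) 0 b)
  (dchi t * \sum_a pd a (fun y => trans i j y 0 b) (T t) * v 0 a).
Proof.
move=> jt; rewrite mulrC.
have Dt : img i (dom j) (T t) by rewrite -coord_c; exact: img_coord.
apply: (@is_derive1_comp R (fun z => trans i j (x0 + z *: v) 0 b)
  (fun s => sin (s * (pi / 2)))).
  apply: (is_derive_line (rop_dom2 i j)) => //; first exact: Ck_trans.
  have : \forall w \near (sin (t * (pi / 2)) : R), `|w| < 2.
    apply/nbhs_normP; exists 1 => //= w; rewrite /ball_ /= distrC => hw.
    have := sin_max (t * (pi / 2)); move: (sin _) hw => z hw hz.
    rewrite -(subrK z w) (le_lt_trans (ler_normD _ _))//.
    by rewrite -[ltRHS]/(1 + 1) ltr_leD.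
  by apply: filterS => w hw; apply: (rop_dom i).1; exact: hdom.
apply: (@is_derive1_comp R sin (fun s => s * (pi / 2))).
have -> : (fun s : R => s * (pi / 2)) = (pi / 2) \*: id by apply/funext => s; rewrite mulrC.
by rewrite -[X in is_derive _ _ _ X]mulr1; exact: is_deriveZ.
Qed.

Let near_dom j t : dom j (c t) -> \forall s \near t, dom j (c s).
Proof. by move=> jt; apply: cont_c; exact: open_nbhs_nbhs (conj (@open_dom _ _ _ A j) jt). Qed.

Lemma segment_C1 : C1_curve A c.
Proof.
split=> // t j jt b; have dt := is_derive_c b jt; split; first exact: ex_derive.
have dE : \forall s \near t, derive1 (fun s => coord j (c s) 0 b) s =
    dchi s * \sum_a pd a (fun y => trans i j y 0 b) (T s) * v 0 a.
  by apply: filterS (near_dom jt) => s js; rewrite derive1E; have d := is_derive_c b js; exact: derive_val.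
suff : derive1 (fun s => coord j (c s) 0 b) s @[s --> t] -->
  derive1 (fun s => coord j (c s) 0 b) t by [].
rewrite (nbhs_singleton dE); apply: (cvg_near_eq (f := fun s => dchi s *
    \sum_a pd a (fun y => trans i j y 0 b) (T s) * v 0 a)).
  by apply: filterS dE => s ->.
have Dt : img i (dom j) (T t) by rewrite -coord_c; exact: img_coord.
apply: cvgM.
  apply: cvgMl; apply: continuous_comp; [exact: mulrr_continuous|exact: continuous_cos].
apply: cvg_big => [|a _]; first exact: add_continuous.
apply: cvgMl => P /(Ck_hcont (rop_dom2 i j) (Ck_pd a (Ck_trans i j 1 b)) Dt).
exact: cvg_T.
Qed.

(** The velocity is read in [chart_at (c t)], which varies with t; the transformation law of g
    brings it back to the chart i. *)
Lemma segment_speed t : speed g c t = Num.sqrt (dchi t ^+ 2 * qf (loc i g (T t)) v v).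
Proof.
set j := chart_at A (c t); have jt : dom j (c t) by exact: dom_chart_at.
have vE : velocity A c t = dchi t *: (v *m jac (trans i j) (T t)).
  apply/rowP => b; rewrite [LHS]mxE -/j derive1E; have d := is_derive_c b jt.
  rewrite derive_val [RHS]mxE mxE; congr (_ * _).
  by apply: eq_bigr => a _; rewrite jacE mulrC.
rewrite /speed vE -/j; congr Num.sqrt.
rewrite -/(qf (g j (c t)) _ _) qfZl qfZr mulrA -expr2; congr (_ * _).
rewrite /loc -/(c t) (sym_02_jac hg.1 (ip t) jt) coord_c.
by rewrite /qf trmx_mul !mulmxA.
Qed.

End Segment.

(** Points near p are joined to p by coordinate segments, whose length is at most a constant times
    the coordinate distance. *)
Lemma metric_ball_nbhs (n_gt0 : (0 < n)%N) p (r : R) : 0 < r -> Int A p ->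
  nbhs p (metric_ball g p r).
Proof.
move=> r0 /(IntP A n_gt0)[i ip]; set o := Ordinal n_gt0; set x0 := coord i p => xo.
have Dx0 : (coord i @` dom i) x0 by exists p.
pose G : R := 1 + \sum_a \sum_b `|loc i g x0 a b|.
have G1 : 1 <= G by rewrite lerDl sumr_ge0// => a _; exact: sumr_ge0.
have [d d0 hd] : exists2 d : R, 0 < d & forall y, `|y - x0| < d ->
    (coord i @` dom i) y /\ forall a b, `|loc i g y a b| <= G.
  have h : \forall y \near hnbhs x0,
      (coord i @` dom i) y /\ forall a b, `|loc i g y a b| <= G.
    apply: filterI; first exact: (rop_dom i).2.
    apply: (@filter_forall _ _ (fun a y => forall b, `|loc i g y a b| <= G) (hnbhs x0)) => a.
    apply: (@filter_forall _ _ (fun b y => `|loc i g y a b| <= G) (hnbhs x0)) => b.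
    have /cvgrPdist_le/(_ _ ltr01) := Ck_hcont (rop_dom i) (Ck_field_loc i Cg a b) Dx0.
    apply: filterS => y; rewrite distrC => hy.
    rewrite -(subrK (loc i g x0 a b) (loc i g y a b)) (le_trans (ler_normD _ _))//.
    rewrite lerD// (bigD1 a)//= (bigD1 b)//= -addrA lerDl addr_ge0// sumr_ge0// => a' _.
    by rewrite sumr_ge0.
  have /hnbhsP[d d0 hd] := h.
  (* Below the distance to the wall the half-space condition is automatic. *)
  exists (Num.min d (x0 0 o)); first by rewrite lt_min d0.
  move=> y; rewrite lt_min => /andP[yd yo]; apply: hd => // a /= a0.
  have -> : a = o by apply: val_inj.
  have := le_lt_trans (ler_coord_norm (y - x0) o) yo.
  rewrite [(y - x0) 0 o]mxE [(- x0) 0 o]mxE ltr_norml => /andP[+ _].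
  by move: (y 0 o) (x0 0 o) => a1 a2; lra.
(* The squared speed is at most (pi / 2)^2 n G n |v|^2, and G <= G^2 since G >= 1. *)
pose c : R := pi / 2 * n%:R * G.
have c0 : 0 < c by rewrite !mulr_gt0// ?pi_gt0 ?ltr0n// (lt_le_trans ltr01).
(* Half of d, because the segment must remain in the chart for all parameters below 2 in absolute
   value; r / c makes the length less than r. *)
have e0 : 0 < Num.min (d / 2) (r / c) by rewrite lt_min !divr_gt0.
have : \forall q \near p, dom i q /\ `|coord i q - x0| < Num.min (d / 2) (r / c).
  apply: (near_coord (Q := fun y => `|y - x0| < Num.min (d / 2) (r / c))) => //.
  by apply/hnbhsP; exists (Num.min (d / 2) (r / c)).
apply: filterS => q [iq]; set v := coord i q - x0; rewrite lt_min => /andP[vd vr].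
have zd (z : R) : `|z| < 2 -> `|z *: v| < d.
  move=> z2; rewrite normrZ (@le_lt_trans _ _ (2 * `|v|))//.
    by rewrite ler_wpM2r// ltW.
  by rewrite mulrC -ltr_pdivlMr.
have hdom (z : R) : `|z| < 2 -> (coord i @` dom i) (x0 + z *: v).
  by move=> z2; apply: (hd _ _).1; rewrite addrC addKr; exact: zd.
exists (fun s => param i (x0 + sin (s * (pi / 2)) *: v)); split.
- exact: segment_C1.
- by rewrite mul0r sin0 scale0r addr0 coordK.
- by rewrite mul1r sin_pihalf scale1r addrC subrK coordK.
rewrite /curve_length; apply: (@le_lt_trans _ _ (c * `|v|)%:E); last first.
  by rewrite lte_fin mulrC -ltr_pdivlMr.
apply: integral_le_cst => t; rewrite sqrtr_ge0 /= segment_speed//.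
have cv0 : 0 <= c * `|v| by rewrite mulr_ge0// ltW.
set y := x0 + _; have yd : `|y - x0| < d.
  by rewrite /y addrC addKr zd// (le_lt_trans (sin_max _))// ltr1n.
have [_ gG] := hd y yd.
rewrite -(ger0_norm cv0) -sqrtr_sqr ler_wsqrtr//.
have h1 : qf (loc i g y) v v <= n%:R * G * (n%:R * `|v| ^+ 2).
  rewrite (le_trans (ler_norm _))// (le_trans (qf_ge _ gG))//.
  rewrite ler_wpM2l//.
    by rewrite mulr_ge0// (le_trans ler01).
  rewrite /sqn mulr_natl -[X in _ *+ X](card_ord n) -sumr_const.
  apply: ler_sum => b _; rewrite -(real_normK (num_real (v 0 b))).
  by rewrite ler_pXn2r ?nnegrE// ler_coord_norm.
have h2 : (cos (t * (pi / 2)) * (pi / 2)) ^+ 2 <= (pi / 2 : R) ^+ 2.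
  by rewrite exprMn ler_piMl ?sqr_ge0//.
apply: (le_trans (ler_wpM2l (sqr_ge0 _) h1)).
apply: (@le_trans _ _ ((pi / 2) ^+ 2 * (n%:R * G * (n%:R * `|v| ^+ 2)))).
  by rewrite ler_wpM2r// !mulr_ge0// (le_trans ler01).
have : (0 : R) <= pi / 2 by rewrite divr_ge0// pi_ge0.
rewrite /c; move: (pi / 2) => w w0.
have -> : (w * n%:R * G * `|v|) ^+ 2 = G * (w ^+ 2 * (n%:R * G * (n%:R * `|v| ^+ 2))).
  by ring.
have G0 : 0 <= G by exact: le_trans G1.
by rewrite ler_peMl// !mulr_ge0.
Qed.

End MetricBall.

(** * Conclusion *)

Section ConformalPerturbation.
Context {R : realType} {n : nat} {M : topologicalType} (A : bd_atlas R n M).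
Implicit Types (f : M -> R) (h : tensor A).

Lemma Ck_conf_tensor k f h : smooth_fun A k f -> Ck_field k setT h ->
  Ck_field k setT (conf_tensor f h).
Proof.
move=> hf hh a b i; rewrite setIT.
apply: (Ck_ext (rop_dom i) (f := fun x => locf i f x * loc i h x a b)).
  by move=> x _; rewrite [RHS]mxE.
exact: CkM (rop_dom i) (hf i) (Ck_field_loc i hh a b).
Qed.

Lemma sym_02_conf_tensor f h : sym_02 h -> sym_02 (conf_tensor f h).
Proof.
move=> [hs ht]; split=> [i p ip|i j p ip jp]; rewrite /conf_tensor.
  by rewrite linearZ /= hs.
by rewrite (ht i j p ip jp) -scalemxAr -scalemxAl.
Qed.

Lemma supp_conf_tensor f h : supp_field (conf_tensor f h) `<=` supp_fun f.
Proof.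
apply: closure_subset => p [i ip]; apply: contra_neq => fp.
by rewrite /conf_tensor fp scale0r.
Qed.

Lemma conf_tensorZ (t : R) f h :
  conf_tensor (fun q => t * f q) h = fun i p => t *: conf_tensor f h i p.
Proof. by apply/funext => i; apply/funext => p; rewrite /conf_tensor scalerA. Qed.

Lemma supp_funZ (t : R) f : supp_fun (fun q => t * f q) `<=` supp_fun f.
Proof. by apply: closure_subset => p /=; apply: contra_neq => ->; rewrite mulr0. Qed.

Lemma Ck_field0 k : Ck_field k setT (fun (_ : chart A) _ => 0).
Proof.
move=> a b i; apply: (Ck_ext _ (f := fun=> 0)).
- by rewrite setIT; exact: rop_dom.
- by move=> x _; rewrite mxE.
- by apply: Ck_cst; rewrite setIT; exact: rop_dom.
Qed.

End ConformalPerturbation.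

Theorem theorem8 (R : realType) (n : nat) (n_ge3 : (3 <= n)%N)
    (alpha : R) (alpha_gt0 : 0 < alpha) (alpha_lt1 : alpha < 1)
    (Omega : topologicalType) (A : bd_atlas R n Omega) (K : norm_cover A)
    (Omega_T2 : hausdorff_space Omega)
    (Omega_compact : compact [set: Omega])
    (Omega_connected : connected [set: Omega])
    (boundary_n0 : ~` Int A !=set0)
    (g pi : tensor A)
    (g_pi_data : init_data K alpha (g, pi))
    (g_C5 : Ck_field 5 (Int A) g)
    (pi_C4 : Ck_field 4 (Int A) pi)
    (p0 : Omega) (r0 : R) (r0_gt0 : 0 < r0)
    (B : set Omega) (B_ball : B = metric_ball g p0 r0) (B_Int : B `<=` Int A)
    (delta : R) (delta_gt0 : 0 < delta) :
  exists2 U : set (tensor A * tensor A), data_nbhs K alpha (g, pi) U &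
  forall V : set Omega, compact (closure V) -> closure V `<=` Int A ->
  exists epsilon C : R, [/\ 0 < epsilon, 0 < C &
  forall (gamma tau : tensor A) (u : Omega -> R), U (gamma, tau) ->
    holder_fun K 0 alpha u ->
    compact (supp_fun u) -> supp_fun u `<=` V ->
    (norm_fun K 0 alpha u < epsilon%:E)%E ->
  exists h w : tensor A,
    [/\ sym_02 h, sym_20 w, holder_field K 2 alpha h & holder_field K 2 alpha w]
    /\
    [/\ compact (supp_field h), supp_field h `<=` Int A,
        compact (supp_field w) & supp_field w `<=` Int A]
    /\
    (norm_field K 2 alpha h + norm_field K 2 alpha w
       <= C%:E * norm_fun K 0 alpha u)%E
    /\
    riemannian (tensorD gamma h)
    /\
    forall p : Omega,
      sigma gamma tau p + u p - delta * \1_B p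
        <= sigma (tensorD gamma h) (tensorD tau w) p].
Proof.
have n_gt0 : (0 < n)%N by exact: leq_trans n_ge3.
have hg : riemannian g by case: g_pi_data.
have Cg : Ck_field 4 setT g by case: g_pi_data => _ _ [].
have Bp0 : B p0 by rewrite B_ball; exact: metric_ball_center.
have nB : nbhs p0 B.
  rewrite B_ball; apply: metric_ball_nbhs => //; last exact: B_Int.
  exact: Ck_field_le (isT : (1 <= 4)%N) Cg.
have [r [k1 [C1 [l2 [L [[r_gt0 k10 C10 l20 L0] main]]]]]] := main_estimate n_ge3 p0 g_pi_data.
(* The radius r is chosen before V; only the subsolution, and with it epsilon and C, depend on V. *)
exists [set y | init_data K alpha y /\
  (norm_field K 4 alpha (tensorB y.1 g) + norm_field K 3 alpha (tensorB y.2 pi) < r%:E)%E].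
  by split=> [y []//|]; exists r.
move=> V cV VI.
have [f gf fV] := reach_sum C10 cV
  (subset_trans VI (reach_Int K C10 l20 L0 hg Omega_T2 n_gt0 Omega_connected nB)).
have Cf := good_smooth gf.
have Cf2 : smooth_fun A 2 f := smooth_fun_le (isT : (2 <= 3)%N) Cf.
have [b0 b00 hb0] := smooth_bdd K (s := [::]) Cf isT.
have /choice[b1 hb1] (a : 'I_n) : exists b : R, 0 <= b /\ forall (m : 'I_(csize K)) p, cset m p ->
    `|pd a (locf (cchart m) f) (coord (cchart m) p)| <= b.
  by have [b ? ?] := smooth_bdd K (s := [:: a]) Cf isT; exists b.
have [bd bd0 hbd] := plow_bdd K l2 C10 L0 Cf2.
have hf p : `|f p| <= b0.
  have [m /interior_subset mp] := @cset_cover _ _ _ _ K p.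
  by have := hb0 m p mp; rewrite /= /locf (coordK (cset_dom mp)).
have Chf : Ck_field 3 setT (conf_tensor f g).
  by apply: Ck_conf_tensor => //; exact: Ck_field_le (isT : (3 <= 4)%N) Cg.
have a01 : 0 < alpha < 1 by rewrite alpha_gt0.
have [c c0 hc] := norm_field_scale K a01 Chf.
have [c' _ hc'] := norm_field_scale K a01 (@Ck_field0 _ _ _ A 3).
pose B1 := \sum_a b1 a.
have b1_ge0 a : 0 <= b1 a by case: (hb1 a).
have hB1 a : b1 a <= B1 by rewrite /B1 (bigD1 a)//= lerDl sumr_ge0.
have B1_ge0 : 0 <= B1 by rewrite sumr_ge0.
have e1 : 0 < k1 / (b0 + 1) by rewrite divr_gt0// ltr_wpDl.
have e2 : 0 < (B1 + 1)^-1 by rewrite invr_gt0 ltr_wpDl.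
have e3 : 0 < delta / (bd + 1) by rewrite divr_gt0// ltr_wpDl.
(* For t below epsilon: t |f| <= k1 and t |df| <= 1, as [main_estimate] requires, and t (bd + 1) <=
   delta, for the ball. The terms + 1 keep the quotients and the constant C positive. *)
exists (Num.min (k1 / (b0 + 1)) (Num.min (B1 + 1)^-1 (delta / (bd + 1)))), (c + 1); split.
- by rewrite !lt_min e1 e2.
- by rewrite ltr_wpDl.
move=> gamma tau u [Dgt near_gt] Cu _ suppu.
have u_le p := norm_fun_ge K alpha u p.
have fin_u : norm_fun K 0 alpha u \is a fin_num.
  rewrite ge0_fin_numE; first by case: Cu.
  exact: le_trans (u_le p0).
rewrite -(fineK fin_u) in u_le *; set t := fine _ in u_le *.
have {}u_le p : `|u p| <= t by have := u_le p; rewrite lee_fin.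
have t0 : 0 <= t by exact: le_trans (u_le p0).
rewrite lte_fin !lt_min => /and3P[t1 t2 t3].
have tk : t * b0 <= k1.
  move: t1; rewrite ltr_pdivlMr ?ltr_wpDl// mulrDr mulr1 => /ltW; apply: le_trans.
  by rewrite lerDl.
have tB : t * B1 <= 1.
  move: t2; rewrite -[X in _ < X]mul1r ltr_pdivlMr ?ltr_wpDl// mulrDr mulr1 => /ltW.
  by apply: le_trans; rewrite lerDl.
have td : t * bd + t <= delta.
  by move: t3; rewrite ltr_pdivlMr ?ltr_wpDl// mulrDr mulr1 => /ltW.
have hk q : - k1 <= t * f q <= 0.
  rewrite (mulr_ge0_le0 t0 (good_le0 gf q)) andbT lerNl -mulrN (le_trans _ tk)// ler_wpM2l//.
  by rewrite (le_trans _ (hf q))// -normrN ler_norm.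
have h1 (m : 'I_(csize K)) p a : cset m p -> `|t * pd a (locf (cchart m) f) (coord (cchart m) p)| <= 1 :> R.
  move=> mp; rewrite normrM (ger0_norm t0) (le_trans _ tB)// ler_wpM2l//.
  exact: le_trans (proj2 (hb1 a) m p mp) (hB1 a).
have [hg' hsig] := main gamma tau f t Dgt near_gt Cf2 t0 hk h1.
pose h := conf_tensor (fun q => t * f q) g.
have hE : h = fun i p => t *: conf_tensor f g i p by exact: conf_tensorZ.
pose w : tensor A := fun _ _ => 0.
(* As a multiple by 0, w has norm zero by the scaling bound. *)
have wE : w = fun i p => 0 *: w i p by apply/funext => i; apply/funext => p; rewrite scale0r.
have supp_h : supp_field h `<=` supp_fun f.
  exact: subset_trans (@supp_conf_tensor _ _ _ _ _ _) (@supp_funZ _ _ _ _).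
have supp_w : supp_field w = set0.
  rewrite /supp_field (_ : [set _ | _] = set0) ?closure0//.
  by apply/seteqP; split=> // p [i _] /=; rewrite /w eqxx.
have norm_h : (norm_field K 2 alpha h <= (t * c)%:E)%E by rewrite hE; exact: hc.
have norm_w : (norm_field K 2 alpha w <= 0)%E.
  by rewrite wE; have := hc' 0 (lexx _); rewrite mul0r.
have Ch : Ck_field 2 setT h.
  apply: Ck_conf_tensor; first exact: smooth_funZ.
  exact: Ck_field_le (isT : (2 <= 4)%N) Cg.
exists h, w; split; [split|split; [split|split; [|split]]].
- by apply: sym_02_conf_tensor; exact: hg.1.
- by split=> [i p _|i j p _ _]; rewrite /w ?trmx0 ?mulmx0 ?mul0mx.
- by split=> //; exact: le_lt_trans norm_h (ltry _).
- by split; [exact: Ck_field0|exact: le_lt_trans norm_w (ltry _)].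
- exact: subclosed_compact (@closed_closure _ _) (good_compact gf) supp_h.
- exact: subset_trans supp_h (good_Int gf).
- by rewrite supp_w; exact: compact0.
- by rewrite supp_w.
- rewrite (le_trans (leeD norm_h norm_w))// adde0 -EFinM lee_fin mulrC ler_wpM2r//.
  by rewrite lerDl.
- exact: hg'.
move=> p.
have -> : tensorD tau w = tau.
  by apply/funext => i; apply/funext => q; rewrite /tensorD /w addr0.
have [m /interior_subset mp] := @cset_cover _ _ _ _ K p.
have [a [a1 a2 Hs]] := hsig m p mp.
have key z : plow C1 l2 L f m p z -> sigma gamma tau p + t * z <= sigma (tensorD gamma h) tau p.
  move=> /(_ a (conj a1 a2)); rewrite /Pop /locf (coordK (cset_dom mp)) -/(locf _ f) => hz.
  apply: le_trans Hs; move: (ler_wpM2l t0 hz).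
  move: (\sum_i _) (\sum_i _) (sigma gamma tau p) => S1 S2 s0; lra.
have up : u p <= t by exact: le_trans (ler_norm _) (u_le p).
(* In B, delta covers the loss t bd and u <= t. In the closure of V off B, the gain is t >= u.
   Elsewhere u = 0 and nothing is lost. *)
rewrite indicE; have [Bp|nBp] := pselect (B p).
  rewrite mem_set// mulr1; apply: le_trans (key _ (hbd m p mp)).
  by lra.
rewrite memNset// mulr0 subr0; have [Vp|nVp] := pselect (closure V p).
  by apply: le_trans (key _ (fV m p Vp mp nBp)); rewrite mulr1 lerD2l.
have -> : u p = 0.
  apply: contrapT => /eqP up0; apply: nVp; apply: subset_closure; apply: suppu.
  exact: subset_closure.
by rewrite addr0; have := key _ (good_plow gf mp nBp); rewrite mulr0 addr0.
Qed.
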